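(* Let $k\geq1$. The class of ${\mathrm{PCF}}^\Omega_k$-denotable procedures-in-environment $\Gamma\vdash p$ is the class generated inductively by the following rules: 1. If $\Gamma\vdash q_i$ is denotable for each $i<r$ and $x\in\Gamma$, then $\Gamma\vdash\lambda.\mathtt{case}\ x\,q_0\cdots q_{r-1}\ \mathtt{of}\ (j\Rightarrow j)$ is denotable. 2. If $\Gamma,x\vdash p$ is denotable, then $\Gamma\vdash\lambda x.p$ is denotable. 3. Each $\Gamma\vdash\lambda.n$ is denotable. 4. If $\Gamma\vdash p$ is denotable and $f:\mathbb{N}\rightharpoonup\mathbb{N}$, then $\Gamma\vdash p[i\mapsto f(i)]$ is denotable. 5. If $\Gamma\vdash p$, $\Gamma\vdash\lambda.d$ and $\Gamma\vdash\lambda.e$ are denotable, then $\Gamma\vdash p[0\mapsto d,\ i+1\mapsto e]$ is denotable. 6. If $\Gamma\vdash\lambda z^\sigma x_0^{\sigma_0}\cdots x_{r-1}^{\sigma_{r-1}}.e$ is denotable where $\sigma=\sigma_0,\ldots,\sigma_{r-1}\rightarrow\mathbb{N}$ is of level $\le k$, and $\Gamma\vdash q_i:\sigma_i$ is denotable for each $i<r$, then $\Gamma\vdash\lambda.\langle\!\langle\Pi_{\Gamma,Z}(e,\xi)\rangle\!\rangle$ is denotable, where $Z=z,\vec x$ is disjoint from $\Gamma$, $\xi(z)=\lambda\vec x.e$ and $\xi(x_i)=q_i$ for each $i$.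
   Context: Levels: ${\mathrm{lv}}(\mathbb{N})=0$, ${\mathrm{lv}}(\sigma\rightarrow\tau)=\max({\mathrm{lv}}\,\sigma+1,{\mathrm{lv}}\,\tau)$. ${\mathrm{PCF}}^\Omega$: simply typed $\lambda$-calculus over $\mathbb{N}$ with constants $\underline n$, $\mathit{suc},\mathit{pre}$, $\mathit{ifzero}$, $Y_\sigma:(\sigma\rightarrow\sigma)\rightarrow\sigma$ for all $\sigma$, and $C_f:\mathbb{N}\rightarrow\mathbb{N}$ for each partial $f:\mathbb{N}\rightharpoonup\mathbb{N}$; ${\mathrm{PCF}}^\Omega_k$ admits $Y_\sigma$ only for ${\mathrm{lv}}(\sigma)\le k$. NSPs: coinductively generated well-typed trees $p::=\lambda\vec x.e$, $e::=\bot\mid n\mid\mathtt{case}\ a\ \mathtt{of}\ (i\Rightarrow e_i\mid i\in\mathbb{N})$, $a::=x\,q_0\cdots q_{r-1}$, modulo $\alpha$; meta-terms add $P\vec Q$ and $\mathtt{case}\ G\ \mathtt{of}(\ldots)$ for arbitrary ground $G$, and $\langle\!\langle T\rangle\!\rangle$ is the limit of reduction by $\beta$, $\mathtt{case}\ \bot\rightsquigarrow\bot$, $\mathtt{case}\ n\ \mathtt{of}(i\Rightarrow E_i)\rightsquigarrow E_n$ and case-of-case commutation. Application $(\lambda x_0\cdots x_r.e)\cdot q=\lambda x_1\cdots x_r.\langle\!\langle e[x_0\mapsto q]\rangle\!\rangle$, $x^\eta=\lambda\vec z.\mathtt{case}\ x\vec z^{\,\eta}\ \mathtt{of}(i\Rightarrow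 i)$. The interpretation: $[\![x]\!]=x^\eta$, $[\![\underline n]\!]=\lambda.n$, $[\![\mathit{suc}]\!]=\lambda x.\mathtt{case}\ x\ \mathtt{of}(i\Rightarrow i+1)$, $[\![\mathit{pre}]\!]=\lambda x.\mathtt{case}\ x\ \mathtt{of}(0\Rightarrow0\mid i+1\Rightarrow i)$, $[\![\mathit{ifzero}]\!]=\lambda xyz.\mathtt{case}\ x\ \mathtt{of}(0\Rightarrow\mathtt{case}\ y\ \mathtt{of}(j\Rightarrow j)\mid i+1\Rightarrow\mathtt{case}\ z\ \mathtt{of}(j\Rightarrow j))$, $[\![C_f]\!]=\lambda x.\mathtt{case}\ x\ \mathtt{of}(i\Rightarrow f(i))$, $[\![Y_\sigma]\!]=\lambda g.F_\sigma[g]$, $F_\sigma[g]=\lambda\vec x.\mathtt{case}\ g(F_\sigma[g])\vec x^{\,\eta}\ \mathtt{of}(i\Rightarrow i)$, $[\![\lambda x.M]\!]_\Gamma=\lambda x.[\![M]\!]_{\Gamma,x}$, $[\![MN]\!]_\Gamma=[\![M]\!]_\Gamma\cdot[\![N]\!]_\Gamma$. $\Gamma\vdash p$ is ${\mathrm{PCF}}^\Omega_k$-denotable if $p=[\![M]\!]_\Gamma$ for some ${\mathrm{PCF}}^\Omega_k$ term $\Gamma\vdash M$. Rightward numeral leaves of $t$: $n$ in itself; those of $e$ in $\lambda\vec x.e$; those of each $e_i$ in $\mathtt{case}\ a\ \mathtt{of}(i\Rightarrow e_i)$; $t[i\mapsto e_i]$ replaces each rightward leaf $i$ by $e_i$ ($f(i)$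 read as $\bot$ if undefined). Plugging: for $\Gamma$, a list $Z$ of variables of level $\le k$ disjoint from $\Gamma$, $\Gamma,Z\vdash e$, and $\xi$ with $\Gamma,Z\vdash\xi(z):\sigma$ for $z^\sigma\in Z$, let $T^\circ$ replace each ground subterm $z\vec Q$ ($z\in Z$) of $T$ by $\bot$; $\Pi^0=e$, $\Pi^{m+1}=\Pi^m[z\mapsto\xi(z)\ \forall z\in Z]$, $\Pi_{\Gamma,Z}(e,\xi)=\bigsqcup_m(\Pi^m)^\circ$. *)

(* Defs.v *)
(* Nested sequential procedures (NSPs), meta-terms, PCF^Omega,
   and the NSP interpretation, following the paper's definitions.
   Variables are represented by de Bruijn LEVELS: an environment Gamma is a
   list of types, variable v refers to the v-th entry of the current
   environment (Gamma followed by all enclosing lambda-binders, in order).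
   This gives canonical representatives of alpha-classes.  Infinite trees are
   coinductive; equality of NSPs is bisimilarity ([peq]). *)
From Stdlib Require Import List Arith PeanoNat ClassicalEpsilon.
Import ListNotations.
Open Scope nat_scope.

(* ---------- Types:  Arr [s0;...;s(r-1)] = s0,...,s(r-1) -> N ---------- *)
Inductive ty : Type := Arr : list ty -> ty.
Definition N : ty := Arr [].

Fixpoint lv (t : ty) : nat :=
  match t with
  | Arr ts => (fix go (l : list ty) : nat :=
                 match l with [] => 0 | s :: l' => Nat.max (S (lv s)) (go l') end) ts
  end.

(* ---------- NSPs ----------
   p ::= lam xs. e      e ::= bot | n | case (x q_0 ... q_{r-1}) of (i => e_i)
   (the arguments are given as a function, only indices < r are meaningful) *)
CoInductive proc : Type := Lam : list ty -> expr -> proc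
with expr : Type :=
| Bot : expr
| Num : nat -> expr
| Case : nat -> nat -> (nat -> proc) -> (nat -> expr) -> expr.

(* bisimilarity = equality of (alpha-classes of) NSP trees *)
CoInductive peq : proc -> proc -> Prop :=
| peq_lam : forall ts e e', eeq e e' -> peq (Lam ts e) (Lam ts e')
with eeq : expr -> expr -> Prop :=
| eeq_bot : eeq Bot Bot
| eeq_num : forall n, eeq (Num n) (Num n)
| eeq_case : forall x r Q Q' B B',
    (forall i, i < r -> peq (Q i) (Q' i)) -> (forall i, eeq (B i) (B' i)) ->
    eeq (Case x r Q B) (Case x r Q' B').

Definition ptype (p : proc) : ty := match p with Lam ts _ => Arr ts end.
Definition lam1 (s : ty) (p : proc) : proc :=
  match p with Lam ts e => Lam (s :: ts) e end.

CoFixpoint ren_p (f : nat -> nat) (p : proc) : proc :=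
  match p with Lam ts e => Lam ts (ren_e f e) end
with ren_e (f : nat -> nat) (e : expr) : expr :=
  match e with
  | Bot => Bot
  | Num n => Num n
  | Case x r Q B => Case (f x) r (fun i => ren_p f (Q i)) (fun i => ren_e f (B i))
  end.

Definition shift (base k : nat) (v : nat) : nat := if v <? base then v else v + k.

CoFixpoint repl_e (h : nat -> expr) (e : expr) : expr :=
  match e with
  | Bot => Bot
  | Num n => h n
  | Case x r Q B => Case x r Q (fun i => repl_e h (B i))
  end.
Definition repl_p (h : nat -> expr) (p : proc) : proc :=
  match p with Lam ts e => Lam ts (repl_e h e) end.

Definition opt_num (o : option nat) : expr :=
  match o with Some n => Num n | None => Bot end.

(* ---------- Meta-terms ----------
   mproc ::= lam xs. E      E ::= bot | n | case G of (i => E_i)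
   G ::= E | x Q_0...Q_{r-1} | P Q_0 ... Q_{r-1}                        *)
CoInductive mproc : Type := MLam : list ty -> mexpr -> mproc
with mexpr : Type :=
| MBot : mexpr
| MNum : nat -> mexpr
| MCase : mground -> (nat -> mexpr) -> mexpr
with mground : Type :=
| GE : mexpr -> mground
| GVar : nat -> nat -> (nat -> mproc) -> mground
| GApp : mproc -> nat -> (nat -> mproc) -> mground.

CoFixpoint embed_p (p : proc) : mproc :=
  match p with Lam ts e => MLam ts (embed_e e) end
with embed_e (e : expr) : mexpr :=
  match e with
  | Bot => MBot
  | Num n => MNum n
  | Case x r Q B => MCase (GVar x r (fun i => embed_p (Q i))) (fun i => embed_e (B i))
  end.

CoFixpoint mren_p (f : nat -> nat) (P : mproc) : mproc :=
  match P with MLam ts E => MLam ts (mren_e f E) end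
with mren_e (f : nat -> nat) (E : mexpr) : mexpr :=
  match E with
  | MBot => MBot
  | MNum n => MNum n
  | MCase G B => MCase (mren_g f G) (fun i => mren_e f (B i))
  end
with mren_g (f : nat -> nat) (G : mground) : mground :=
  match G with
  | GE E => GE (mren_e f E)
  | GVar x r Q => GVar (f x) r (fun i => mren_p f (Q i))
  | GApp P r Q => GApp (mren_p f P) r (fun i => mren_p f (Q i))
  end.

(* Substitution.  The source term lives in an environment of length n0
   (levels >= n0 are bound inside it), the result in one of length n1.
   A free level v < n0 is sent by s to a variable (SVar) or to a
   meta-procedure living in the target environment of length n1 (STm);
   bound levels v >= n0 become v - n0 + n1.  d is the current source depth. *)
Inductive sval : Type := SVar : nat -> sval | STm : mproc -> sval.

CoFixpoint sub_p (n0 n1 : nat) (s : nat -> sval) (d : nat) (P : mproc) : mproc :=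
  match P with MLam ts E => MLam ts (sub_e n0 n1 s (d + length ts) E) end
with sub_e (n0 n1 : nat) (s : nat -> sval) (d : nat) (E : mexpr) : mexpr :=
  match E with
  | MBot => MBot
  | MNum n => MNum n
  | MCase G B => MCase (sub_g n0 n1 s d G) (fun i => sub_e n0 n1 s d (B i))
  end
with sub_g (n0 n1 : nat) (s : nat -> sval) (d : nat) (G : mground) : mground :=
  match G with
  | GE E => GE (sub_e n0 n1 s d E)
  | GVar v r Q =>
      if v <? n0 then
        match s v with
        | SVar w => GVar w r (fun i => sub_p n0 n1 s d (Q i))
        | STm P => GApp (mren_p (shift n1 (d - n0)) P) r (fun i => sub_p n0 n1 s d (Q i))
        end
      else GVar (v - n0 + n1) r (fun i => sub_p n0 n1 s d (Q i))
  | GApp P r Q => GApp (sub_p n0 n1 s d P) r (fun i => sub_p n0 n1 s d (Q i))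
  end.

Definition hstep (d : nat) (E : mexpr) : option mexpr :=
  match E with
  | MCase G B =>
      match G with
      | GE MBot => Some MBot
      | GE (MNum n) => Some (B n)
      | GE (MCase G' B') => Some (MCase G' (fun i => MCase (GE (B' i)) B))
      | GVar _ _ _ => None
      | GApp (MLam ts E') r Q =>
          Some (MCase (GE (sub_e (d + length ts) d
                             (fun v => if v <? d then SVar v else STm (Q (v - d)))
                             (d + length ts) E')) B)
      end
  | _ => None
  end.

Fixpoint hred (d n : nat) (E : mexpr) : mexpr :=
  match n with
  | 0 => E
  | S n' => match hstep d E with None => E | Some E' => hred d n' E' end
  end.

Definition hnf (d : nat) (E : mexpr) : option mexpr :=
  match excluded_middle_informative (exists n, hstep d (hred d n E) = None) with
  | left H => Some (hred d (proj1_sig (constructive_indefinite_description _ H)) E)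
  | right _ => None
  end.

CoFixpoint nfe (d : nat) (E : mexpr) : expr :=
  match hnf d E with
  | Some (MNum n) => Num n
  | Some (MCase (GVar x r Q) B) => Case x r (fun i => nfp d (Q i)) (fun i => nfe d (B i))
  | _ => Bot
  end
with nfp (d : nat) (P : mproc) : proc :=
  match P with MLam ts E => Lam ts (nfe (d + length ts) E) end.

(* NSP application in an environment of length g:
   (lam x0 ... xr. e) . q = lam x1...xr. << e[x0 |-> q] >> *)
Definition app (g : nat) (p q : proc) : proc :=
  match p with
  | Lam (t :: ts) e =>
      Lam ts (nfe (g + length ts)
                (sub_e (g + 1) g (fun v => if v <? g then SVar v else STm (embed_p q))
                       (g + 1 + length ts) (embed_e e)))
  | _ => p
  end.

(* x^eta in an environment of length n, x of type s *)
CoFixpoint eta (n x : nat) (s : ty) : proc :=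
  match s with
  | Arr ts => Lam ts (Case x (length ts)
                         (fun j => eta (n + length ts) (n + j) (nth j ts N))
                         (fun i => Num i))
  end.

Definition dummy : nat -> proc := fun _ => Lam [] Bot.

(* F_sigma[g] in an environment of length n, g at level gv, sigma = Arr ts *)
CoFixpoint Fy (n gv : nat) (ts : list ty) : proc :=
  Lam ts (Case gv (S (length ts))
            (fun j => match j with
                      | 0 => Fy (n + length ts) gv ts
                      | S j' => eta (n + length ts) (n + j') (nth j' ts N)
                      end)
            (fun i => Num i)).

Inductive term : Type :=
| TVar : nat -> term
| TLam : ty -> term -> term
| TApp : term -> term -> term
| TNum : nat -> term
| TSuc | TPre | TIfz
| TY : ty -> term
| TC : (nat -> option nat) -> term.

Definition arrow (s t : ty) : ty := match t with Arr ts => Arr (s :: ts) end.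

Inductive has_type (k : nat) : list ty -> term -> ty -> Prop :=
| ht_var : forall G v, v < length G -> has_type k G (TVar v) (nth v G N)
| ht_lam : forall G s M t, has_type k (G ++ [s]) M t -> has_type k G (TLam s M) (arrow s t)
| ht_app : forall G M M' s ts,
    has_type k G M (Arr (s :: ts)) -> has_type k G M' s -> has_type k G (TApp M M') (Arr ts)
| ht_num : forall G n, has_type k G (TNum n) N
| ht_suc : forall G, has_type k G TSuc (Arr [N])
| ht_pre : forall G, has_type k G TPre (Arr [N])
| ht_ifz : forall G, has_type k G TIfz (Arr [N; N; N])
| ht_Y : forall G s, lv s <= k -> has_type k G (TY s) (arrow (arrow s s) s)
| ht_C : forall G f, has_type k G (TC f) (Arr [N]).

Fixpoint interp (G : list ty) (M : term) : proc :=
  let g := length G in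
  match M with
  | TVar v => eta g v (nth v G N)
  | TLam s M' => lam1 s (interp (G ++ [s]) M')
  | TApp M1 M2 => app g (interp G M1) (interp G M2)
  | TNum n => Lam [] (Num n)
  | TSuc => Lam [N] (Case g 0 dummy (fun i => Num (S i)))
  | TPre => Lam [N] (Case g 0 dummy (fun i => Num (pred i)))
  | TIfz => Lam [N; N; N]
              (Case g 0 dummy (fun i => match i with
                                        | 0 => Case (g + 1) 0 dummy (fun j => Num j)
                                        | S _ => Case (g + 2) 0 dummy (fun j => Num j)
                                        end))
  | TC f => Lam [N] (Case g 0 dummy (fun i => opt_num (f i)))
  | TY s => match s with
            | Arr ts => match Fy (g + 1) g ts with
                        | Lam _ e => Lam (arrow s s :: ts) e
                        end
            end
  end.

Definition denotable (k : nat) (G : list ty) (p : proc) : Prop :=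
  exists M t, has_type k G M t /\ peq p (interp G M).

CoFixpoint circ_p (lo hi : nat) (P : mproc) : mproc :=
  match P with MLam ts E => MLam ts (circ_e lo hi E) end
with circ_e (lo hi : nat) (E : mexpr) : mexpr :=
  match E with
  | MBot => MBot
  | MNum n => MNum n
  | MCase G B => MCase (circ_g lo hi G) (fun i => circ_e lo hi (B i))
  end
with circ_g (lo hi : nat) (G : mground) : mground :=
  match G with
  | GE E => GE (circ_e lo hi E)
  | GVar x r Q => if andb (lo <=? x) (x <? hi) then GE MBot
                  else GVar x r (fun i => circ_p lo hi (Q i))
  | GApp P r Q => GApp (circ_p lo hi P) r (fun i => circ_p lo hi (Q i))
  end.

(* supremum of an (increasing, w.r.t. the bot-approximation order) chain *)
Definition pick (P : nat -> Prop) : option nat :=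
  match excluded_middle_informative (exists m, P m) with
  | left H => Some (proj1_sig (constructive_indefinite_description _ H))
  | right _ => None
  end.

Definition is_mbot (E : mexpr) : bool := match E with MBot => true | _ => false end.
Definition is_GE (G : mground) : bool := match G with GE _ => true | _ => false end.
Definition caseG (E : mexpr) : mground := match E with MCase G _ => G | _ => GE MBot end.
Definition caseB (i : nat) (E : mexpr) : mexpr := match E with MCase _ B => B i | _ => MBot end.
Definition unGE (G : mground) : mexpr := match G with GE E => E | _ => MBot end.
Definition argG (i : nat) (G : mground) : mproc :=
  match G with GVar _ _ Q => Q i | GApp _ _ Q => Q i | GE _ => MLam [] MBot end.
Definition headP (G : mground) : mproc :=
  match G with GApp P _ _ => P | _ => MLam [] MBot end.
Definition binders (P : mproc) : list ty := match P with MLam ts _ => ts end.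
Definition body (P : mproc) : mexpr := match P with MLam _ E => E end.

CoFixpoint lub_e (c : nat -> mexpr) : mexpr :=
  match pick (fun m => is_mbot (c m) = false) with
  | None => MBot
  | Some m =>
      match c m with
      | MBot => MBot
      | MNum n => MNum n
      | MCase _ _ => MCase (lub_g (fun j => caseG (c (m + j))))
                           (fun i => lub_e (fun j => caseB i (c (m + j))))
      end
  end
with lub_g (c : nat -> mground) : mground :=
  match pick (fun m => is_GE (c m) = false) with
  | None => GE (lub_e (fun j => unGE (c j)))
  | Some m =>
      match c m with
      | GVar x r _ => GVar x r (fun i => lub_p (fun j => argG i (c (m + j))))
      | GApp _ r _ => GApp (lub_p (fun j => headP (c (m + j)))) r
                           (fun i => lub_p (fun j => argG i (c (m + j))))
      | GE _ => GE (lub_e (fun j => unGE (c (m + j))))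
      end
  end
with lub_p (c : nat -> mproc) : mproc :=
  MLam (binders (c 0)) (lub_e (fun j => body (c j))).

(* For Gamma of length g, Z = z, x_0..x_{r-1} (levels g .. g+r), e in Gamma,Z,
   xi(z) = lam xs. e  and  xi(x_i) = q_i  (all viewed in Gamma,Z).
   Returns  Pi_{Gamma,Z}(e, xi)  as a meta-expression in Gamma,Z. *)
Definition plug (g : nat) (ss : list ty) (e : expr) (qs : nat -> proc) : mexpr :=
  let r := length ss in
  let n := g + 1 + r in
  let xiz := MLam ss (mren_e (shift (g + 1) r) (embed_e e)) in
  let xix := fun i => mren_p (shift g (1 + r)) (embed_p (qs i)) in
  let s := fun v => if v <? g then SVar v
                    else if v =? g then STm xiz else STm (xix (v - g - 1)) in
  let Pi := fun m => Nat.iter m (sub_e n n s n) (embed_e e) in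
  lub_e (fun m => circ_e g n (Pi m)).

(* lam. << Pi_{Gamma,Z}(e, xi) >>, re-indexed as a procedure in Gamma *)
Definition plug_result (g : nat) (ss : list ty) (e : expr) (qs : nat -> proc) : proc :=
  let n := g + 1 + length ss in
  Lam [] (ren_e (fun v => if v <? g then v else v - n + g) (nfe n (plug g ss e qs))).

Inductive gen (k : nat) : list ty -> proc -> Prop :=
| gen_var : forall G x ts qs p,
    x < length G -> nth x G N = Arr ts ->
    (forall i, i < length ts -> gen k G (qs i) /\ ptype (qs i) = nth i ts N) ->
    peq p (Lam [] (Case x (length ts) qs (fun j => Num j))) ->
    gen k G p
| gen_lam : forall G s p p',
    gen k (G ++ [s]) p -> peq p' (lam1 s p) -> gen k G p'
| gen_num : forall G n p, peq p (Lam [] (Num n)) -> gen k G p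
| gen_fun : forall G p (f : nat -> option nat) p',
    gen k G p -> peq p' (repl_p (fun i => opt_num (f i)) p) -> gen k G p'
| gen_ifz : forall G ts e d e' p',
    gen k G (Lam ts e) -> gen k G (Lam [] d) -> gen k G (Lam [] e') ->
    peq p' (repl_p (fun i => match i with
                             | 0 => ren_e (shift (length G) (length ts)) d
                             | S _ => ren_e (shift (length G) (length ts)) e'
                             end) (Lam ts e)) ->
    gen k G p'
| gen_plug : forall G ss e qs p',
    lv (Arr ss) <= k ->
    gen k G (Lam (Arr ss :: ss) e) ->
    (forall i, i < length ss -> gen k G (qs i) /\ ptype (qs i) = nth i ss N) ->
    peq p' (plug_result (length G) ss e qs) ->
    gen k G p'.

(* Main.v *)
(* Run NSP code in a Krivine-style machine with closures.  Since variables are de Bruijn levels,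
   closures never need renaming, and the normal form of a meta-term is the typed readback of a
   machine state.  A simulation relation shows that readback is unaffected by eta-expansion, by
   normalising code beforehand (so application is compositional), and by replacing the infinite
   procedure [Fy] with a recursive closure; the plugging [Pi] of rule 6 is that same recursive
   closure, unfolded syntactically.
   Denotable procedures are generated by a Tait-style argument: an entry is computable if calling
   it with computable arguments reads back to a generated procedure; variables are computable by
   rule 1, computable entries reify by rule 2, and the constants are rules 3-6.  Conversely each
   rule is realised by an explicit term. *)
Require Import Defs.
From Stdlib Require Import List Arith PeanoNat Lia ClassicalEpsilon FunctionalExtensionality.
Import ListNotations.

(** * Bisimilarity and the abstract machine *)

(** A direct syntactic argument would have to show that normalising before or after a substitution
    gives the same infinite tree, comparing reductions of meta-terms in which [case] commutations
    and renamings intervene. Machine runs are counted and stop at values with a readable head, so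
    each comparison becomes an induction on run lengths followed by one coinduction over the tree
    that is read back. The delicate direction is the backward one: eta-expanded or normalised code
    may move while its direct presentation stands still, so the step count does not decrease, and an
    inner induction on the derivation of the relation takes over. Levels make an entry over a
    context also an entry over every extension of that context. Hence substitution, extension of the
    stack and passage under binders need no bookkeeping, and computability can quantify over context
    extensions without renaming. *)

Lemma peq_inv p p' : peq p p' ->
  exists ts e e', p = Lam ts e /\ p' = Lam ts e' /\ eeq e e'.
Proof. intros []; eauto 6. Qed.

Lemma peq_Lam_inv ts e ts' e' : peq (Lam ts e) (Lam ts' e') -> ts = ts' /\ eeq e e'.
Proof. inversion 1; auto. Qed.

Lemma peq_refl p : peq p p with eeq_refl e : eeq e e.
Proof.
- destruct p; constructor; apply eeq_refl.
- destruct e; constructor; intros; [apply peq_refl | apply eeq_refl].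
Qed.

Lemma peq_sym p p' : peq p p' -> peq p' p with eeq_sym e e' : eeq e e' -> eeq e' e.
Proof.
- destruct 1; constructor; apply eeq_sym; assumption.
- destruct 1 as [| |x r Q Q' B B' HQ HB]; constructor; intros i;
    [intros Hi; apply peq_sym, (HQ i Hi) | apply eeq_sym, HB].
Qed.

Lemma peq_trans p q r : peq p q -> peq q r -> peq p r
with eeq_trans e f h : eeq e f -> eeq f h -> eeq e h.
Proof.
- destruct 1; inversion 1; subst; constructor; eapply eeq_trans; eassumption.
- destruct 1 as [| |x r Q Q' B B' HQ HB]; inversion 1 as [| |? ? ? Q2 ? B2 HQ2 HB2]; subst;
    constructor; intros i;
    [intros Hi; apply (peq_trans _ (Q' i) _); [apply (HQ i Hi) | apply (HQ2 i Hi)]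
    |apply (eeq_trans _ (B' i) _); [apply HB | apply HB2]].
Qed.

Definition eeq_shape (X : expr -> expr -> Prop) (e e' : expr) : Prop :=
  match e, e' with
  | Bot, Bot => True
  | Num n, Num n' => n = n'
  | Case x r Q B, Case x' r' Q' B' =>
      x = x' /\ r = r' /\
      (forall i, i < r -> exists ts b b', Q i = Lam ts b /\ Q' i = Lam ts b' /\ X b b') /\
      (forall i, X (B i) (B' i))
  | _, _ => False
  end.

(** Coinduction up to subtrees already known to be bisimilar. The guarded [cofix] is carried out
    once here, so that users only match one layer of shape. Since [eeq_shape] opens argument
    procedures to their bodies, one relation on expressions replaces a mutual pair. *)
Lemma eeq_coind (X : expr -> expr -> Prop) :
  (forall e e', X e e' -> eeq_shape (fun a b => X a b \/ eeq a b) e e' \/ eeq e e') ->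
  forall e e', X e e' -> eeq e e'.
Proof.
intros HX.
assert (H : forall e e', X e e' \/ eeq e e' -> eeq e e').
{ cofix IH. intros e e' H.
  assert (H' : eeq_shape (fun a b => X a b \/ eeq a b) e e').
  { destruct H as [H | H].
    - destruct (HX _ _ H) as [H' | H']; [exact H'|].
      destruct H'; simpl; auto. repeat split; auto.
      intros i Hi. destruct (peq_inv _ _ (H0 i Hi)) as (ts & b & b' & -> & -> & ?); eauto 8.
    - destruct H; simpl; auto. repeat split; auto.
      intros i Hi. destruct (peq_inv _ _ (H i Hi)) as (ts & b & b' & -> & -> & ?); eauto 8. }
  clear H. destruct e, e'; simpl in H'; try contradiction.
  - constructor.
  - subst. constructor.
  - destruct H' as (-> & -> & HQ & HB). constructor.
    + intros i Hi. destruct (HQ i Hi) as (ts & b & b' & -> & -> & Hb).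
      constructor. apply IH. exact Hb.
    + intros i. apply IH. apply HB. }
auto.
Qed.

(* Environment entries: a variable of the target context, a closure, or the recursive closure
   [ER f], which when called passes itself to [f] as first argument. *)
Inductive ent : Type :=
| EV : nat -> ent
| EC : proc -> list ent -> ent
| ER : ent -> ent.

Definition frame : Type := (nat -> expr) * list ent.

(* Running code, calling an entry with arguments, and returning a numeral to the stack. *)
Inductive state : Type :=
| SE : expr -> list ent -> list frame -> state
| SC : ent -> list ent -> list frame -> state
| SR : nat -> list frame -> state.

Definition clos (r : nat) (Q : nat -> proc) (rho : list ent) : list ent :=
  map (fun i => EC (Q i) rho) (seq 0 r).

Definition step (s : state) : option state :=
  match s with
  | SE Bot _ _ => None
  | SE (Num n) _ K => Some (SR n K)
  | SE (Case x r Q B) rho K =>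
      match nth_error rho x with
      | Some a => Some (SC a (clos r Q rho) ((B, rho) :: K))
      | None => None
      end
  | SC (EV _) _ _ => None
  | SC (EC (Lam _ e) rho) bs K => Some (SE e (rho ++ bs) K)
  | SC (ER f) bs K => Some (SC f (ER f :: bs) K)
  | SR _ [] => None
  | SR n ((B, rho) :: K) => Some (SE (B n) rho K)
  end.

(** * Values, evaluation and typed readback *)

Definition isval (s : state) : Prop :=
  match s with
  | SC (EV _) _ _ => True
  | SR _ [] => True
  | _ => False
  end.

(** A state that is stuck without being a value (running [Bot], or looking up a missing variable)
    evaluates to nothing, so it is read back as [Bot] exactly like a diverging one. *)
Inductive ev : nat -> state -> state -> Prop :=
| ev_val : forall v, isval v -> ev 0 v v
| ev_step : forall n s s' v, step s = Some s' -> ev n s' v -> ev (S n) s v.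

Lemma isval_step v : isval v -> step v = None.
Proof. destruct v as [| [] | ? []]; simpl; tauto. Qed.

Lemma ev_isval n s v : ev n s v -> isval v.
Proof. induction 1; auto. Qed.

Lemma ev_det n s v : ev n s v -> forall m w, ev m s w -> n = m /\ v = w.
Proof.
induction 1 as [v Hv | n s s' v Hs He IH]; intros m w Hw; inversion Hw; subst.
- auto.
- rewrite (isval_step _ Hv) in H. discriminate.
- rewrite (isval_step _ H) in Hs. discriminate.
- rewrite Hs in H. injection H as <-. destruct (IH _ _ H0); auto.
Qed.

Lemma ev_step_inv n s s' v : ev n s v -> step s = Some s' -> exists m, n = S m /\ ev m s' v.
Proof.
intros He Hs. inversion He; subst.
- rewrite (isval_step _ H) in Hs. discriminate.
- rewrite Hs in H. injection H as <-. eauto.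
Qed.

Definition val (s : state) : option state :=
  match excluded_middle_informative (exists v n, ev n s v) with
  | left H => Some (proj1_sig (constructive_indefinite_description _ H))
  | right _ => None
  end.

Lemma val_ev n s v : ev n s v -> val s = Some v.
Proof.
intros H. unfold val. destruct excluded_middle_informative as [H' | H'].
- destruct constructive_indefinite_description as [w [m Hw]]; simpl.
  destruct (ev_det _ _ _ H _ _ Hw) as [_ ->]. reflexivity.
- exfalso. eauto.
Qed.

Lemma val_Some s v : val s = Some v -> exists n, ev n s v.
Proof.
unfold val. destruct excluded_middle_informative as [H' | H']; [|discriminate].
destruct constructive_indefinite_description as [w [m Hw]]; simpl.
intros [= <-]. eauto.
Qed.

Lemma val_None s n v : val s = None -> ~ ev n s v.
Proof. intros H He. rewrite (val_ev _ _ _ He) in H. discriminate. Qed.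

Lemma val_none_intro s : (forall n v, ~ ev n s v) -> val s = None.
Proof.
intros H. destruct (val s) eqn:E; auto. destruct (val_Some _ _ E) as [n Hn].
destruct (H _ _ Hn).
Qed.

Lemma val_step s s' : step s = Some s' -> val s = val s'.
Proof.
intros Hs. destruct (val s') eqn:E.
- destruct (val_Some _ _ E) as [n Hn]. apply (val_ev (S n)). econstructor; eauto.
- apply val_none_intro. intros n v H. destruct (ev_step_inv _ _ _ _ H Hs) as (m & _ & Hm).
  exact (val_None _ _ _ E Hm).
Qed.

Definition fresh (d k : nat) : list ent := map EV (seq d k).

(** Readback is directed by the types in [D]: an argument of a blocked variable is read back by
    calling it on fresh variables, so the tree is eta-long, and the branches come from returning
    each numeral to the suspended stack. The inner [match] is [rb], spelled out to keep the
    corecursion guarded. *)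
CoFixpoint nf (D : list ty) (s : state) : expr :=
  match val s with
  | Some (SR n _) => Num n
  | Some (SC (EV w) bs K) =>
      match nth w D N with
      | Arr ts =>
          Case w (length ts)
            (fun i => match nth i ts N with
                      | Arr us => Lam us (nf (D ++ us)
                                   (SC (nth i bs (EV 0)) (fresh (length D) (length us)) []))
                      end)
            (fun i => nf D (SR i K))
      end
  | _ => Bot
  end.

Definition rb (D : list ty) (t : ty) (a : ent) : proc :=
  match t with
  | Arr us => Lam us (nf (D ++ us) (SC a (fresh (length D) (length us)) []))
  end.

Definition nf_val (D : list ty) (o : option state) : expr :=
  match o with
  | Some (SR n _) => Num n
  | Some (SC (EV w) bs K) =>
      match nth w D N with
      | Arr ts =>
          Case w (length ts) (fun i => rb D (nth i ts N) (nth i bs (EV 0)))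
               (fun i => nf D (SR i K))
      end
  | _ => Bot
  end.

Definition frob (e : expr) : expr :=
  match e with Bot => Bot | Num n => Num n | Case x r Q B => Case x r Q B end.
Lemma frob_eq e : e = frob e.
Proof. destruct e; reflexivity. Qed.

Lemma nf_eq D s : nf D s = nf_val D (val s).
Proof.
rewrite (frob_eq (nf D s)). simpl.
destruct (val s) as [[e rho K | [w | p rho | f] bs K | n K]|]; simpl; try reflexivity.
destruct (nth w D N). reflexivity.
Qed.

Lemma nf_step D s s' : step s = Some s' -> nf D s = nf D s'.
Proof. intros H. rewrite !nf_eq, (val_step _ _ H). reflexivity. Qed.

Lemma nf_ev D n s v : ev n s v -> nf D s = nf_val D (Some v).
Proof. intros H. rewrite nf_eq, (val_ev _ _ _ H). reflexivity. Qed.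

Lemma nf_SR_nil D n : nf D (SR n []) = Num n.
Proof. rewrite (nf_ev D 0 _ (SR n [])); [reflexivity|]. constructor. exact I. Qed.

Lemma nf_var D w bs K ts : nth_error D w = Some (Arr ts) ->
  nf D (SC (EV w) bs K) =
  Case w (length ts) (fun i => rb D (nth i ts N) (nth i bs (EV 0))) (fun i => nf D (SR i K)).
Proof.
intros H. rewrite (nf_ev D 0 _ (SC (EV w) bs K)) by (constructor; exact I).
simpl. rewrite (nth_error_nth _ _ _ H). reflexivity.
Qed.

Lemma nf_div D s : (forall n v, ~ ev n s v) -> nf D s = Bot.
Proof. intros H. rewrite nf_eq, val_none_intro; auto. Qed.

(** * Typing and substitution of machine states *)

CoInductive wt_p : list ty -> proc -> ty -> Prop :=
| wt_Lam : forall G ts e, wt_e (G ++ ts) e -> wt_p G (Lam ts e) (Arr ts)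
with wt_e : list ty -> expr -> Prop :=
| wt_Bot : forall G, wt_e G Bot
| wt_Num : forall G n, wt_e G (Num n)
| wt_Case : forall G x ts Q B,
    nth_error G x = Some (Arr ts) ->
    (forall i t, nth_error ts i = Some t -> wt_p G (Q i) t) ->
    (forall i, wt_e G (B i)) ->
    wt_e G (Case x (length ts) Q B).

Lemma wt_peq G p p' t : wt_p G p t -> peq p p' -> wt_p G p' t
with wt_eeq G e e' : wt_e G e -> eeq e e' -> wt_e G e'.
Proof.
- destruct 1; inversion 1; subst. constructor. eapply wt_eeq; eassumption.
- destruct 1 as [| |G x ts Q B Hx HQ HB]; inversion 1 as [| |? ? ? Q' ? B' HQ' HB']; subst.
  + constructor.
  + constructor.
  + econstructor.
    * exact Hx.
    * intros i t Hi. apply (wt_peq _ (Q i)); [exact (HQ i t Hi)|].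
      apply HQ'. apply nth_error_Some. rewrite Hi. discriminate.
    * intros i. apply (wt_eeq _ (B i)); [apply HB | apply HB'].
Qed.

(** Environments are constrained pointwise through [nth_error], so that the generated induction
    principle gives hypotheses for the entries stored inside closures. The relation [er] follows the
    same pattern. *)
Inductive wt_ent (D : list ty) : ty -> ent -> Prop :=
| wt_EV : forall w t, nth_error D w = Some t -> wt_ent D t (EV w)
| wt_EC : forall G t p rho,
    wt_p G p t -> length rho = length G ->
    (forall i u b, nth_error G i = Some u -> nth_error rho i = Some b -> wt_ent D u b) ->
    wt_ent D t (EC p rho)
| wt_ER : forall ss f, wt_ent D (Arr (Arr ss :: ss)) f -> wt_ent D (Arr ss) (ER f).

Definition wt_env (D G : list ty) (rho : list ent) : Prop :=
  length rho = length G /\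
  forall i u b, nth_error G i = Some u -> nth_error rho i = Some b -> wt_ent D u b.

Inductive wt_k (D : list ty) : list frame -> Prop :=
| wt_k_nil : wt_k D []
| wt_k_cons : forall G B rho K,
    (forall i, wt_e G (B i)) -> wt_env D G rho -> wt_k D K -> wt_k D ((B, rho) :: K).

Inductive wt_s (D : list ty) : state -> Prop :=
| wt_SE : forall G e rho K, wt_e G e -> wt_env D G rho -> wt_k D K -> wt_s D (SE e rho K)
| wt_SC : forall ts a bs K,
    wt_ent D (Arr ts) a -> wt_env D ts bs -> wt_k D K -> wt_s D (SC a bs K)
| wt_SR : forall n K, wt_k D K -> wt_s D (SR n K).

Lemma nth_error_lookup {A B} (l : list A) (l' : list B) i x :
  length l' = length l -> nth_error l i = Some x -> exists y, nth_error l' i = Some y.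
Proof.
intros Hl Hi. destruct (nth_error l' i) eqn:E; eauto.
apply nth_error_None in E. assert (i < length l) by (apply nth_error_Some; congruence). lia.
Qed.

Lemma nth_error_app_cases {A} (l l' : list A) i x :
  nth_error (l ++ l') i = Some x ->
  (i < length l /\ nth_error l i = Some x) \/
  (length l <= i /\ nth_error l' (i - length l) = Some x).
Proof.
intros H. destruct (Nat.lt_ge_cases i (length l)).
- rewrite nth_error_app1 in H; auto.
- rewrite nth_error_app2 in H; auto.
Qed.

Lemma nth_error_weaken {A} (l l' : list A) i x :
  nth_error l i = Some x -> nth_error (l ++ l') i = Some x.
Proof.
intros H. rewrite nth_error_app1; auto. apply nth_error_Some. congruence.
Qed.

Lemma nth_error_lt {A} (l : list A) i x : nth_error l i = Some x -> i < length l.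
Proof. intros H. apply nth_error_Some. congruence. Qed.

Lemma nth_error_seq_lt d k i : i < k -> nth_error (seq d k) i = Some (d + i).
Proof.
intros H. rewrite (nth_error_nth' _ 0) by (rewrite length_seq; lia).
rewrite seq_nth; auto.
Qed.

Lemma nth_error_clos r Q rho i : i < r -> nth_error (clos r Q rho) i = Some (EC (Q i) rho).
Proof. intros H. unfold clos. rewrite nth_error_map, nth_error_seq_lt; auto. Qed.

Lemma length_clos r Q rho : length (clos r Q rho) = r.
Proof. unfold clos. rewrite length_map, length_seq. reflexivity. Qed.

Lemma nth_error_fresh d k i : i < k -> nth_error (fresh d k) i = Some (EV (d + i)).
Proof. intros H. unfold fresh. rewrite nth_error_map, nth_error_seq_lt; auto. Qed.

Lemma length_fresh d k : length (fresh d k) = k.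
Proof. unfold fresh. rewrite length_map, length_seq. reflexivity. Qed.

Lemma fresh_app d k l : fresh d k ++ fresh (d + k) l = fresh d (k + l).
Proof. unfold fresh. rewrite seq_app, map_app. reflexivity. Qed.

Lemma wt_env_nil D : wt_env D [] [].
Proof. split; auto. intros [|i] u b H; discriminate. Qed.

Lemma wt_env_app D G G' rho rho' :
  wt_env D G rho -> wt_env D G' rho' -> wt_env D (G ++ G') (rho ++ rho').
Proof.
intros [Hl H] [Hl' H']. split; [rewrite !length_app; congruence|].
intros i u b Hu Hb. destruct (nth_error_app_cases _ _ _ _ Hu) as [[Hi Hu']|[Hi Hu']].
- rewrite nth_error_app1 in Hb by lia. eauto.
- rewrite nth_error_app2 in Hb by lia. rewrite Hl in Hb. eauto.
Qed.

Lemma wt_env_cons D t G a rho : wt_ent D t a -> wt_env D G rho -> wt_env D (t :: G) (a :: rho).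
Proof.
intros Ha [Hl H]. split; [simpl; congruence|].
intros [|i] u b; simpl; [congruence|]. apply H.
Qed.

Lemma wt_env_cons_inv D t G a rho :
  wt_env D (t :: G) (a :: rho) -> wt_ent D t a /\ wt_env D G rho.
Proof.
intros [Hl H]. split; [apply (H 0); reflexivity|].
split; [simpl in Hl; congruence|]. intros i. apply (H (S i)).
Qed.

Lemma wt_env_Forall2 D G rho : Forall2 (wt_ent D) G rho <-> wt_env D G rho.
Proof.
split.
- induction 1; [apply wt_env_nil | apply wt_env_cons; auto].
- revert rho. induction G as [|t G IH]; intros [|a rho] H; try (destruct H; discriminate).
  + constructor.
  + apply wt_env_cons_inv in H. destruct H. constructor; auto.
Qed.

Lemma wt_env_lookup D G rho x t : wt_env D G rho -> nth_error G x = Some t ->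
  exists a, nth_error rho x = Some a /\ wt_ent D t a.
Proof.
intros [Hl H] Hx. destruct (nth_error_lookup G rho x t Hl Hx) as [a Ha]. eauto.
Qed.

Lemma wt_EC_env D G p t rho : wt_p G p t -> wt_env D G rho -> wt_ent D t (EC p rho).
Proof. intros Hp [Hl H]. econstructor; eauto. Qed.

Lemma wt_clos D G Q rho ts :
  (forall i t, nth_error ts i = Some t -> wt_p G (Q i) t) -> wt_env D G rho ->
  wt_env D ts (clos (length ts) Q rho).
Proof.
intros HQ Hr. split; [apply length_clos|].
intros i u b Hu Hb. rewrite nth_error_clos in Hb by (eapply nth_error_lt; eauto).
injection Hb as <-. eapply wt_EC_env; eauto.
Qed.

Lemma wt_fresh D us : wt_env (D ++ us) us (fresh (length D) (length us)).
Proof.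
split; [apply length_fresh|].
intros i u b Hu Hb. rewrite nth_error_fresh in Hb by (eapply nth_error_lt; eauto).
injection Hb as <-. constructor. rewrite nth_error_app2 by lia.
replace (length D + i - length D) with i by lia. exact Hu.
Qed.

Lemma wt_idenv D : wt_env D D (fresh 0 (length D)).
Proof. apply (wt_fresh [] D). Qed.

Lemma wt_ent_weaken D D' t a : wt_ent D t a -> wt_ent (D ++ D') t a.
Proof.
induction 1.
- constructor. apply nth_error_weaken. auto.
- econstructor; eauto.
- constructor. auto.
Qed.

Lemma wt_env_weaken D D' G rho : wt_env D G rho -> wt_env (D ++ D') G rho.
Proof. intros [Hl H]. split; auto. intros. apply wt_ent_weaken. eauto. Qed.

Lemma wt_step D s s' : wt_s D s -> step s = Some s' -> wt_s D s'.
Proof.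
destruct 1 as [G e rho K He Hr HK | ts a bs K Ha Hbs HK | n K HK]; simpl; intros Hs.
- destruct He as [| |G x ts Q B Hx HQ HB].
  + discriminate.
  + injection Hs as <-. constructor. auto.
  + destruct (wt_env_lookup _ _ _ _ _ Hr Hx) as (a & Ha & Hwa). rewrite Ha in Hs.
    injection Hs as <-. econstructor; [eauto| |econstructor; eauto].
    eapply wt_clos; eauto.
- destruct a as [w | p rho | f].
  + discriminate.
  + destruct p as [us e]. injection Hs as <-. inversion Ha; subst.
    inversion H1; subst. econstructor; eauto. apply wt_env_app; auto. split; auto.
  + injection Hs as <-. inversion Ha; subst. econstructor; eauto.
    apply wt_env_cons; auto.
- destruct HK as [|G B rho K HB Hr HK]; [discriminate|]. injection Hs as <-.
  econstructor; eauto.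
Qed.

Lemma wt_ev D n s v : ev n s v -> wt_s D s -> wt_s D v.
Proof. induction 1; auto. intros. eauto using wt_step. Qed.

Lemma wt_nf D s : wt_s D s -> wt_e D (nf D s)
with wt_rb D t a : wt_ent D t a -> wt_p D (rb D t a) t.
Proof.
- intros Hs. rewrite nf_eq. destruct (val s) as [v|] eqn:Hv; [|constructor].
  destruct (val_Some _ _ Hv) as [n Hn]. pose proof (wt_ev _ _ _ _ Hn Hs) as Hw.
  pose proof (ev_isval _ _ _ Hn) as Hi.
  destruct Hw as [G e rho K He Hr HK | ts a bs K Ha Hbs HK | k K HK].
  + contradiction.
  + destruct a as [w | p rho | f]; try contradiction. inversion Ha as [w' t' Hw' | |]; subst.
    simpl. rewrite (nth_error_nth _ _ _ Hw'). econstructor; eauto.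
    * intros i t Ht. rewrite (nth_error_nth _ _ _ Ht).
      destruct (wt_env_lookup _ _ _ _ _ Hbs Ht) as (b & Hb & Hwb).
      rewrite (nth_error_nth _ _ _ Hb). apply wt_rb. exact Hwb.
    * intros i. apply wt_nf. constructor. exact HK.
  + constructor.
- intros Ha. destruct t as [us]. constructor. apply wt_nf. econstructor.
  + apply wt_ent_weaken. exact Ha.
  + apply wt_fresh.
  + constructor.
Qed.

(** * Substitution into states and extension of the stack *)

Fixpoint esub (th : nat -> ent) (a : ent) : ent :=
  match a with
  | EV w => th w
  | EC p rho => EC p (map (esub th) rho)
  | ER f => ER (esub th f)
  end.

Definition fsub (th : nat -> ent) (f : frame) : frame := (fst f, map (esub th) (snd f)).

Definition ssub (th : nat -> ent) (s : state) : state :=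
  match s with
  | SE e rho K => SE e (map (esub th) rho) (map (fsub th) K)
  | SC a bs K => SC (esub th a) (map (esub th) bs) (map (fsub th) K)
  | SR n K => SR n (map (fsub th) K)
  end.

Definition sapp (s : state) (K' : list frame) : state :=
  match s with
  | SE e rho K => SE e rho (K ++ K')
  | SC a bs K => SC a bs (K ++ K')
  | SR n K => SR n (K ++ K')
  end.

Lemma map_clos th r Q rho : map (esub th) (clos r Q rho) = clos r Q (map (esub th) rho).
Proof. unfold clos. rewrite map_map. reflexivity. Qed.

Lemma step_ssub th s s' : step s = Some s' -> step (ssub th s) = Some (ssub th s').
Proof.
destruct s as [e rho K | a bs K | n K]; simpl.
- destruct e as [|n|x r Q B]; try discriminate.
  + intros [= <-]. reflexivity.
  + rewrite nth_error_map. destruct (nth_error rho x); try discriminate.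
    intros [= <-]. simpl. rewrite map_clos. reflexivity.
- destruct a as [w|[us e] rho|f]; try discriminate; intros [= <-]; simpl; auto.
  rewrite map_app. reflexivity.
- destruct K as [|[B rho] K]; try discriminate. intros [= <-]. reflexivity.
Qed.

Lemma step_sapp s s' K : step s = Some s' -> step (sapp s K) = Some (sapp s' K).
Proof.
destruct s as [e rho K0 | a bs K0 | n K0]; simpl.
- destruct e as [|n|x r Q B]; try discriminate.
  + intros [= <-]. reflexivity.
  + destruct (nth_error rho x); try discriminate. intros [= <-]. reflexivity.
- destruct a as [w|[us e] rho|f]; try discriminate; intros [= <-]; reflexivity.
- destruct K0 as [|[B rho] K0]; try discriminate. intros [= <-]. reflexivity.
Qed.

Lemma stuck_ssub th s K : step s = None -> ~ isval s ->
  step (sapp (ssub th s) K) = None /\ ~ isval (sapp (ssub th s) K).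
Proof.
destruct s as [e rho K0 | a bs K0 | n K0]; simpl.
- destruct e as [|n|x r Q B]; try discriminate; auto.
  rewrite nth_error_map. destruct (nth_error rho x); try discriminate. auto.
- destruct a as [w|[us e] rho|f]; try discriminate; tauto.
- destruct K0 as [|[B rho] K0]; try discriminate; tauto.
Qed.

Lemma stuck_sapp s K : step s = None -> ~ isval s ->
  step (sapp s K) = None /\ ~ isval (sapp s K).
Proof.
destruct s as [e rho K0 | a bs K0 | n K0]; simpl.
- destruct e as [|n|x r Q B]; intros H1 H2; try discriminate; split; auto.
  destruct (nth_error rho x); [discriminate | reflexivity].
- destruct a as [w|[us e] rho|f]; try discriminate; tauto.
- destruct K0 as [|[B rho] K0]; try discriminate; tauto.
Qed.

Lemma isval_dec s : isval s \/ ~ isval s.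
Proof. destruct s as [| [] | ? []]; simpl; auto. Qed.

Definition commutes_with_step (C : state -> state) : Prop :=
  forall s s', step s = Some s' -> step (C s) = Some (C s').

Definition preserves_stuck (C : state -> state) : Prop :=
  forall s, step s = None -> ~ isval s -> step (C s) = None /\ ~ isval (C s).

Lemma ev_compose C m s v n w : commutes_with_step C -> ev m s v -> ev n (C v) w -> ev (m + n) (C s) w.
Proof.
intros C_step. induction 1 as [v Hv | m s s' v Hs He IH]; intros Hw; auto.
simpl. econstructor; eauto.
Qed.

(** As long as [s] is not a value, it either steps, and [C s] steps along, or it is stuck, and then
    so is [C s]. A terminating run of [C s] must therefore pass through the value of [s]. *)
Lemma ev_decompose C n s w : commutes_with_step C -> preserves_stuck C -> ev n (C s) w ->
  exists m v, m <= n /\ ev m s v /\ ev (n - m) (C v) w.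
Proof.
intros C_step C_stuck. revert s. induction n as [|n IH]; intros s Hw.
all: destruct (isval_dec s) as [Hs|Hs];
  [exists 0, s; rewrite Nat.sub_0_r; split; [lia|split; [constructor; auto|auto]]|].
all: destruct (step s) as [s'|] eqn:E;
  [|destruct (C_stuck _ E Hs) as [H1 H2]; inversion Hw; subst; solve [contradiction|congruence]].
all: destruct (ev_step_inv _ _ _ _ Hw (C_step _ _ E)) as (m & Hm & Hw').
- discriminate.
- injection Hm as <-. destruct (IH _ Hw') as (k & v & Hk & Hv & Hw2).
  exists (S k), v. split; [lia|]. split; auto. econstructor; eauto.
Qed.

Lemma repl_e_Num h n : repl_e h (Num n) = h n.
Proof. rewrite (frob_eq (repl_e h (Num n))). simpl. destruct (h n); reflexivity. Qed.

(** A rightward leaf of the readback is a numeral returned to the empty stack. Adding [K] at the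
    bottom resumes there, which grafts the readback of [K] onto the leaves; this is how leaf
    replacement in rules 4 and 5 is computed by the machine. *)
Lemma nf_frame D s K :
  eeq (nf D (sapp s K)) (repl_e (fun i => nf D (SR i K)) (nf D s)).
Proof.
set (h := fun i => nf D (SR i K)).
apply (eeq_coind (fun e e' => exists s, e = nf D (sapp s K) /\ e' = repl_e h (nf D s))); eauto.
clear s. intros e e' (s & -> & ->).
assert (Hst : commutes_with_step (fun s => sapp s K))
  by (intros ? ?; apply step_sapp; auto).
assert (Hk : preserves_stuck (fun s => sapp s K)) by (intros ?; apply stuck_sapp; auto).
destruct (val s) as [v|] eqn:Hv.
- destruct (val_Some _ _ Hv) as [n Hn]. pose proof (ev_isval _ _ _ Hn) as Hi.
  assert (E : nf D (sapp s K) = nf D (sapp v K)).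
  { rewrite (nf_eq D (sapp s K)), (nf_eq D (sapp v K)). f_equal.
    destruct (val (sapp v K)) as [w|] eqn:Hw.
    - destruct (val_Some _ _ Hw) as [m Hm]. eapply val_ev.
      apply (ev_compose (fun s => sapp s K) n s v m w Hst Hn Hm).
    - apply val_none_intro. intros m w Hm.
      destruct (ev_decompose (fun s => sapp s K) m s w Hst Hk Hm) as (j & v' & _ & H1 & H2).
      destruct (ev_det _ _ _ Hn _ _ H1) as [_ <-]. exact (val_None _ _ _ Hw H2). }
  rewrite E, (nf_ev _ _ _ _ Hn).
  destruct v as [e rho K0 | [w|p rho|f] bs K0 | k K0]; try contradiction.
  + left. rewrite (nf_ev D 0 (sapp (SC (EV w) bs K0) K) (SC (EV w) bs (K0 ++ K)))
      by (constructor; exact I).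
    rewrite (frob_eq (repl_e _ _)). simpl. destruct (nth w D N) as [ts]. simpl.
    repeat split; auto.
    * intros i Hi'. destruct (nth i ts N) as [us]; simpl.
      do 3 eexists. repeat split; eauto. right. apply eeq_refl.
    * intros i. left. exists (SR i K0). auto.
  + right. destruct K0; [|contradiction]. simpl.
    rewrite repl_e_Num. apply eeq_refl.
- left. rewrite (nf_eq D s), Hv. rewrite (frob_eq (repl_e _ _)).
  rewrite (nf_div D (sapp s K)); simpl; auto. intros n w Hw.
  destruct (ev_decompose (fun s => sapp s K) n s w Hst Hk Hw) as (j & v' & _ & H1 & _).
  exact (val_None _ _ _ Hv H1).
Qed.

(** * The simulation *)

Definition frob_p (p : proc) : proc := match p with Lam ts e => Lam ts e end.
Lemma frob_p_eq p : p = frob_p p.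
Proof. destruct p; reflexivity. Qed.

Lemma eta_eq n x ts : eta n x (Arr ts) =
  Lam ts (Case x (length ts) (fun j => eta (n + length ts) (n + j) (nth j ts N)) (fun i => Num i)).
Proof. rewrite (frob_p_eq (eta n x (Arr ts))). reflexivity. Qed.

Definition Fy_arg (n gv : nat) (ts : list ty) (j : nat) : proc :=
  match j with
  | 0 => Fy (n + length ts) gv ts
  | S j' => eta (n + length ts) (n + j') (nth j' ts N)
  end.

Lemma Fy_eq n gv ts : Fy n gv ts =
  Lam ts (Case gv (S (length ts)) (Fy_arg n gv ts) (fun i => Num i)).
Proof. rewrite (frob_p_eq (Fy n gv ts)). reflexivity. Qed.

Lemma map_nth_error_ext {A B} (f g : A -> B) l :
  (forall i a, nth_error l i = Some a -> f a = g a) -> map f l = map g l.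
Proof.
induction l as [|a l IH]; simpl; intros H; auto.
rewrite (H 0 a eq_refl), IH; auto. intros i b Hb. apply (H (S i)). exact Hb.
Qed.

Lemma map_id_nth_error {A} (f : A -> A) l :
  (forall i a, nth_error l i = Some a -> f a = a) -> map f l = l.
Proof. intros H. rewrite <- (map_id l) at 2. apply map_nth_error_ext. exact H. Qed.

Lemma esub_ext D t a th th' : wt_ent D t a -> (forall w, w < length D -> th w = th' w) ->
  esub th a = esub th' a.
Proof.
intros Ha Hth. induction Ha as [w t Hw | G t p rho Hp Hl Hr IH | ss f Hf IH]; simpl.
- apply Hth. eapply nth_error_lt; eauto.
- f_equal. apply map_nth_error_ext. intros i b Hb.
  destruct (nth_error_lookup rho G i b (eq_sym Hl) Hb) as [u Hu]. eauto.
- f_equal. exact IH.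
Qed.

Lemma esub_id D t a th : wt_ent D t a -> (forall w, w < length D -> th w = EV w) ->
  esub th a = a.
Proof.
intros Ha Hth. induction Ha as [w t Hw | G t p rho Hp Hl Hr IH | ss f Hf IH]; simpl.
- apply Hth. eapply nth_error_lt; eauto.
- f_equal. apply map_id_nth_error. intros i b Hb.
  destruct (nth_error_lookup rho G i b (eq_sym Hl) Hb) as [u Hu]. eauto.
- f_equal. exact IH.
Qed.

Lemma env_sub_id D G rho th : wt_env D G rho -> (forall w, w < length D -> th w = EV w) ->
  map (esub th) rho = rho.
Proof.
intros [Hl H] Hth. apply map_id_nth_error. intros i b Hb.
destruct (nth_error_lookup rho G i b (eq_sym Hl) Hb) as [u Hu]. eapply esub_id; eauto.
Qed.

Definition lk (th : list ent) (w : nat) : ent := nth w th (EV 0).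

Lemma lk_nth_error th w a : nth_error th w = Some a -> lk th w = a.
Proof. apply nth_error_nth. Qed.

Lemma lk_app1 th th' w : w < length th -> lk (th ++ th') w = lk th w.
Proof. apply app_nth1. Qed.

Lemma map_lk_fresh th bs : map (esub (lk (th ++ bs))) (fresh (length th) (length bs)) = bs.
Proof.
unfold fresh. rewrite map_map. simpl. apply nth_error_ext. intros i.
rewrite nth_error_map. destruct (nth_error bs i) eqn:E.
- rewrite nth_error_seq_lt by (eapply nth_error_lt; eauto). simpl. f_equal.
  apply lk_nth_error. rewrite nth_error_app2 by lia.
  replace (length th + i - length th) with i by lia. exact E.
- apply nth_error_None in E.
  rewrite (proj2 (nth_error_None (seq _ _) i)); [reflexivity | rewrite length_seq; exact E].
Qed.

Lemma map_lk_idenv th bs : map (esub (lk (th ++ bs))) (fresh 0 (length th)) = th.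
Proof.
unfold fresh. rewrite map_map. simpl. apply nth_error_ext. intros i.
rewrite nth_error_map. destruct (nth_error th i) eqn:E.
- pose proof (nth_error_lt _ _ _ E). rewrite nth_error_seq_lt by auto. simpl. f_equal.
  rewrite lk_app1 by auto. apply lk_nth_error. exact E.
- apply nth_error_None in E.
  rewrite (proj2 (nth_error_None (seq _ _) i)); [reflexivity | rewrite length_seq; exact E].
Qed.

(* Relates an environment entry to a more direct presentation of the same value: up to
   bisimilar code, eta-expansion ([er_eta]), the unfolding of [Fy] ([er_Y]), and code that was
   obtained by normalising another entry ([er_N]). *)
Inductive er (D : list ty) : ty -> ent -> ent -> Prop :=
| er_V : forall w t, nth_error D w = Some t -> er D t (EV w) (EV w)
| er_C : forall G t p p' rho rho',
    wt_p G p t -> peq p p' -> length rho = length G -> length rho' = length G ->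
    (forall i u a b, nth_error G i = Some u -> nth_error rho i = Some a ->
       nth_error rho' i = Some b -> er D u a b) ->
    er D t (EC p rho) (EC p' rho')
| er_R : forall ss f f', er D (Arr (Arr ss :: ss)) f f' -> er D (Arr ss) (ER f) (ER f')
| er_eta : forall x t rho a b,
    nth_error rho x = Some a -> er D t a b -> er D t (EC (eta (length rho) x t) rho) b
| er_Y : forall gv ss rho f f',
    nth_error rho gv = Some f -> er D (Arr (Arr ss :: ss)) f f' ->
    er D (Arr ss) (EC (Fy (length rho) gv ss) rho) (ER f')
| er_N : forall D0 t q a b th th',
    wt_ent D0 t a -> peq q (rb D0 t a) -> length th = length D0 -> length th' = length D0 ->
    (forall i u a b, nth_error D0 i = Some u -> nth_error th i = Some a ->
       nth_error th' i = Some b -> er D u a b) ->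
    b = esub (lk th') a ->
    er D t (EC q th) b.

Definition pw (D G : list ty) (rho rho' : list ent) : Prop :=
  length rho = length G /\ length rho' = length G /\
  forall i u a b, nth_error G i = Some u -> nth_error rho i = Some a ->
    nth_error rho' i = Some b -> er D u a b.

(** [kr_id] discards a frame that merely passes its numeral on, as pushed by [eta] and [Fy]. [kr_N]
    matches one frame of normalised code with the whole stack segment from which its branches were
    read back. *)
Inductive kr (D : list ty) : list frame -> list frame -> Prop :=
| kr_nil : kr D [] []
| kr_cons : forall G B B' rho rho' K K',
    (forall i, wt_e G (B i)) -> (forall i, eeq (B i) (B' i)) -> pw D G rho rho' ->
    kr D K K' -> kr D ((B, rho) :: K) ((B', rho') :: K')
| kr_id : forall B rho K K',
    (forall i, B i = Num i) -> kr D K K' -> kr D ((B, rho) :: K) K'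
| kr_N : forall D0 B th th' K0 K K',
    wt_k D0 K0 -> (forall i, eeq (B i) (nf D0 (SR i K0))) -> pw D D0 th th' ->
    kr D K K' -> kr D ((B, th) :: K) (map (fsub (lk th')) K0 ++ K').

(** In [sr_N] the left side runs the normal form of [s0] in the environment [th], while the right
    side runs [s0] itself with its variables instantiated by [th']. Thus normalising and then
    substituting is compared with substituting and then running. *)
Inductive sr (D : list ty) : state -> state -> Prop :=
| sr_E : forall G e e' rho rho' K K',
    wt_e G e -> eeq e e' -> pw D G rho rho' -> kr D K K' -> sr D (SE e rho K) (SE e' rho' K')
| sr_C : forall ts a b bs bs' K K',
    er D (Arr ts) a b -> pw D ts bs bs' -> kr D K K' -> sr D (SC a bs K) (SC b bs' K')
| sr_R : forall n K K', kr D K K' -> sr D (SR n K) (SR n K')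
| sr_N : forall D0 e th th' s0 K K',
    wt_s D0 s0 -> eeq e (nf D0 s0) -> pw D D0 th th' -> kr D K K' ->
    sr D (SE e th K) (sapp (ssub (lk th') s0) K').

Lemma er_weaken D D' t a b : er D t a b -> er (D ++ D') t a b.
Proof.
induction 1.
- constructor. apply nth_error_weaken. auto.
- econstructor; eauto.
- constructor; auto.
- eapply er_eta; eauto.
- eapply er_Y; eauto.
- eapply er_N; eauto.
Qed.

Lemma er_refl D t a : wt_ent D t a -> er D t a a.
Proof.
induction 1 as [w t Hw | G t p rho Hp Hl Hr IH | ss f Hf IH].
- constructor; auto.
- econstructor; eauto using peq_refl. intros i u a b Hu Ha Hb.
  rewrite Ha in Hb. injection Hb as <-. eauto.
- constructor; auto.
Qed.

Lemma pw_refl D G rho : wt_env D G rho -> pw D G rho rho.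
Proof.
intros [Hl H]. repeat split; auto. intros i u a b Hu Ha Hb.
rewrite Ha in Hb. injection Hb as <-. apply er_refl. eauto.
Qed.

Lemma pw_nil D : pw D [] [] [].
Proof. repeat split; auto. intros [|i] u b c H; discriminate. Qed.

Lemma pw_cons D t G a b rho rho' : er D t a b -> pw D G rho rho' ->
  pw D (t :: G) (a :: rho) (b :: rho').
Proof.
intros Ha (H1 & H2 & H). repeat split; simpl; try congruence.
intros [|i] u c d; simpl; [congruence|]. apply H.
Qed.

Lemma pw_app D G G' rho rho' bs bs' :
  pw D G rho rho' -> pw D G' bs bs' -> pw D (G ++ G') (rho ++ bs) (rho' ++ bs').
Proof.
intros (H1 & H2 & H) (H1' & H2' & H'). repeat split; try (rewrite !length_app; congruence).
intros i u a b Hu Ha Hb. destruct (nth_error_app_cases _ _ _ _ Hu) as [[Hi Hu']|[Hi Hu']].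
- rewrite nth_error_app1 in Ha, Hb by lia. eauto.
- rewrite nth_error_app2 in Ha, Hb by lia. rewrite H1 in Ha. rewrite H2 in Hb. eauto.
Qed.

Lemma pw_lookup D G rho rho' x t : pw D G rho rho' -> nth_error G x = Some t ->
  exists a b, nth_error rho x = Some a /\ nth_error rho' x = Some b /\ er D t a b.
Proof.
intros (H1 & H2 & H) Hx. destruct (nth_error_lookup G rho x t H1 Hx) as [a Ha].
destruct (nth_error_lookup G rho' x t H2 Hx) as [b Hb]. eauto 6.
Qed.

Lemma kr_refl D K : wt_k D K -> kr D K K.
Proof. induction 1; econstructor; eauto using eeq_refl, pw_refl. Qed.

Lemma pw_clos D G ts Q Q' rho rho' :
  (forall i t, nth_error ts i = Some t -> wt_p G (Q i) t) ->
  (forall i, i < length ts -> peq (Q i) (Q' i)) -> pw D G rho rho' ->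
  pw D ts (clos (length ts) Q rho) (clos (length ts) Q' rho').
Proof.
intros HQ HQ' (H1 & H2 & H). repeat split; try apply length_clos.
intros i u a b Hu Ha Hb. pose proof (nth_error_lt _ _ _ Hu).
rewrite nth_error_clos in Ha, Hb by auto. injection Ha as <-. injection Hb as <-.
eapply er_C; eauto.
Qed.

Lemma pw_clos_eta D ts n rho bs bs' : n = length rho -> pw D ts bs bs' ->
  pw D ts (clos (length ts) (fun j => eta (n + length ts) (n + j) (nth j ts N)) (rho ++ bs)) bs'.
Proof.
intros -> (H1 & H2 & H). repeat split; auto; [apply length_clos|].
intros i u a b Hu Ha Hb. pose proof (nth_error_lt _ _ _ Hu).
rewrite nth_error_clos in Ha by auto. injection Ha as <-.
destruct (nth_error_lookup ts bs i u H1 Hu) as [c Hc].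
rewrite (nth_error_nth _ _ _ Hu).
replace (length rho + length ts) with (length (rho ++ bs)) by (rewrite length_app; lia).
apply (er_eta D _ _ _ c); eauto. rewrite nth_error_app2 by lia.
replace (length rho + i - length rho) with i by lia. exact Hc.
Qed.

(** The first argument passed by [Fy] is again [Fy] code over a longer environment in which [gv]
    still denotes [f], so [er_Y] matches it with [ER f']. This ties the infinite unfolding to the
    finite recursive closure. *)
Lemma pw_clos_Fy D ss gv rho f f' bs bs' :
  nth_error rho gv = Some f -> er D (Arr (Arr ss :: ss)) f f' -> pw D ss bs bs' ->
  pw D (Arr ss :: ss)
     (clos (S (length ss)) (Fy_arg (length rho) gv ss) (rho ++ bs)) (ER f' :: bs').
Proof.
intros Hg Hf Hbs. unfold clos. simpl. apply pw_cons.
- replace (length rho + length ss) with (length (rho ++ bs))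
    by (rewrite length_app; destruct Hbs; lia).
  eapply er_Y; eauto. apply nth_error_weaken. exact Hg.
- rewrite <- seq_shift, map_map. simpl. apply pw_clos_eta; auto.
Qed.

Lemma commutes_ssub_sapp th K : commutes_with_step (fun s => sapp (ssub th s) K).
Proof. intros s s' H. apply step_sapp, step_ssub, H. Qed.

Lemma stuck_ssub_sapp th K : preserves_stuck (fun s => sapp (ssub th s) K).
Proof. intros s. apply stuck_ssub. Qed.

(* Running the normal form of [s0] as code performs in one step what [s0] needs [m] steps for. *)
Lemma sr_N_resolve D D0 e th th' s0 K K' m v0 :
  wt_s D0 s0 -> eeq e (nf D0 s0) -> pw D D0 th th' -> kr D K K' -> ev m s0 v0 ->
  exists s1, step (SE e th K) = Some s1 /\ sr D s1 (sapp (ssub (lk th') v0) K') /\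
    ((exists k, v0 = SR k [] /\ s1 = SR k K) \/
     exists w bs K0 ts a b bs1 K1, v0 = SC (EV w) bs K0 /\
       nth_error D0 w = Some (Arr ts) /\ nth_error th w = Some a /\ nth_error th' w = Some b /\
       s1 = SC a bs1 K1 /\ pw D ts bs1 (map (esub (lk th')) bs) /\
       kr D K1 (map (fsub (lk th')) K0 ++ K')).
Proof.
intros Hs He Hth HK Hv. rewrite (nf_ev _ _ _ _ Hv) in He.
pose proof (wt_ev _ _ _ _ Hv Hs) as Hw. pose proof (ev_isval _ _ _ Hv) as Hi.
destruct v0 as [e0 rho0 K0 | [w|p rho|f] bs K0 | k K0]; try contradiction.
- inversion Hw as [|ts a bs0 K1 Ha Hbs HK0|]; subst. inversion Ha as [w' t' Hw'| |]; subst.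
  simpl in He. rewrite (nth_error_nth _ _ _ Hw') in He.
  inversion He as [| |x r Q Q' B B' HQ HB]; subst.
  destruct (pw_lookup _ _ _ _ _ _ Hth Hw') as (a & b & Hta & Htb & Hab).
  assert (Hpw : pw D ts (clos (length ts) Q th) (map (esub (lk th')) bs)).
  { destruct Hth as (H1 & H2 & H3). destruct Hbs as [Hl Hbs].
      repeat split; [apply length_clos | rewrite length_map; auto |].
      intros i u c d Hu Hc Hd. pose proof (nth_error_lt _ _ _ Hu) as Hlt.
      rewrite nth_error_clos in Hc by auto. injection Hc as <-.
      rewrite nth_error_map in Hd. destruct (nth_error bs i) as [b0|] eqn:Hb0; [|discriminate].
      injection Hd as <-. specialize (HQ i Hlt).
      rewrite (nth_error_nth _ _ _ Hu), (nth_error_nth _ _ _ Hb0) in HQ.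
      eapply er_N; eauto. }
  assert (HK1 : kr D ((B, th) :: K) (map (fsub (lk th')) K0 ++ K')) by (eapply kr_N; eauto).
  simpl. rewrite Hta. eexists. split; [reflexivity|]. split.
  + rewrite (lk_nth_error _ _ _ Htb). eapply sr_C; eauto.
  + right. exists w, bs, K0, ts, a, b. do 2 eexists.
    split; [reflexivity|]. do 4 (split; [eauto|]). auto.
- destruct K0; [|contradiction]. inversion He; subst. simpl. eexists. split; [reflexivity|].
  split; [constructor; auto | left; eauto].
Qed.

Definition hr (D : list ty) (v v' : state) : Prop :=
  match v, v' with
  | SR k [], SR k' [] => k = k'
  | SC (EV w) bs K, SC (EV w') bs' K' =>
      w = w' /\ exists ts, nth_error D w = Some (Arr ts) /\ pw D ts bs bs' /\ kr D K K'
  | _, _ => False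
  end.

(** The code [q] is the readback of calling [a] on fresh variables. Entering it binds those
    variables to [bs], and instantiating the same call by [th' ++ bs'] yields the call on the right,
    so the states become related by [sr_N]. *)
Lemma sr_N_call D D0 ts q a th th' bs bs' K K' :
  wt_ent D0 (Arr ts) a -> peq q (rb D0 (Arr ts) a) -> pw D D0 th th' ->
  pw D ts bs bs' -> kr D K K' ->
  exists e s0, step (SC (EC q th) bs K) = Some (SE e (th ++ bs) K) /\
    s0 = SC a (fresh (length D0) (length ts)) [] /\
    wt_s (D0 ++ ts) s0 /\ eeq e (nf (D0 ++ ts) s0) /\
    SC (esub (lk th') a) bs' K' = sapp (ssub (lk (th' ++ bs')) s0) K'.
Proof.
intros Ha Hq Hth Hbs HK. inversion Hq as [us e e' He]; subst. exists e. eexists.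
split; [reflexivity|]. split; [reflexivity|]. split; [|split]; auto.
- econstructor; [apply wt_ent_weaken; eauto | apply wt_fresh | constructor].
- simpl. destruct Hth as (_ & H2 & _). destruct Hbs as (_ & H2' & _).
  rewrite <- H2, <- H2', map_lk_fresh. f_equal. eapply esub_ext; eauto.
  intros w Hw. rewrite lk_app1 by lia. reflexivity.
Qed.

(** Strong induction on the run on the left works because the left side moves in every case where it
    is not yet a value, while the right side may answer with no step or with many. *)
Lemma sr_forward D n : forall s s' v, sr D s s' -> ev n s v ->
  exists m v', ev m s' v' /\ hr D v v'.
Proof.
induction n as [n IH] using lt_wf_ind. intros s s' v Hs Hv.
(* Here [k] is the length of the remaining left run and [j] the number of steps with which the right
   side answers, possibly 0. *)
assert (Hstep : forall k s1 s1' j, ev k s1 v -> k < n -> sr D s1 s1' ->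
  (forall m v', ev m s1' v' -> ev (j + m) s' v') -> exists m v', ev m s' v' /\ hr D v v').
{ intros k s1 s1' j H1 H2 H3 H4. destruct (IH k H2 _ _ _ H3 H1) as (m & v' & Hm & Hr). eauto. }
destruct Hs as [G e e' rho rho' K K' He Hee Hr HK | ts a b bs bs' K K' Hab Hbs HK
  | k K K' HK | D0 e th th' s0 K K' Hs0 He Hth HK].
- destruct He as [| G k | G x ts Q B Hx HQ HB].
  + inversion Hv as [v1 Hiv | n1 s1 s1' v1 Hst]; subst; [contradiction | discriminate].
  + inversion Hee; subst. destruct (ev_step_inv _ (SE (Num k) rho K) _ _ Hv eq_refl) as (m & -> & Hm).
    apply (Hstep m _ (SR k K') 1 Hm); auto; [constructor; auto|].
    intros; econstructor; eauto. reflexivity.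
  + inversion Hee as [| |x' r Q0 Q' B0 B' HQ' HB']; subst.
    destruct (pw_lookup _ _ _ _ _ _ Hr Hx) as (a & b & Ha & Hb & Hab).
    edestruct (ev_step_inv n) as (m & -> & Hm); [exact Hv| |].
    { simpl. rewrite Ha. reflexivity. }
    apply (Hstep m _ (SC b (clos (length ts) Q' rho') ((B', rho') :: K')) 1 Hm); auto.
    * eapply sr_C; eauto; [eapply pw_clos; eauto | eapply kr_cons; eauto].
    * intros; econstructor; eauto. simpl. rewrite Hb. reflexivity.
- inversion Hab as [w t Hw | G t p p' rho rho' Hp Hpp Hl Hl' Hr | ss f f' Hf
    | x t rho a0 b0 Hx Ha0 | gv ss rho f f' Hg Hf | D0 t q a0 b0 th th' Ha0 Hq Hl Hl' Hth Hb0]; subst.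
  + inversion Hv as [v1 Hiv | n1 s1 s1' v1 Hst]; subst; [|discriminate].
    exists 0, (SC (EV w) bs' K'). split; [constructor; exact I|]. simpl. eauto.
  + inversion Hp as [G' ts' e He]; subst. inversion Hpp as [us e1 e' Hee]; subst.
    destruct (ev_step_inv _ (SC (EC (Lam ts e) rho) bs K) _ _ Hv eq_refl) as (m & -> & Hm).
    apply (Hstep m _ (SE e' (rho' ++ bs') K') 1 Hm); auto.
    * eapply sr_E; eauto. apply pw_app; auto. repeat split; auto.
    * intros; econstructor; eauto. reflexivity.
  + destruct (ev_step_inv _ (SC (ER f) bs K) _ _ Hv eq_refl) as (m & -> & Hm).
    apply (Hstep m _ (SC f' (ER f' :: bs') K') 1 Hm); auto.
    * eapply sr_C; eauto. apply pw_cons; auto.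
    * intros; econstructor; eauto. reflexivity.
  + rewrite eta_eq in Hv. destruct (ev_step_inv _ _ _ _ Hv eq_refl) as (m & -> & Hm).
    edestruct (ev_step_inv m) as (m' & -> & Hm'); [exact Hm| |].
    { simpl. rewrite (nth_error_weaken _ _ _ _ Hx). reflexivity. }
    apply (Hstep m' _ (SC b bs' K') 0 Hm'); auto.
    eapply sr_C; eauto; [apply pw_clos_eta; auto | apply kr_id; auto].
  + rewrite Fy_eq in Hv. destruct (ev_step_inv _ _ _ _ Hv eq_refl) as (m & -> & Hm).
    edestruct (ev_step_inv m) as (m' & -> & Hm'); [exact Hm| |].
    { simpl. rewrite (nth_error_weaken _ _ _ _ Hg). reflexivity. }
    apply (Hstep m' _ (SC f' (ER f' :: bs') K') 1 Hm'); auto.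
    * eapply sr_C; eauto; [apply (pw_clos_Fy _ _ _ _ f); auto | apply kr_id; auto].
    * intros; econstructor; eauto. reflexivity.
  + assert (Hpw : pw D D0 th th') by (repeat split; auto).
    destruct (sr_N_call _ _ _ _ _ _ _ _ _ _ _ Ha0 Hq Hpw Hbs HK) as (e & s0 & Hs & _ & Hw & He & E).
    destruct (ev_step_inv _ _ _ _ Hv Hs) as (m & -> & Hm). rewrite E in Hstep |- *.
    eapply (Hstep m _ _ 0 Hm); eauto. eapply sr_N; eauto. apply pw_app; auto.
- inversion HK as [|G B B' rho rho' K1 K1' HB HBB Hr HK1 | B rho K1 K1' HB HK1
    | D0 B th th' K0 K1 K1' HK0 HB Hth HK1]; subst.
  + inversion Hv as [v1 Hiv | n1 s1 s1' v1 Hst]; subst; [|discriminate].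
    exists 0, (SR k []). split; [constructor; exact I|]. reflexivity.
  + destruct (ev_step_inv _ _ _ _ Hv eq_refl) as (m & -> & Hm).
    apply (Hstep m _ (SE (B' k) rho' K1') 1 Hm); auto.
    * eapply sr_E; eauto.
    * intros; econstructor; eauto. reflexivity.
  + destruct (ev_step_inv _ _ _ _ Hv eq_refl) as (m & -> & Hm).
    rewrite HB in Hm. destruct (ev_step_inv _ _ _ _ Hm eq_refl) as (m' & -> & Hm').
    apply (Hstep m' _ (SR k K') 0 Hm'); auto. constructor; auto.
  + destruct (ev_step_inv _ _ _ _ Hv eq_refl) as (m & -> & Hm).
    eapply (Hstep m _ _ 0 Hm); eauto.
    change (SR k (map (fsub (lk th')) K0 ++ K1')) with (sapp (ssub (lk th') (SR k K0)) K1').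
    eapply sr_N; eauto. constructor; auto.
(* If [s0] has no value, its normal form is [Bot] and the left side is stuck, against [Hv]. *)
- destruct (val s0) as [v0|] eqn:Hv0.
  + destruct (val_Some _ _ Hv0) as [m Hm].
    destruct (sr_N_resolve _ _ _ _ _ _ _ _ _ _ Hs0 He Hth HK Hm) as (s1 & Hs1 & Hsr & _).
    destruct (ev_step_inv _ _ _ _ Hv Hs1) as (j & -> & Hj).
    apply (Hstep j s1 (sapp (ssub (lk th') v0) K') m Hj); [auto | exact Hsr |].
    intros. apply (ev_compose (fun s => sapp (ssub (lk th') s) K') m s0 v0); auto.
    apply commutes_ssub_sapp.
  + rewrite nf_eq, Hv0 in He. simpl in He. inversion He; subst.
    inversion Hv as [v1 Hiv | n1 s1 s1' v1 Hst]; subst; [contradiction | discriminate].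
Qed.

(** The right side stands still under [kr_id], [er_eta], and under [kr_N] or [er_N] when the
    normalised state was already a value. The outer induction on [n] gives nothing there; [HR] and
    [HC] instead recurse on the derivation of [kr] or [er], which gets smaller. *)
Lemma sr_backward D n : forall s s' v', sr D s s' -> ev n s' v' ->
  exists m v, ev m s v /\ hr D v v'.
Proof.
induction n as [n IH] using lt_wf_ind.
assert (Hstep : forall j k s1 s1' s v', ev k s1' v' -> k < n -> sr D s1 s1' ->
  (forall m v, ev m s1 v -> ev (j + m) s v) -> exists m v, ev m s v /\ hr D v v').
{ intros j k s1 s1' s v' H1 H2 H3 H4. destruct (IH k H2 _ _ _ H3 H1) as (m & v & Hm & Hr). eauto. }
assert (HR : forall K K', kr D K K' -> forall k v', ev n (SR k K') v' ->
  exists m v, ev m (SR k K) v /\ hr D v v').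
{ intros K K' HK. induction HK as [|G B B' rho rho' K1 K1' HB HBB Hr HK1 IHK | B rho K1 K1' HB HK1 IHK
    | D0 B th th' K0 K1 K1' HK0 HB Hth HK1 IHK]; intros k v' Hv.
  - inversion Hv as [v1 Hiv | n1 s1 s1' v1 Hst]; subst; [|discriminate].
    exists 0, (SR k []). split; [constructor; exact I|]. reflexivity.
  - destruct (ev_step_inv _ _ _ _ Hv eq_refl) as (m & -> & Hm).
    apply (Hstep 1 m (SE (B k) rho K1) _ _ _ Hm); auto.
    + eapply sr_E; eauto.
    + intros; econstructor; eauto. reflexivity.
  - destruct (IHK _ _ Hv) as (m & v & Hm & Hr). exists (S (S m)), v. split; auto.
    econstructor; [reflexivity|]. rewrite HB. econstructor; [reflexivity | auto].
  - destruct K0 as [|[B0 rho0] K0].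
    + destruct (IHK _ _ Hv) as (m & v & Hm & Hr). exists (S (S m)), v. split; auto.
      econstructor; [reflexivity|]. specialize (HB k). rewrite nf_SR_nil in HB.
      inversion HB. econstructor; [reflexivity | auto].
    + change (SR k (map (fsub (lk th')) ((B0, rho0) :: K0) ++ K1'))
        with (sapp (ssub (lk th') (SR k ((B0, rho0) :: K0))) K1') in Hv.
      destruct (ev_decompose (fun s => sapp (ssub (lk th') s) K1') n _ _
        (commutes_ssub_sapp _ _) (stuck_ssub_sapp _ _) Hv) as (m & v0 & Hle & Hm & Hv0).
      (* Returning to a nonempty stack is not a value, so the right run is consumed and the outer
         induction applies. *)
      assert (0 < m) by (inversion Hm; subst; [contradiction | lia]).
      assert (Hw : wt_s D0 (SR k ((B0, rho0) :: K0))) by (constructor; auto).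
      destruct (sr_N_resolve _ _ _ _ _ _ _ _ _ _ Hw (HB k) Hth HK1 Hm) as (s1 & Hs1 & Hsr & _).
      apply (Hstep 2 (n - m) s1 _ _ _ Hv0); auto; [lia|].
      intros; econstructor; [reflexivity|]. econstructor; [exact Hs1 | auto]. }
assert (HC : forall t a b, er D t a b -> forall ts bs bs' K K' v', t = Arr ts ->
  pw D ts bs bs' -> kr D K K' -> ev n (SC b bs' K') v' ->
  exists m v, ev m (SC a bs K) v /\ hr D v v').
{ intros t a b Hab. induction Hab as [w t Hw | G t p p' rho rho' Hp Hpp Hl Hl' Hr _ | ss f f' Hf _
    | x t rho a0 b0 Hx Ha0 IHa | gv ss rho f f' Hg Hf _ | D0 t q a0 b0 th th' Ha0 Hq Hl Hl' Hth IHth Hb0];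
    intros ts bs bs' K K' v' Et Hbs HK Hv.
  - inversion Hv as [v1 Hiv | n1 s1 s1' v1 Hst]; subst; [|discriminate].
    exists 0, (SC (EV w) bs K). split; [constructor; exact I|]. simpl. eauto.
  - subst t. inversion Hp as [G' ts' e He]; subst. inversion Hpp as [us e1 e' Hee]; subst.
    destruct (ev_step_inv _ _ _ _ Hv eq_refl) as (m & -> & Hm).
    apply (Hstep 1 m (SE e (rho ++ bs) K) _ _ _ Hm); auto.
    + eapply sr_E; eauto. apply pw_app; auto. repeat split; auto.
    + intros; econstructor; eauto. reflexivity.
  - injection Et as <-. destruct (ev_step_inv _ _ _ _ Hv eq_refl) as (m & -> & Hm).
    apply (Hstep 1 m (SC f (ER f :: bs) K) _ _ _ Hm); auto.
    + eapply sr_C; eauto. apply pw_cons; auto. constructor; auto.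
    + intros; econstructor; eauto. reflexivity.
  - subst t.
    assert (Hs : pw D ts (clos (length ts)
       (fun j => eta (length rho + length ts) (length rho + j) (nth j ts N)) (rho ++ bs)) bs')
      by (apply pw_clos_eta; auto).
    assert (HK' : kr D (((fun i => Num i), rho ++ bs) :: K) K') by (apply kr_id; auto).
    destruct (IHa _ _ _ _ _ _ eq_refl Hs HK' Hv) as (m & v & Hm & Hr). exists (S (S m)), v.
    split; auto. rewrite eta_eq. econstructor; [reflexivity|].
    econstructor; [|exact Hm]. simpl. rewrite (nth_error_weaken _ _ _ _ Hx). reflexivity.
  - injection Et as <-. destruct (ev_step_inv _ _ _ _ Hv eq_refl) as (m & -> & Hm).
    eapply (Hstep 2 m (SC f _ _) _ _ _ Hm); auto.
    + eapply sr_C; [exact Hf | apply (pw_clos_Fy D ss gv rho f f' bs bs'); auto|].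
      apply (kr_id _ (fun i => Num i) (rho ++ bs)); eauto.
    + intros; rewrite Fy_eq. econstructor; [reflexivity|]. econstructor; eauto.
      simpl. rewrite (nth_error_weaken _ _ _ _ Hg). reflexivity.
  - subst t. assert (Hpw : pw D D0 th th') by (repeat split; auto).
    destruct (sr_N_call _ _ _ _ _ _ _ _ _ _ _ Ha0 Hq Hpw Hbs HK) as (e & s0 & Hs & Es0 & Hw & He & E).
    subst b0. rewrite E in Hv.
    destruct (ev_decompose (fun s => sapp (ssub (lk (th' ++ bs')) s) K') n _ _
        (commutes_ssub_sapp _ _) (stuck_ssub_sapp _ _) Hv) as (m & v0 & Hle & Hm & Hv0).
    destruct (sr_N_resolve _ _ _ _ _ _ _ _ _ _ Hw He (pw_app _ _ _ _ _ _ _ Hpw Hbs) HK Hm)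
      as (s1 & Hs1 & Hsr & Hcases).
    assert (Hrun : forall j v, ev j s1 v -> ev (2 + j) (SC (EC q th) bs K) v).
    { intros. econstructor; [exact Hs|]. econstructor; [exact Hs1 | auto]. }
    (* With no step on the right, [a0] is a variable. Its entries in the two environments are
       related by a subderivation, whose hypothesis [IHth] finishes the case. *)
    destruct m as [|m].
    + inversion Hm; subst v0. subst s0. destruct a0 as [w|p rho|f]; try contradiction.
      destruct Hcases as [(k & Ek & _)
        | (w' & bs0 & K0 & us & a & b & bs1 & K1 & [= <- <- <-] & Hu & Ha & Hb & Es1 & Hbs1 & HK1)];
        [discriminate|]. subst s1.
      inversion Ha0 as [w' t' Hw'| |]; subst. rewrite (nth_error_weaken _ _ _ _ Hw') in Hu.
      injection Hu as <-. pose proof (nth_error_lt _ _ _ Hw').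
      rewrite nth_error_app1 in Ha, Hb by lia. rewrite Nat.sub_0_r in Hv0. simpl in Hv0.
      rewrite lk_app1, (lk_nth_error _ _ _ Hb) in Hv0 by lia.
      destruct (IHth _ _ _ _ Hw' Ha Hb _ _ _ _ _ _ eq_refl Hbs1 HK1 Hv0) as (j & v & Hj & Hr).
      eauto.
    + apply (Hstep 2 (n - S m) s1 _ _ _ Hv0); auto. lia. }
intros s s' v Hs Hv.
destruct Hs as [G e e' rho rho' K K' He Hee Hr HK | ts a b bs bs' K K' Hab Hbs HK
  | k K K' HK | D0 e th th' s0 K K' Hs0 He Hth HK].
- destruct He as [| G k | G x ts Q B Hx HQ HB].
  + inversion Hee; subst.
    inversion Hv as [v1 Hiv | n1 s1 s1' v1 Hst]; subst; [contradiction | discriminate].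
  + inversion Hee; subst. destruct (ev_step_inv _ _ _ _ Hv eq_refl) as (m & -> & Hm).
    apply (Hstep 1 m (SR k K) _ _ _ Hm); auto; [constructor; auto|].
    intros; econstructor; eauto. reflexivity.
  + inversion Hee as [| |x' r Q0 Q' B0 B' HQ' HB']; subst.
    destruct (pw_lookup _ _ _ _ _ _ Hr Hx) as (a & b & Ha & Hb & Hab).
    edestruct (ev_step_inv n) as (m & -> & Hm); [exact Hv| |].
    { simpl. rewrite Hb. reflexivity. }
    apply (Hstep 1 m (SC a (clos (length ts) Q rho) ((B, rho) :: K)) _ _ _ Hm); auto.
    * eapply sr_C; eauto; [eapply pw_clos; eauto | eapply kr_cons; eauto].
    * intros; econstructor; eauto. simpl. rewrite Ha. reflexivity.
- eapply HC; eauto.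
- eapply HR; eauto.
- destruct (ev_decompose (fun s => sapp (ssub (lk th') s) K') n _ _
    (commutes_ssub_sapp _ _) (stuck_ssub_sapp _ _) Hv) as (m & v0 & Hle & Hm & Hv0).
  destruct (sr_N_resolve _ _ _ _ _ _ _ _ _ _ Hs0 He Hth HK Hm) as (s1 & Hs1 & Hsr & Hcases).
  assert (Hrun : (exists j v1, ev j s1 v1 /\ hr D v1 v) ->
    exists j v1, ev j (SE e th K) v1 /\ hr D v1 v).
  { intros (j & v1 & Hj & Hr). exists (S j), v1. split; auto. econstructor; eauto. }
  (* If [s0] is already a value, the right side has not moved, and the numeral or entry is handled
     by [HR] or [HC]. *)
  apply Hrun. destruct m as [|m]; [|eapply (IH (n - S m)); [lia | exact Hsr | exact Hv0]].
  rewrite Nat.sub_0_r in Hv0.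
  destruct Hcases as [(k & -> & ->)
    | (w' & bs0 & K0 & us & a & b & bs1 & K1 & -> & Hu & Ha & Hb & -> & Hbs1 & HK1)].
  + eapply HR; eauto.
  + simpl in Hv0. rewrite (lk_nth_error _ _ _ Hb) in Hv0.
    destruct Hth as (_ & _ & Hth). eapply HC; eauto.
Qed.

Lemma rb_eeq_shape (X : expr -> expr -> Prop) D t a b :
  (forall us, t = Arr us -> X (nf (D ++ us) (SC a (fresh (length D) (length us)) []))
     (nf (D ++ us) (SC b (fresh (length D) (length us)) []))) ->
  exists ts e e', rb D t a = Lam ts e /\ rb D t b = Lam ts e' /\ X e e'.
Proof. destruct t as [us]. intros H. simpl. do 3 eexists. eauto. Qed.

(** The two simulations make the sides converge together to values with the same head. Their
    arguments, called on fresh variables, and their stacks are again related, so the coinduction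
    continues. *)
Theorem sr_nf D s s' : sr D s s' -> eeq (nf D s) (nf D s').
Proof.
intros Hs.
apply (eeq_coind (fun e e' => exists D s s', sr D s s' /\ e = nf D s /\ e' = nf D s'));
  [|eauto 6].
clear D s s' Hs. intros e e' (D & s & s' & Hs & -> & ->). left.
destruct (val s) as [v|] eqn:Hv.
- destruct (val_Some _ _ Hv) as [n Hn].
  destruct (sr_forward _ _ _ _ _ Hs Hn) as (m & v' & Hm & Hr).
  rewrite (nf_ev _ _ _ _ Hn), (nf_ev _ _ _ _ Hm).
  destruct v as [|[w| |] bs K|k [|]]; try contradiction;
  destruct v' as [|[w'| |] bs' K'|k' [|]]; try contradiction; simpl in Hr |- *; auto.
  destruct Hr as (<- & ts & Hw & (Hl & Hl' & Hpw) & HK). rewrite (nth_error_nth _ _ _ Hw).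
  simpl. repeat split; auto.
  + intros i Hi. apply rb_eeq_shape. intros us Hus. left.
    exists (D ++ us). do 2 eexists. split; [|split; reflexivity].
    apply nth_error_Some in Hi. destruct (nth_error ts i) as [t|] eqn:Ht; [|congruence].
    rewrite (nth_error_nth _ _ _ Ht) in Hus. subst t.
    destruct (nth_error_lookup ts bs i _ Hl Ht) as [a Ha].
    destruct (nth_error_lookup ts bs' i _ Hl' Ht) as [b Hb].
    rewrite (nth_error_nth _ _ _ Ha), (nth_error_nth _ _ _ Hb).
    eapply sr_C; [apply er_weaken; eauto | apply pw_refl, wt_fresh | constructor].
  + intros i. left. exists D, (SR i K), (SR i K'). split; auto. constructor; auto.
- assert (Hv' : val s' = None).
  { apply val_none_intro. intros n v Hn.
    destruct (sr_backward _ _ _ _ _ Hs Hn) as (m & v' & Hm & _). exact (val_None _ _ _ Hv Hm). }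
  rewrite (nf_eq D s), (nf_eq D s'), Hv, Hv'. exact I.
Qed.

(** Well-typed code is already eta-long and normal, and entering a binder extends the identity
    environment to that of the larger context; so running code in it only copies the code. *)
Lemma nf_idenv D e : wt_e D e -> eeq (nf D (SE e (fresh 0 (length D)) [])) e.
Proof.
intros He.
apply (eeq_coind (fun e1 e => exists D, wt_e D e /\ e1 = nf D (SE e (fresh 0 (length D)) [])));
  [|eauto].
clear D e He. intros e1 e (D & He & ->). left.
destruct He as [|D n|D x ts Q B Hx HQ HB].
- rewrite nf_div; [exact I|]. intros n v Hv.
  inversion Hv as [v1 Hiv | n1 s1 s1' v1 Hst]; subst; [contradiction | discriminate].
- rewrite (nf_step _ _ (SR n [])), nf_SR_nil by reflexivity. reflexivity.
- rewrite (nf_step _ _ (SC (EV x) (clos (length ts) Q (fresh 0 (length D))) [(B, fresh 0 (length D))])).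
  2:{ simpl. rewrite nth_error_fresh by (eapply nth_error_lt; eauto). reflexivity. }
  rewrite (nf_var _ _ _ _ _ Hx). simpl. repeat split; auto.
  + intros i Hi. destruct (nth_error ts i) as [t|] eqn:Ht; [|apply nth_error_Some in Ht; auto; contradiction].
    rewrite (nth_error_nth _ _ _ Ht), (nth_error_nth _ _ _ (nth_error_clos _ _ _ _ Hi)).
    specialize (HQ i t Ht). inversion HQ as [D' us b Hb E1 E2 E3]; subst.
    do 3 eexists. split; [reflexivity|]. split; [reflexivity|]. left.
    exists (D ++ us). split; auto.
    rewrite (nf_step _ _ (SE b (fresh 0 (length D) ++ fresh (length D) (length us)) [])).
    * rewrite length_app, <- fresh_app. reflexivity.
    * reflexivity.
  + intros i. left. exists D. split; auto. apply nf_step. reflexivity.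
Qed.

Lemma rb_idenv D p t : wt_p D p t -> peq (rb D t (EC p (fresh 0 (length D)))) p.
Proof.
intros Hp. inversion Hp as [D' us e He]; subst. constructor.
rewrite (nf_step _ _ (SE e (fresh 0 (length D) ++ fresh (length D) (length us)) [])) by reflexivity.
rewrite (fresh_app 0), <- length_app. apply nf_idenv. exact He.
Qed.

(** * Weakening, and representation of meta-terms by closures *)

Lemma sapp_nil s : sapp s [] = s.
Proof. destruct s; simpl; rewrite app_nil_r; reflexivity. Qed.

Lemma preserves_stuck_ssub th : preserves_stuck (ssub th).
Proof. intros s. pose proof (stuck_ssub th s []) as H. rewrite sapp_nil in H. exact H. Qed.

Definition rens (f : nat -> nat) (s : state) : state := ssub (fun w => EV (f w)) s.

Lemma ev_rens f n s v : ev n s v -> ev n (rens f s) (rens f v).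
Proof.
induction 1 as [v Hv | n s s' v Hs He IH].
- constructor. destruct v as [|[]|? []]; auto.
- econstructor; eauto. apply step_ssub. exact Hs.
Qed.

Lemma ren_e_eq f e : ren_e f e =
  match e with
  | Bot => Bot
  | Num n => Num n
  | Case x r Q B => Case (f x) r (fun i => ren_p f (Q i)) (fun i => ren_e f (B i))
  end.
Proof. rewrite (frob_eq (ren_e f e)). destruct e; reflexivity. Qed.

Lemma ren_p_eq f ts e : ren_p f (Lam ts e) = Lam ts (ren_e f e).
Proof. rewrite (frob_p_eq (ren_p f (Lam ts e))). reflexivity. Qed.

Lemma ren_e_eeq f e e' : eeq e e' -> eeq (ren_e f e) (ren_e f e')
with ren_p_peq f p p' : peq p p' -> peq (ren_p f p) (ren_p f p').
Proof.
- destruct 1 as [| |x r Q Q' B B' HQ HB];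
    rewrite !(ren_e_eq f); constructor.
  + intros i Hi. apply ren_p_peq. exact (HQ i Hi).
  + intros i. apply ren_e_eeq. exact (HB i).
- destruct 1. rewrite !ren_p_eq. constructor. apply ren_e_eeq. assumption.
Qed.

Lemma ren_e_cancel f h e : (forall v, f (h v) = v) -> eeq (ren_e f (ren_e h e)) e.
Proof.
intros Hfh. revert e. cofix IH. intros e.
rewrite (ren_e_eq h). destruct e as [|n|x r Q B]; rewrite ren_e_eq; try constructor.
rewrite Hfh. constructor.
- intros i _. destruct (Q i) as [ts e]. rewrite !ren_p_eq. constructor. apply IH.
- intros i. apply IH.
Qed.

Lemma shift_lt n k v : v < n -> shift n k v = v.
Proof. intros H. unfold shift. apply Nat.ltb_lt in H. rewrite H. reflexivity. Qed.

Lemma shift_ge n k v : n <= v -> shift n k v = v + k.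
Proof. intros H. unfold shift. apply Nat.ltb_ge in H. rewrite H. reflexivity. Qed.

Lemma map_shift_fresh n k d m : n <= d ->
  map (esub (fun w => EV (shift n k w))) (fresh d m) = fresh (d + k) m.
Proof.
intros H. unfold fresh. rewrite map_map. simpl. revert d H.
induction m as [|m IH]; intros d H; simpl; auto.
rewrite shift_ge, IH by lia. reflexivity.
Qed.

Lemma nth_error_shift {A} (G Z X : list A) w :
  nth_error (G ++ Z ++ X) (shift (length G) (length Z) w) = nth_error (G ++ X) w.
Proof.
destruct (Nat.lt_ge_cases w (length G)).
- rewrite shift_lt, !nth_error_app1 by auto. reflexivity.
- rewrite shift_ge, !nth_error_app2 by lia. f_equal. lia.
Qed.

(** The block [Z] is inserted below the variables [X] bound during readback. Keeping [X] arbitrary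
    lets the coinduction pass under further binders. *)
Lemma nf_weaken_ren G Z X s : wt_s (G ++ X) s ->
  eeq (nf (G ++ Z ++ X) (rens (shift (length G) (length Z)) s))
      (ren_e (shift (length G) (length Z)) (nf (G ++ X) s)).
Proof.
set (f := shift (length G) (length Z)). intros Hs.
apply (eeq_coind (fun e e' => exists X s, wt_s (G ++ X) s /\ e = nf (G ++ Z ++ X) (rens f s) /\
  e' = ren_e f (nf (G ++ X) s))); [|eauto 6].
clear X s Hs. intros e e' (X & s & Hs & -> & ->). left. rewrite ren_e_eq.
destruct (val s) as [v|] eqn:Hv.
- destruct (val_Some _ _ Hv) as [n Hn]. pose proof (wt_ev _ _ _ _ Hn Hs) as Hw.
  pose proof (ev_isval _ _ _ Hn) as Hi.
  rewrite (nf_ev _ _ _ _ Hn), (nf_ev _ _ _ _ (ev_rens f _ _ _ Hn)).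
  destruct v as [|[w| |] bs K|k [|]]; try contradiction; [|reflexivity].
  inversion Hw as [|ts a bs0 K0 Ha [Hl Hbs] HK|]; subst. inversion Ha as [w' t' Hw'| |]; subst.
  unfold rens. simpl.
  pose proof (nth_error_shift G Z X w) as E. fold f in E. rewrite Hw' in E.
  rewrite (nth_error_nth _ _ _ E), (nth_error_nth _ _ _ Hw'). simpl. repeat split; auto.
  + intros i Hi'. destruct (nth_error ts i) as [[us]|] eqn:Ht;
      [|apply nth_error_None in Ht; lia].
    destruct (nth_error_lookup ts bs i _ Hl Ht) as [b Hb].
    rewrite (nth_error_nth _ _ _ Ht), (nth_error_nth _ _ _ Hb).
    assert (Hb' : nth i (map (esub (fun w => EV (f w))) bs) (EV 0) = esub (fun w => EV (f w)) b).
    { apply nth_error_nth. rewrite nth_error_map, Hb. reflexivity. }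
    rewrite Hb'. simpl. rewrite ren_p_eq. do 3 eexists. split; [reflexivity|].
    split; [reflexivity|]. left. exists (X ++ us). eexists.
    split; [|split; [|rewrite app_assoc; reflexivity]].
    * rewrite app_assoc. econstructor; [apply wt_ent_weaken; eauto | apply wt_fresh | constructor].
    * rewrite <- !app_assoc. unfold rens. simpl. unfold f at 3.
      rewrite map_shift_fresh by (rewrite length_app; lia).
      rewrite !length_app. do 3 f_equal. lia.
  + intros i. left. exists X, (SR i K). split; [constructor; auto|]. auto.
- rewrite (nf_eq (G ++ X) s), Hv. rewrite nf_div; [exact I|]. intros n w Hw.
  destruct (ev_decompose (rens f) n s w) as (j & v' & _ & H1 & _); auto.
  + intros ? ?. apply step_ssub.
  + apply preserves_stuck_ssub.
  + exact (val_None _ _ _ Hv H1).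
Qed.

Lemma wt_k_sub_id D K th : wt_k D K -> (forall w, w < length D -> th w = EV w) ->
  map (fsub th) K = K.
Proof.
intros HK Hth. induction HK as [|G B rho K HB Hr HK IH]; simpl; auto.
rewrite IH. unfold fsub. simpl. rewrite (env_sub_id _ _ _ _ Hr Hth). reflexivity.
Qed.

Lemma ssub_id D s th : wt_s D s -> (forall w, w < length D -> th w = EV w) -> ssub th s = s.
Proof.
intros Hs Hth.
destruct Hs as [G e rho K He Hr HK | ts a bs K Ha Hbs HK | n K HK]; simpl;
  rewrite (wt_k_sub_id _ _ _ HK Hth); auto.
- rewrite (env_sub_id _ _ _ _ Hr Hth). reflexivity.
- rewrite (env_sub_id _ _ _ _ Hbs Hth), (esub_id _ _ _ _ Ha Hth). reflexivity.
Qed.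

Lemma nf_weaken G Z s : wt_s G s ->
  eeq (nf (G ++ Z) s) (ren_e (shift (length G) (length Z)) (nf G s)).
Proof.
intros Hs. pose proof (nf_weaken_ren G Z [] s) as H. rewrite !app_nil_r in H.
unfold rens in H. rewrite (ssub_id G) in H; auto.
intros w Hw. rewrite shift_lt; auto.
Qed.

(** The renaming is the one in [plug_result]. On a state over [G], readback in the larger context
    only shifts levels, and this renaming undoes the shift. *)
Lemma nf_strengthen G Z s : wt_s G s ->
  eeq (ren_e (fun v => if v <? length G then v else v - (length G + length Z) + length G)
         (nf (G ++ Z) s)) (nf G s).
Proof.
intros Hs. eapply eeq_trans; [apply ren_e_eeq, nf_weaken, Hs|]. apply ren_e_cancel.
intros v. destruct (Nat.lt_ge_cases v (length G)) as [H|H].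
- rewrite shift_lt by auto. apply Nat.ltb_lt in H. rewrite H. reflexivity.
- rewrite shift_ge by auto. assert (E : (v + length Z <? length G) = false) by (apply Nat.ltb_ge; lia).
  rewrite E. lia.
Qed.

(** Treats closures and recursive closures uniformly: a recursive one reaches its body with itself
    prepended to the arguments, which models the body of the procedure plugged for [z]. *)
Inductive enters : ent -> list ent -> list ty -> expr -> list ent -> Prop :=
| enters_C : forall ts e rho bs, enters (EC (Lam ts e) rho) bs ts e (rho ++ bs)
| enters_R : forall t ts e rho bs,
    enters (ER (EC (Lam (t :: ts) e) rho)) bs ts e (rho ++ ER (EC (Lam (t :: ts) e) rho) :: bs).

Lemma enters_sub th a bs ts e rho : enters a bs ts e rho ->
  enters (esub th a) (map (esub th) bs) ts e (map (esub th) rho).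
Proof. destruct 1; simpl; rewrite map_app; constructor. Qed.

Lemma enters_wt a bs ts e rho D us : enters a bs ts e rho -> wt_ent D (Arr us) a -> ts = us.
Proof.
destruct 1; inversion 1; subst.
- inversion H2; auto.
- inversion H2; subst. inversion H3. auto.
Qed.

Inductive steps : nat -> state -> state -> Prop :=
| steps_0 : forall s, steps 0 s s
| steps_S : forall n s s1 s2, step s = Some s1 -> steps n s1 s2 -> steps (S n) s s2.

Lemma steps_ev j s s' : steps j s s' -> forall n v, ev n s v -> exists m, n = j + m /\ ev m s' v.
Proof.
induction 1 as [s0 | j s0 s1 s2 Hs0 Hs1 IH]; intros n v Hv; [exists n; auto|].
destruct (ev_step_inv _ _ _ _ Hv Hs0) as (m & -> & Hm).
destruct (IH _ _ Hm) as (m' & -> & Hm'). exists m'. auto.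
Qed.

Lemma steps_nf D j s s' : steps j s s' -> nf D s = nf D s'.
Proof. induction 1; auto. rewrite (nf_step _ _ _ H). auto. Qed.

Lemma steps_wt D j s s' : steps j s s' -> wt_s D s -> wt_s D s'.
Proof. induction 1; eauto using wt_step. Qed.

Lemma steps_trans j s s1 k s2 : steps j s s1 -> steps k s1 s2 -> steps (j + k) s s2.
Proof. induction 1; simpl; auto. intros. econstructor; eauto. Qed.

Lemma enters_steps a bs ts e rho K : enters a bs ts e rho ->
  exists j, 0 < j /\ steps j (SC a bs K) (SE e rho K).
Proof.
destruct 1.
- exists 1. split; auto. econstructor; [reflexivity | constructor].
- exists 2. split; auto. do 2 (econstructor; [reflexivity|]). constructor.
Qed.

(* [rep0 d E e rho]: the meta-expression [E], in an environment of length [d], is the result of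
   substituting the entries of [rho] into the code [e].  Only [GE]-free terms are represented. *)
CoInductive rep0 : nat -> mexpr -> expr -> list ent -> Prop :=
| rep0_bot : forall d rho, rep0 d MBot Bot rho
| rep0_num : forall d n rho, rep0 d (MNum n) (Num n) rho
| rep0_case : forall d Gd B x r Q0 B0 rho,
    repG d Gd x r Q0 rho -> (forall i, rep0 d (B i) (B0 i) rho) ->
    rep0 d (MCase Gd B) (Case x r Q0 B0) rho
with repG : nat -> mground -> nat -> nat -> (nat -> proc) -> list ent -> Prop :=
| repG_var : forall d w x r Q Q0 rho,
    nth_error rho x = Some (EV w) -> (forall i, i < r -> repE d (Q i) (EC (Q0 i) rho)) ->
    repG d (GVar w r Q) x r Q0 rho
| repG_app : forall d P a x r Q Q0 rho,
    nth_error rho x = Some a -> repE d P a -> (forall i, i < r -> repE d (Q i) (EC (Q0 i) rho)) ->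
    repG d (GApp P r Q) x r Q0 rho
with repE : nat -> mproc -> ent -> Prop :=
| repE_lam : forall d ts A a e rho,
    enters a (fresh d (length ts)) ts e rho -> rep0 (d + length ts) A e rho ->
    repE d (MLam ts A) a.

Definition mfrob_e (E : mexpr) : mexpr :=
  match E with MBot => MBot | MNum n => MNum n | MCase G B => MCase G B end.
Lemma mfrob_e_eq E : E = mfrob_e E.
Proof. destruct E; reflexivity. Qed.
Definition mfrob_g (G : mground) : mground :=
  match G with GE E => GE E | GVar x r Q => GVar x r Q | GApp P r Q => GApp P r Q end.
Lemma mfrob_g_eq G : G = mfrob_g G.
Proof. destruct G; reflexivity. Qed.
Definition mfrob_p (P : mproc) : mproc := match P with MLam ts E => MLam ts E end.
Lemma mfrob_p_eq P : P = mfrob_p P.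
Proof. destruct P; reflexivity. Qed.

Lemma embed_e_eq e : embed_e e =
  match e with
  | Bot => MBot
  | Num n => MNum n
  | Case x r Q B => MCase (GVar x r (fun i => embed_p (Q i))) (fun i => embed_e (B i))
  end.
Proof. rewrite (mfrob_e_eq (embed_e e)). destruct e; reflexivity. Qed.

Lemma embed_p_eq ts e : embed_p (Lam ts e) = MLam ts (embed_e e).
Proof. rewrite (mfrob_p_eq (embed_p (Lam ts e))). reflexivity. Qed.

Lemma mren_e_eq f E : mren_e f E =
  match E with
  | MBot => MBot
  | MNum n => MNum n
  | MCase G B => MCase (mren_g f G) (fun i => mren_e f (B i))
  end.
Proof. rewrite (mfrob_e_eq (mren_e f E)). destruct E; reflexivity. Qed.

Lemma mren_g_eq f G : mren_g f G =
  match G with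
  | GE E => GE (mren_e f E)
  | GVar x r Q => GVar (f x) r (fun i => mren_p f (Q i))
  | GApp P r Q => GApp (mren_p f P) r (fun i => mren_p f (Q i))
  end.
Proof. rewrite (mfrob_g_eq (mren_g f G)). destruct G; reflexivity. Qed.

Lemma mren_p_eq f ts E : mren_p f (MLam ts E) = MLam ts (mren_e f E).
Proof. rewrite (mfrob_p_eq (mren_p f (MLam ts E))). reflexivity. Qed.

Lemma sub_e_eq n0 n1 s d E : sub_e n0 n1 s d E =
  match E with
  | MBot => MBot
  | MNum n => MNum n
  | MCase G B => MCase (sub_g n0 n1 s d G) (fun i => sub_e n0 n1 s d (B i))
  end.
Proof. rewrite (mfrob_e_eq (sub_e n0 n1 s d E)). destruct E; reflexivity. Qed.

Lemma sub_g_eq n0 n1 s d G : sub_g n0 n1 s d G =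
  match G with
  | GE E => GE (sub_e n0 n1 s d E)
  | GVar v r Q =>
      if v <? n0 then
        match s v with
        | SVar w => GVar w r (fun i => sub_p n0 n1 s d (Q i))
        | STm P => GApp (mren_p (shift n1 (d - n0)) P) r (fun i => sub_p n0 n1 s d (Q i))
        end
      else GVar (v - n0 + n1) r (fun i => sub_p n0 n1 s d (Q i))
  | GApp P r Q => GApp (sub_p n0 n1 s d P) r (fun i => sub_p n0 n1 s d (Q i))
  end.
Proof.
rewrite (mfrob_g_eq (sub_g n0 n1 s d G)). destruct G; simpl; try reflexivity.
destruct (_ <? _); [destruct (s _)|]; reflexivity.
Qed.

Lemma sub_p_eq n0 n1 s d ts E :
  sub_p n0 n1 s d (MLam ts E) = MLam ts (sub_e n0 n1 s (d + length ts) E).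
Proof. rewrite (mfrob_p_eq (sub_p n0 n1 s d (MLam ts E))). reflexivity. Qed.

Lemma rep0_embed G e : wt_e G e -> rep0 (length G) (embed_e e) e (fresh 0 (length G))
with repE_embed G p t : wt_p G p t -> repE (length G) (embed_p p) (EC p (fresh 0 (length G))).
Proof.
- destruct 1 as [| |G x ts Q B Hx HQ HB]; rewrite embed_e_eq; constructor.
  + constructor.
    * rewrite nth_error_fresh by (eapply nth_error_lt; eauto). reflexivity.
    * intros i Hi. destruct (nth_error ts i) as [t|] eqn:Ht;
        [|apply nth_error_Some in Hi; contradiction].
      eapply repE_embed. exact (HQ i t Ht).
  + intros i. apply rep0_embed. apply HB.
- destruct 1 as [G ts e He]. rewrite embed_p_eq. econstructor; [constructor|].
  rewrite (fresh_app 0), <- length_app. apply rep0_embed. exact He.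
Qed.

Lemma rep0_ren n k d E e rho : n <= d -> rep0 d E e rho ->
  rep0 (d + k) (mren_e (shift n k) E) e (map (esub (fun w => EV (shift n k w))) rho)
with repG_ren n k d Gd x r Q rho : n <= d -> repG d Gd x r Q rho ->
  repG (d + k) (mren_g (shift n k) Gd) x r Q (map (esub (fun w => EV (shift n k w))) rho)
with repE_ren n k d P a : n <= d -> repE d P a ->
  repE (d + k) (mren_p (shift n k) P) (esub (fun w => EV (shift n k w)) a).
Proof.
- intros Hd. destruct 1; rewrite mren_e_eq; constructor.
  + apply repG_ren; assumption.
  + intros i. apply rep0_ren; [assumption | apply H0].
- intros Hd. destruct 1 as [d w x r Q Q0 rho Hx HQ | d P a x r Q Q0 rho Hx HP HQ];
    rewrite mren_g_eq.
  + constructor; [rewrite nth_error_map, Hx; reflexivity|].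
    intros i Hi. apply (repE_ren n k d (Q i) (EC (Q0 i) rho)); [assumption | exact (HQ i Hi)].
  + econstructor; [rewrite nth_error_map, Hx; reflexivity| |].
    * apply repE_ren; assumption.
    * intros i Hi. apply (repE_ren n k d (Q i) (EC (Q0 i) rho)); [assumption | exact (HQ i Hi)].
- intros Hd. destruct 1 as [d ts A a e rho Ha HA]. rewrite mren_p_eq. econstructor.
  + rewrite <- (map_shift_fresh n) by assumption. apply enters_sub. exact Ha.
  + replace (d + k + length ts) with (d + length ts + k) by lia.
    apply rep0_ren; [lia | exact HA].
Qed.

(** Under [j] binders the substituted meta-procedure is shifted by [j], whereas the entry
    representing it stays the same; hence the quantification over [j]. *)
Definition sub_rep (n0 n1 : nat) (s : nat -> sval) (th : nat -> ent) : Prop :=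
  (forall v, v < n0 -> match s v with
     | SVar w => th v = EV w
     | STm P => forall j, repE (n1 + j) (mren_p (shift n1 j) P) (th v)
     end) /\
  (forall v, n0 <= v -> th v = EV (v - n0 + n1)).

Lemma map_sub_fresh n0 n1 th d m : (forall v, n0 <= v -> th v = EV (v - n0 + n1)) -> n0 <= d ->
  map (esub th) (fresh d m) = fresh (d - n0 + n1) m.
Proof.
intros Hth. unfold fresh. rewrite map_map. simpl. revert d.
induction m as [|m IH]; intros d H; simpl; auto.
rewrite Hth, IH by lia. do 3 f_equal. lia.
Qed.

Lemma rep0_sub n0 n1 s th d E e rho : sub_rep n0 n1 s th -> n0 <= d -> rep0 d E e rho ->
  rep0 (d - n0 + n1) (sub_e n0 n1 s d E) e (map (esub th) rho)
with repG_sub n0 n1 s th d Gd x r Q rho : sub_rep n0 n1 s th -> n0 <= d -> repG d Gd x r Q rho ->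
  repG (d - n0 + n1) (sub_g n0 n1 s d Gd) x r Q (map (esub th) rho)
with repE_sub n0 n1 s th d P a : sub_rep n0 n1 s th -> n0 <= d -> repE d P a ->
  repE (d - n0 + n1) (sub_p n0 n1 s d P) (esub th a).
Proof.
- intros Hs Hd. destruct 1; rewrite sub_e_eq; constructor.
  + apply repG_sub; assumption.
  + intros i. apply rep0_sub; [assumption | assumption | apply H0].
- intros Hs Hd. destruct 1 as [d w x r Q Q0 rho Hx HQ | d P a x r Q Q0 rho Hx HP HQ];
    rewrite sub_g_eq.
  + assert (HQ' : forall i, i < r ->
      repE (d - n0 + n1) (sub_p n0 n1 s d (Q i)) (EC (Q0 i) (map (esub th) rho))).
    { intros i Hi. apply (repE_sub n0 n1 s th d (Q i) (EC (Q0 i) rho));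
        [assumption | assumption | exact (HQ i Hi)]. }
    assert (Hx' : nth_error (map (esub th) rho) x = Some (th w))
      by (rewrite nth_error_map, Hx; reflexivity).
    destruct Hs as [Hs1 Hs2]. destruct (Nat.ltb_spec w n0) as [Hw|Hw].
    * specialize (Hs1 w Hw). destruct (s w) as [w'|P].
      -- rewrite Hs1 in Hx'. constructor; assumption.
      -- econstructor; [exact Hx' | | exact HQ'].
         replace (d - n0 + n1) with (n1 + (d - n0)) by lia. apply Hs1.
    * rewrite (Hs2 w Hw) in Hx'. constructor; assumption.
  + econstructor; [rewrite nth_error_map, Hx; reflexivity| |].
    * apply repE_sub; assumption.
    * intros i Hi. apply (repE_sub n0 n1 s th d (Q i) (EC (Q0 i) rho));
        [assumption | assumption | exact (HQ i Hi)].
- intros Hs Hd. destruct 1 as [d ts A a e rho Ha HA]. rewrite sub_p_eq. econstructor.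
  + rewrite <- (map_sub_fresh n0 n1 th) by (try apply Hs; assumption). apply enters_sub. exact Ha.
  + replace (d - n0 + n1 + length ts) with (d + length ts - n0 + n1) by lia.
    apply rep0_sub; [assumption | lia | exact HA].
Qed.

(** * Normalisation of meta-terms *)

(** The machine stack stands for the [case] contexts around the head. [repK_GE] is such a context
    before commutation; after it, [repK_case] finds the rest of the stack inside every branch. In
    [repK_bot] the stack is arbitrary, since reducing a [case] of [MBot] discards its branches. *)
CoInductive repK (d : nat) : mexpr -> expr -> list ent -> list frame -> Prop :=
| repK_0 : forall E e rho, rep0 d E e rho -> repK d E e rho []
| repK_bot : forall rho K, repK d MBot Bot rho K
| repK_case : forall Gd B x r Q0 B0 rho K,
    repG d Gd x r Q0 rho -> (forall i, repK d (B i) (B0 i) rho K) ->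
    repK d (MCase Gd B) (Case x r Q0 B0) rho K
| repK_GE : forall E1 B1 e rho B0 rhoB K,
    rep0 d E1 e rho -> (forall n, repK d (B1 n) (B0 n) rhoB K) ->
    repK d (MCase (GE E1) B1) e rho ((B0, rhoB) :: K).

Definition caseGE (E : mexpr) : bool := match E with MCase (GE _) _ => true | _ => false end.

Lemma repK_case_inv d Gd B e rho K : is_GE Gd = false -> repK d (MCase Gd B) e rho K ->
  exists x r Q0 B0, e = Case x r Q0 B0 /\ repG d Gd x r Q0 rho /\
    forall i, repK d (B i) (B0 i) rho K.
Proof.
intros HG H. inversion H as [E e1 rho1 H0 | | Gd1 B1 x r Q0 B0 rho1 K1 H1 H2 |]; subst.
- inversion H0 as [| |d0 Gd1 B1 x r Q0 B0 rho1 H1 H2]; subst. do 4 eexists. split; [reflexivity|].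
  split; auto. intros i. constructor. auto.
- eauto 8.
- discriminate.
Qed.

(** A beta step substitutes into the whole body, whereas the machine only binds the arguments in an
    environment. The two agree because substitution acts on the representing environment through
    [esub] and leaves the code [e0] alone. *)
Lemma hstep_beta_rep D ts A r Q x Q0 B B0 us G rho K e0 rho0 a :
  nth_error rho x = Some a -> enters a (fresh (length D) (length ts)) ts e0 rho0 ->
  rep0 (length D + length ts) A e0 rho0 ->
  (forall i, i < r -> repE (length D) (Q i) (EC (Q0 i) rho)) ->
  (forall i, repK (length D) (B i) (B0 i) rho K) ->
  r = length us -> wt_ent D (Arr us) a -> wt_env D G rho ->
  (forall i t, nth_error us i = Some t -> wt_p G (Q0 i) t) ->
  exists j rho', 0 < j /\
    steps j (SE (Case x r Q0 B0) rho K) (SE e0 rho' ((B0, rho) :: K)) /\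
    repK (length D)
      (MCase (GE (sub_e (length D + length ts) (length D)
        (fun v => if v <? length D then SVar v else STm (Q (v - length D)))
        (length D + length ts) A)) B) e0 rho' ((B0, rho) :: K).
Proof.
intros Hx Ha HA HQ HB -> Hwa Hrho HQ0. pose proof (enters_wt _ _ _ _ _ _ _ Ha Hwa) as ->.
set (d := length D) in *. set (r := length us) in *.
(* Levels below [d] are free, the next [r] are the instantiated binders, and those bound deeper move
   down by [r]. *)
set (th := fun v => if v <? d then EV v else if v <? d + r then EC (Q0 (v - d)) rho
                    else EV (v - r)).
assert (Hth : forall w, w < d -> th w = EV w)
  by (intros w Hw; unfold th; apply Nat.ltb_lt in Hw; rewrite Hw; reflexivity).
assert (Hth2 : forall w, d <= w -> w < d + r -> th w = EC (Q0 (w - d)) rho).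
{ intros w H1 H2. unfold th. apply Nat.ltb_ge in H1. apply Nat.ltb_lt in H2.
  rewrite H1, H2. reflexivity. }
assert (Hcl : map (esub th) (fresh d r) = clos r Q0 rho).
{ unfold fresh, clos. rewrite map_map. simpl. apply nth_error_ext. intros i.
  rewrite !nth_error_map. destruct (Nat.lt_ge_cases i r).
  - rewrite !nth_error_seq_lt by auto. simpl. rewrite Hth2 by lia. do 3 f_equal. lia.
  - rewrite !(proj2 (nth_error_None _ _)) by (rewrite length_seq; auto). reflexivity. }
pose proof (enters_sub th _ _ _ _ _ Ha) as Ha'.
rewrite Hcl, (esub_id _ _ _ _ Hwa Hth) in Ha'.
destruct (enters_steps _ _ _ _ _ ((B0, rho) :: K) Ha') as (j & Hj & Hst).
exists (S j), (map (esub th) rho0). split; [lia|]. split.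
- econstructor; [|exact Hst]. simpl. rewrite Hx. reflexivity.
- constructor; auto.
  replace d with (d + r - (d + r) + d) at 1 by lia. apply rep0_sub; auto.
  split.
  + intros v Hv. destruct (Nat.ltb_spec v d) as [Hd|Hd]; [auto|].
    intros k. rewrite Hth2 by auto. assert (Hi : v - d < r) by lia.
    pose proof (repE_ren d k d _ _ (Nat.le_refl d) (HQ _ Hi)) as HR.
    rewrite (esub_id D (nth (v - d) us N)) in HR; auto.
    * eapply wt_EC_env; eauto. apply HQ0. apply nth_error_nth'. exact Hi.
    * intros w Hw. rewrite shift_lt; auto.
  + intros v Hv. unfold th. assert (E1 : (v <? d) = false) by (apply Nat.ltb_ge; lia).
    assert (E2 : (v <? d + r) = false) by (apply Nat.ltb_ge; lia). rewrite E1, E2. f_equal. lia.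
Qed.

(** Beta steps and the selection of a branch cost machine steps. Commutation of cases and
    propagation of [MBot] cost none, but their result is no longer a [case] of a [GE], so two free
    steps never follow each other. *)
Lemma hstep_rep D E E' e rho K : wt_s D (SE e rho K) -> repK (length D) E e rho K ->
  hstep (length D) E = Some E' ->
  exists j e' rho' K', steps j (SE e rho K) (SE e' rho' K') /\ repK (length D) E' e' rho' K' /\
    (j = 0 -> caseGE E = true /\ caseGE E' = false).
Proof.
intros Hw Hr Hs. inversion Hw as [G e1 rho1 K1 He Hrho HK | |]; subst.
assert (Hcase : forall Gd B, is_GE Gd = false -> E = MCase Gd B ->
  exists j e' rho' K', 0 < j /\ steps j (SE e rho K) (SE e' rho' K') /\
    repK (length D) E' e' rho' K').
{ intros Gd B HG ->. destruct (repK_case_inv _ _ _ _ _ _ HG Hr) as (x & r & Q0 & B0 & -> & Hg & HB).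
  inversion He as [| |G1 x1 us Q1 B1 Hx HQ1 HB1]; subst.
  inversion Hg as [d0 w x1 r1 Q Q1 rho1 Hx' HQ | d0 P a x1 r1 Q Q1 rho1 Hx' HP HQ]; subst;
    [discriminate|].
  destruct (wt_env_lookup _ _ _ _ _ Hrho Hx) as (a' & Ha' & Hwa).
  rewrite Hx' in Ha'. injection Ha' as <-.
  inversion HP as [d0 ts A a1 e0 rho0 Ha HA]; subst. injection Hs as <-.
  destruct (hstep_beta_rep D ts A _ Q x Q0 B B0 us G rho K e0 rho0 a Hx' Ha HA HQ HB eq_refl
    Hwa Hrho HQ1) as (j & rho' & Hj & Hst & Hrep).
  eauto 8. }
inversion Hr as [E1 e1 rho1 H0 | rho1 K1 | Gd B x r Q0 B0 rho1 K1 H1 H2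
  | E1 B1 e1 rho1 B0 rhoB K1 H0 HB]; subst.
- inversion H0 as [| |d Gd B x r Q0 B0 rho1 Hg HB]; subst; try discriminate.
  assert (HG : is_GE Gd = false) by (destruct Hg; reflexivity).
  destruct (Hcase _ _ HG eq_refl) as (j & e' & rho' & K' & Hj & H1 & H2).
  exists j, e', rho', K'. repeat split; auto; lia.
- discriminate.
- assert (HG : is_GE Gd = false) by (destruct H1; reflexivity).
  destruct (Hcase _ _ HG eq_refl) as (j & e' & rho' & K' & Hj & H3 & H4).
  exists j, e', rho', K'. repeat split; auto; lia.
- inversion H0 as [|d n rho1|d Gd B x r Q0 B2 rho1 Hg HB2]; subst; injection Hs as <-.
  + exists 0, Bot, rho, ((B0, rhoB) :: K1). split; [constructor|]. split; [constructor|]. auto.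
  + exists 2, (B0 n), rhoB, K1. split; [|split; [auto | discriminate]].
    do 2 (econstructor; [reflexivity|]). constructor.
  + exists 0, (Case x r Q0 B2), rho, ((B0, rhoB) :: K1). split; [constructor|].
    assert (HG : is_GE Gd = false) by (destruct Hg; reflexivity). split.
    * constructor; auto. intros i. constructor; auto.
    * intros _. destruct Gd; auto; discriminate.
Qed.

Lemma hred_forward D n : forall E e rho K, wt_s D (SE e rho K) -> repK (length D) E e rho K ->
  hstep (length D) (hred (length D) n E) = None ->
  exists j e' rho' K', steps j (SE e rho K) (SE e' rho' K') /\
    repK (length D) (hred (length D) n E) e' rho' K'.
Proof.
induction n as [|n IH]; intros E e rho K Hw Hr Hn.
- exists 0, e, rho, K. split; [constructor | exact Hr].
- simpl in Hn |- *. destruct (hstep (length D) E) as [E'|] eqn:Hs.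
  + destruct (hstep_rep _ _ _ _ _ _ Hw Hr Hs) as (j & e1 & rho1 & K1 & Hj & Hr1 & _).
    destruct (IH _ _ _ _ (steps_wt _ _ _ _ Hj Hw) Hr1 Hn) as (k & e2 & rho2 & K2 & Hk & Hr2).
    exists (j + k), e2, rho2, K2. split; auto. eapply steps_trans; eauto.
  + exists 0, e, rho, K. split; [constructor | exact Hr].
Qed.

(** Each head reduction step, or each pair of them when the first is free, consumes a part of the
    terminating machine run, so head reduction stops. *)
Lemma hred_backward D n : forall E e rho K v, wt_s D (SE e rho K) ->
  repK (length D) E e rho K -> ev n (SE e rho K) v ->
  exists m, hstep (length D) (hred (length D) m E) = None.
Proof.
assert (Hcons : forall E E', hstep (length D) E = Some E' ->
  (exists m, hstep (length D) (hred (length D) m E') = None) ->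
  exists m, hstep (length D) (hred (length D) m E) = None).
{ intros E E' Hs [m Hm]. exists (S m). simpl. rewrite Hs. exact Hm. }
induction n as [n IH] using lt_wf_ind. intros E e rho K v Hw Hr Hv.
destruct (hstep (length D) E) as [E'|] eqn:Hs; [|exists 0; exact Hs].
apply (Hcons _ _ Hs).
destruct (hstep_rep _ _ _ _ _ _ Hw Hr Hs) as (j & e1 & rho1 & K1 & Hj & Hr1 & H0).
pose proof (steps_wt _ _ _ _ Hj Hw) as Hw1.
destruct (steps_ev _ _ _ Hj _ _ Hv) as (m & -> & Hm).
destruct j as [|j]; [|apply (IH m) with (2 := Hw1) (3 := Hr1) (4 := Hm); lia].
destruct (H0 eq_refl) as [_ HGE].
destruct (hstep (length D) E') as [E''|] eqn:Hs'; [|exists 0; exact Hs'].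
apply (Hcons _ _ Hs').
destruct (hstep_rep _ _ _ _ _ _ Hw1 Hr1 Hs') as (k & e2 & rho2 & K2 & Hk & Hr2 & H1).
destruct (steps_ev _ _ _ Hk _ _ Hm) as (m' & -> & Hm').
destruct k as [|k]; [destruct (H1 eq_refl); congruence|].
apply (IH m') with (2 := steps_wt _ _ _ _ Hk Hw1) (3 := Hr2) (4 := Hm'); lia.
Qed.

Lemma nfe_eq d E : nfe d E =
  match hnf d E with
  | Some (MNum n) => Num n
  | Some (MCase (GVar x r Q) B) => Case x r (fun i => nfp d (Q i)) (fun i => nfe d (B i))
  | _ => Bot
  end.
Proof.
rewrite (frob_eq (nfe d E)). simpl.
destruct (hnf d E) as [[| |[] ?]|]; reflexivity.
Qed.

Lemma nfp_eq d ts E : nfp d (MLam ts E) = Lam ts (nfe (d + length ts) E).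
Proof. rewrite (frob_p_eq (nfp d (MLam ts E))). reflexivity. Qed.

(** If head reduction stops, the machine has followed it to the same head. If it does not,
    [hred_backward] excludes a machine value, and both trees are [Bot]. *)
Theorem nfe_nf D E e rho K : wt_s D (SE e rho K) -> repK (length D) E e rho K ->
  eeq (nfe (length D) E) (nf D (SE e rho K)).
Proof.
intros Hw Hr.
apply (eeq_coind (fun e1 e2 => exists D E e rho K, wt_s D (SE e rho K) /\
  repK (length D) E e rho K /\ e1 = nfe (length D) E /\ e2 = nf D (SE e rho K))); [|eauto 10].
clear D E e rho K Hw Hr. intros e1 e2 (D & E & e & rho & K & Hw & Hr & -> & ->). left.
rewrite nfe_eq. unfold hnf. destruct excluded_middle_informative as [H|H].
- destruct constructive_indefinite_description as [n Hn]. simpl.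
  destruct (hred_forward _ _ _ _ _ _ Hw Hr Hn) as (j & e' & rho' & K' & Hj & Hr').
  rewrite (steps_nf _ _ _ _ Hj). pose proof (steps_wt _ _ _ _ Hj Hw) as Hw'.
  clear e rho K Hw Hr Hj.
  destruct (hred (length D) n E) as [|k|Gd B].
  + assert (Ee : e' = Bot) by (inversion Hr' as [E1 e1 rho1 H0 | | |]; subst; auto; inversion H0; auto).
    subst e'. rewrite nf_div; [exact I|]. intros m v Hv.
    inversion Hv as [v1 Hiv | n1 s1 s1' v1 Hst]; subst; [contradiction | discriminate].
  + inversion Hr' as [E1 e1 rho1 H0 | | |]; subst. inversion H0; subst.
    rewrite (nf_step _ _ (SR k [])), nf_SR_nil by reflexivity. reflexivity.
  (* Any [GE] or [GApp] in head position still admits an [hstep]. *)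
  + assert (HG : exists w r Q, Gd = GVar w r Q).
    { destruct Gd as [[| |]| |[]]; try discriminate; eauto. }
    destruct HG as (w & r & Q & ->).
    destruct (repK_case_inv (length D) (GVar w r Q) B e' rho' K' eq_refl Hr')
      as (x & r1 & Q0 & B0 & -> & Hg & HB).
    inversion Hg as [d1 w1 x1 r2 Q1 Q2 rho1 Hx HQ|]; subst.
    inversion Hw' as [G e1 rho1 K1 He Hrho HK | |]; subst.
    inversion He as [| |G1 x1 us Q1 B1 HGx HQ1 HB1]; subst.
    destruct (wt_env_lookup _ _ _ _ _ Hrho HGx) as (a & Ha & Hwa).
    rewrite Hx in Ha. injection Ha as <-. inversion Hwa as [w1 t1 Hw1| |]; subst.
    rewrite (nf_step _ _ (SC (EV w) (clos (length us) Q0 rho') ((B0, rho') :: K')))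
      by (simpl; rewrite Hx; reflexivity).
    rewrite (nf_var _ _ _ _ _ Hw1). simpl. repeat split; auto.
    * intros i Hi. specialize (HQ i Hi).
      inversion HQ as [d1 ts A a e1 rho1 Hent HA E1 E2 E3]; subst.
      destruct (nth_error us i) as [t|] eqn:Ht; [|apply nth_error_None in Ht; lia].
      specialize (HQ1 i t Ht). inversion Hent as [ts1 e2 rho2 bs2 E4|]; subst.
      rewrite <- E4 in HQ1. inversion HQ1 as [G2 ts2 e3 He3]; subst.
      rewrite (nth_error_nth _ _ _ Ht), (nth_error_nth _ _ _ (nth_error_clos _ _ _ _ Hi)).
      rewrite nfp_eq. do 3 eexists. split; [reflexivity|]. split; [reflexivity|]. left.
      exists (D ++ ts), A, e1, (rho' ++ fresh (length D) (length ts)), [].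
      rewrite length_app. split; [|split; [constructor; auto|split; auto]].
      -- econstructor; [eauto | apply wt_env_app; [apply wt_env_weaken; eauto | apply wt_fresh]
           | constructor].
      -- rewrite <- E4. apply nf_step. reflexivity.
    * intros i. left. exists D, (B i), (B0 i), rho', K'. split; [econstructor; eauto|].
      split; auto. split; auto. apply nf_step. reflexivity.
- rewrite nf_div; [exact I|]. intros n v Hv. apply H. eapply hred_backward; eauto.
Qed.

Lemma app_nf G p q t ts : wt_p G p (Arr (t :: ts)) -> wt_p G q t ->
  exists e, p = Lam (t :: ts) e /\
    peq (Defs.app (length G) p q)
      (Lam ts (nf (G ++ ts) (SE e (fresh 0 (length G) ++
         EC q (fresh 0 (length G)) :: fresh (length G) (length ts)) []))) /\
    wt_s (G ++ ts) (SE e (fresh 0 (length G) ++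
         EC q (fresh 0 (length G)) :: fresh (length G) (length ts)) []).
Proof.
intros Hp Hq. inversion Hp as [G1 ts1 e He]; subst. exists e. split; [reflexivity|].
set (g := length G) in *. set (rho := fresh 0 g ++ EC q (fresh 0 g) :: fresh g (length ts)).
assert (Hwq : wt_ent G t (EC q (fresh 0 g))) by (eapply wt_EC_env; [eauto | apply wt_idenv]).
assert (Hw : wt_s (G ++ ts) (SE e rho [])).
{ econstructor; [exact He | | constructor]. apply wt_env_app.
  - apply wt_env_weaken, wt_idenv.
  - apply wt_env_cons; [apply wt_ent_weaken, Hwq | apply wt_fresh]. }
split; auto. constructor. fold g.
replace (g + length ts) with (length (G ++ ts)) by apply length_app.
apply nfe_nf; auto. constructor.
set (th := fun v => if v <? g then EV v else if v =? g then EC q (fresh 0 g) else EV (v - 1)).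
assert (Er : map (esub th) (fresh 0 (g + 1 + length ts)) = rho).
{ rewrite <- (fresh_app 0 (g + 1)), <- (fresh_app 0 g), !map_app. unfold rho.
  rewrite <- app_assoc. f_equal; [|simpl; f_equal].
  - apply map_id_nth_error. intros i a Hi.
    pose proof (nth_error_lt _ _ _ Hi) as Hl. rewrite length_fresh in Hl.
    rewrite nth_error_fresh in Hi by auto. injection Hi as <-. simpl. unfold th.
    apply Nat.ltb_lt in Hl. rewrite Hl. reflexivity.
  - unfold th. rewrite Nat.ltb_irrefl, Nat.eqb_refl. reflexivity.
  - rewrite (map_sub_fresh (g + 1) g); [f_equal; lia| |lia].
    intros v Hv. unfold th. assert (E1 : (v <? g) = false) by (apply Nat.ltb_ge; lia).
    assert (E2 : (v =? g) = false) by (apply Nat.eqb_neq; lia). rewrite E1, E2. f_equal. lia. }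
rewrite <- Er.
replace (length (G ++ ts)) with (g + 1 + length ts - (g + 1) + g) by (rewrite length_app; fold g; lia).
apply rep0_sub; [|lia|].
- split.
  + intros v Hv. unfold th. destruct (Nat.ltb_spec v g) as [Hd|Hd]; [auto|].
    replace v with g by lia. rewrite Nat.eqb_refl. intros j.
    pose proof (repE_ren g j g _ _ (Nat.le_refl g) (repE_embed _ _ _ Hq)) as HR.
    rewrite (esub_id G t) in HR; auto. intros w Hlt. rewrite shift_lt; auto.
  + intros v Hv. unfold th. assert (E1 : (v <? g) = false) by (apply Nat.ltb_ge; lia).
    assert (E2 : (v =? g) = false) by (apply Nat.eqb_neq; lia). rewrite E1, E2. f_equal. lia.
- pose proof (rep0_embed _ _ He) as H. rewrite length_app in H. simpl in H. fold g in H.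
  replace (g + S (length ts)) with (g + 1 + length ts) in H by lia. exact H.
Qed.

(** * Plugging *)

Lemma pick_Some P m : pick P = Some m -> P m.
Proof.
unfold pick. destruct excluded_middle_informative as [H|H]; [|discriminate].
destruct constructive_indefinite_description as [k Hk]. simpl. intros [= <-]. exact Hk.
Qed.

Lemma pick_None P m : pick P = None -> ~ P m.
Proof.
unfold pick. destruct excluded_middle_informative as [H|H]; [discriminate|].
intros _ Hm. eauto.
Qed.

Lemma lub_e_eq c : lub_e c =
  match pick (fun m => is_mbot (c m) = false) with
  | None => MBot
  | Some m =>
      match c m with
      | MBot => MBot
      | MNum n => MNum n
      | MCase _ _ => MCase (lub_g (fun j => caseG (c (m + j))))
                           (fun i => lub_e (fun j => caseB i (c (m + j))))
      end
  end.
Proof.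
rewrite (mfrob_e_eq (lub_e c)). simpl. destruct (pick _) as [m|]; [|reflexivity].
destruct (c m); reflexivity.
Qed.

Lemma lub_g_eq c : lub_g c =
  match pick (fun m => is_GE (c m) = false) with
  | None => GE (lub_e (fun j => unGE (c j)))
  | Some m =>
      match c m with
      | GVar x r _ => GVar x r (fun i => lub_p (fun j => argG i (c (m + j))))
      | GApp _ r _ => GApp (lub_p (fun j => headP (c (m + j)))) r
                           (fun i => lub_p (fun j => argG i (c (m + j))))
      | GE _ => GE (lub_e (fun j => unGE (c (m + j))))
      end
  end.
Proof.
rewrite (mfrob_g_eq (lub_g c)). simpl. destruct (pick _) as [m|]; [|reflexivity].
destruct (c m); reflexivity.
Qed.

Lemma lub_p_eq c : lub_p c = MLam (binders (c 0)) (lub_e (fun j => body (c j))).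
Proof. rewrite (mfrob_p_eq (lub_p c)). reflexivity. Qed.

(** The index chosen by [pick] is arbitrary, hence the existential [m]; the components are limits of
    the tail of the chain starting there. *)
Lemma lub_e_case c : (forall j, exists G B, c j = MCase G B) ->
  exists m, lub_e c = MCase (lub_g (fun j => caseG (c (m + j))))
                            (fun i => lub_e (fun j => caseB i (c (m + j)))).
Proof.
intros Hc. destruct (pick (fun m => is_mbot (c m) = false)) as [m|] eqn:Hm.
- exists m. rewrite lub_e_eq, Hm. destruct (Hc m) as (G & B & E). rewrite E at 1. reflexivity.
- exfalso. apply (pick_None _ 0 Hm). destruct (Hc 0) as (G & B & ->). reflexivity.
Qed.

Lemma lub_g_var c w r : (forall j, exists Q, c j = GVar w r Q) ->
  exists m, lub_g c = GVar w r (fun i => lub_p (fun j => argG i (c (m + j)))).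
Proof.
intros Hc. destruct (pick (fun m => is_GE (c m) = false)) as [m|] eqn:Hm.
- exists m. rewrite lub_g_eq, Hm. destruct (Hc m) as (Q & E). rewrite E at 1. reflexivity.
- exfalso. apply (pick_None _ 0 Hm). destruct (Hc 0) as (Q & ->). reflexivity.
Qed.

Lemma lub_g_app c r : (exists j, is_GE (c j) = false) ->
  (forall j, is_GE (c j) = true \/ exists P Q, c j = GApp P r Q) ->
  exists m, is_GE (c m) = false /\
    lub_g c = GApp (lub_p (fun j => headP (c (m + j)))) r
                   (fun i => lub_p (fun j => argG i (c (m + j)))).
Proof.
intros [j0 Hj0] Hc. destruct (pick (fun m => is_GE (c m) = false)) as [m|] eqn:Hm.
- exists m. pose proof (pick_Some _ _ Hm) as Hge. split; auto. rewrite lub_g_eq, Hm.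
  destruct (Hc m) as [H|(P & Q & E)]; [congruence|]. rewrite E at 1. reflexivity.
- destruct (pick_None _ j0 Hm Hj0).
Qed.

Lemma circ_e_eq lo hi E : circ_e lo hi E =
  match E with
  | MBot => MBot
  | MNum n => MNum n
  | MCase G B => MCase (circ_g lo hi G) (fun i => circ_e lo hi (B i))
  end.
Proof. rewrite (mfrob_e_eq (circ_e lo hi E)). destruct E; reflexivity. Qed.

Lemma circ_g_eq lo hi G : circ_g lo hi G =
  match G with
  | GE E => GE (circ_e lo hi E)
  | GVar x r Q => if andb (lo <=? x) (x <? hi) then GE MBot
                  else GVar x r (fun i => circ_p lo hi (Q i))
  | GApp P r Q => GApp (circ_p lo hi P) r (fun i => circ_p lo hi (Q i))
  end.
Proof.
rewrite (mfrob_g_eq (circ_g lo hi G)). destruct G; simpl; try reflexivity.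
destruct (andb _ _); reflexivity.
Qed.

Lemma circ_p_eq lo hi ts E : circ_p lo hi (MLam ts E) = MLam ts (circ_e lo hi E).
Proof. rewrite (mfrob_p_eq (circ_p lo hi (MLam ts E))). reflexivity. Qed.

Definition it_e n s d k E := Nat.iter k (sub_e n n s d) E.
Definition it_g n s d k G := Nat.iter k (sub_g n n s d) G.
Definition it_p n s d k P := Nat.iter k (sub_p n n s d) P.

Lemma it_e_eq n s d k E : it_e n s d k E =
  match E with
  | MBot => MBot
  | MNum i => MNum i
  | MCase G B => MCase (it_g n s d k G) (fun i => it_e n s d k (B i))
  end.
Proof.
induction k as [|k IH]; [destruct E; reflexivity|].
change (it_e n s d (S k) E) with (sub_e n n s d (it_e n s d k E)). rewrite IH, sub_e_eq.
destruct E; reflexivity.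
Qed.

Lemma it_p_eq n s d k ts E : it_p n s d k (MLam ts E) = MLam ts (it_e n s (d + length ts) k E).
Proof.
induction k as [|k IH]; [reflexivity|].
change (it_p n s d (S k) (MLam ts E)) with (sub_p n n s d (it_p n s d k (MLam ts E))).
rewrite IH, sub_p_eq. reflexivity.
Qed.

Lemma it_g_app n s d k P r Q : it_g n s d k (GApp P r Q) = GApp (it_p n s d k P) r (fun i => it_p n s d k (Q i)).
Proof.
induction k as [|k IH]; [reflexivity|].
change (it_g n s d (S k) (GApp P r Q)) with (sub_g n n s d (it_g n s d k (GApp P r Q))).
rewrite IH, sub_g_eq. reflexivity.
Qed.

Lemma it_g_var n s d k w r Q : (w < n -> s w = SVar w) ->
  it_g n s d k (GVar w r Q) = GVar w r (fun i => it_p n s d k (Q i)).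
Proof.
intros Hw. induction k as [|k IH]; [reflexivity|].
change (it_g n s d (S k) (GVar w r Q)) with (sub_g n n s d (it_g n s d k (GVar w r Q))).
rewrite IH, sub_g_eq. destruct (Nat.ltb_spec w n) as [H|H].
- rewrite Hw by auto. reflexivity.
- replace (w - n + n) with w by lia. reflexivity.
Qed.

(** The procedure put in place of [w] by the first round undergoes only the [k] remaining rounds,
    while the arguments undergo all [S k]. *)
Lemma it_g_plug n s d k w r Q P : w < n -> s w = STm P ->
  it_g n s d (S k) (GVar w r Q) =
  GApp (it_p n s d k (mren_p (shift n (d - n)) P)) r (fun i => it_p n s d (S k) (Q i)).
Proof.
intros Hw Hs. induction k as [|k IH].
- unfold it_g. simpl. rewrite sub_g_eq. apply Nat.ltb_lt in Hw. rewrite Hw, Hs. reflexivity.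
- change (it_g n s d (S (S k)) (GVar w r Q)) with (sub_g n n s d (it_g n s d (S k) (GVar w r Q))).
  rewrite IH, sub_g_eq. reflexivity.
Qed.

(** The plugged meta-procedure still mentions variables of [Z], so its body represents [e] in an
    unplugged [rho]. The entry [th w] reaches the same [e] in [map (esub th) rho], where these
    variables are already resolved; the recursion is thereby tied without an infinite
    substitution. *)
Definition plug_rep (g n : nat) (s : nat -> sval) (th : nat -> ent) : Prop :=
  (forall w, w < g -> s w = SVar w /\ th w = EV w) /\
  (forall w, n <= w -> th w = EV w) /\
  (forall w d, g <= w -> w < n -> n <= d -> exists P ts A e rho,
     s w = STm P /\ mren_p (shift n (d - n)) P = MLam ts A /\
     rep0 (d + length ts) A e rho /\ enters (th w) (fresh d (length ts)) ts e (map (esub th) rho)).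

Lemma map_plug_fresh g n s th d k : plug_rep g n s th -> n <= d -> map (esub th) (fresh d k) = fresh d k.
Proof.
intros (_ & H & _) Hd. rewrite (map_sub_fresh n n).
- f_equal. lia.
- intros v Hv. rewrite H by auto. f_equal. lia.
- exact Hd.
Qed.

(** The limit of the plugging stages represents the original code in the plugged environment. The
    offset [m] is general because every component of a limit is the limit of a tail, and because a
    plugged body lags one round behind its place. *)
Lemma rep0_lub g n s th m d T e rho c : plug_rep g n s th -> n <= d -> rep0 d T e rho ->
  (forall j, c j = circ_e g n (it_e n s d (m + j) T)) -> rep0 d (lub_e c) e (map (esub th) rho)
with repG_lub g n s th m d T x r Q rho c : plug_rep g n s th -> n <= d -> repG d T x r Q rho ->
  (forall j, c j = circ_g g n (it_g n s d (m + j) T)) -> repG d (lub_g c) x r Q (map (esub th) rho)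
with repE_lub g n s th m d T a c : plug_rep g n s th -> n <= d -> repE d T a ->
  (forall j, c j = circ_p g n (it_p n s d (m + j) T)) -> repE d (lub_p c) (esub th a).
Proof.
- intros Hp Hd HT Hc.
  destruct HT as [d rho | d k rho | d Gd B x r Q0 B0 rho HG HB].
  + rewrite lub_e_eq. destruct (pick _) as [m'|]; [|constructor].
    rewrite (Hc m'), it_e_eq, circ_e_eq. constructor.
  + rewrite lub_e_eq. destruct (pick _) as [m'|] eqn:Hm.
    * rewrite (Hc m'), it_e_eq, circ_e_eq. constructor.
    * exfalso. apply (pick_None _ 0 Hm). rewrite Hc, it_e_eq, circ_e_eq. reflexivity.
  + assert (Ec : forall j, c j = MCase (circ_g g n (it_g n s d (m + j) Gd))
      (fun i => circ_e g n (it_e n s d (m + j) (B i))))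
      by (intros j; rewrite Hc, it_e_eq, circ_e_eq; reflexivity).
    destruct (lub_e_case c) as [m' ->]; [intros j; rewrite Ec; do 2 eexists; reflexivity|].
    constructor.
    * apply (repG_lub g n s th (m + m') d Gd); [assumption | assumption | assumption |].
      intros j. rewrite Ec, Nat.add_assoc. reflexivity.
    * intros i. apply (rep0_lub g n s th (m + m') d (B i));
        [assumption | assumption | apply HB |].
      intros j. rewrite Ec, Nat.add_assoc. reflexivity.
- intros Hp Hd HT Hc.
  destruct HT as [d w x r Q Q0 rho Hx HQ | d P a x r Q Q0 rho Hx HP HQ].
  + assert (Hx' : nth_error (map (esub th) rho) x = Some (th w))
      by (rewrite nth_error_map, Hx; reflexivity).
    (* Only variables of [Z], at levels from [g] to [n - 1], are plugged; those of the context and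
       those bound inside the term keep their head. *)
    destruct (le_lt_dec g w) as [Hw|Hw]; [destruct (le_lt_dec n w) as [Hn|Hn]|].
    2:{ destruct (proj2 (proj2 Hp) w d Hw Hn Hd) as (P & ts & A & e & rho0 & Hs & HP & HA & Hent).
        assert (Ec : forall j k, m + j = S k -> c j =
          GApp (circ_p g n (it_p n s d k (MLam ts A))) r
               (fun i => circ_p g n (it_p n s d (S k) (Q i)))).
        { intros j k Hj. rewrite Hc, Hj, (it_g_plug n s _ _ _ _ _ P) by assumption.
          rewrite circ_g_eq, HP. reflexivity. }
        assert (E0 : forall j, m + j = 0 -> c j = GE MBot).
        { intros j Hj. rewrite Hc, Hj. change (it_g n s d 0 (GVar w r Q)) with (GVar w r Q).
          rewrite circ_g_eq. rewrite (proj2 (Nat.leb_le _ _) Hw), (proj2 (Nat.ltb_lt _ _) Hn).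
          reflexivity. }
        destruct (lub_g_app c r) as (m' & Hm' & ->).
        { exists 1. rewrite (Ec 1 m) by lia. reflexivity. }
        { intros j. destruct (m + j) as [|k] eqn:E.
          - left. rewrite E0 by exact E. reflexivity.
          - right. rewrite (Ec j k E). do 2 eexists. reflexivity. }
        (* At stage 0 the head has been erased to [GE MBot], so the index chosen lies after the
           first round of plugging. *)
        destruct (m + m') as [|k0] eqn:Hk0; [rewrite (E0 m' Hk0) in Hm'; discriminate|].
        econstructor; [exact Hx' | |].
        - rewrite lub_p_eq, Nat.add_0_r, (Ec m' k0 Hk0). cbn [headP].
          rewrite it_p_eq, circ_p_eq. econstructor; [exact Hent|].
          apply (rep0_lub g n s th k0 (d + length ts) A); [exact Hp | lia | exact HA |].
          intros j. rewrite (Ec (m' + j) (k0 + j)) by lia. cbn [headP].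
          rewrite it_p_eq, circ_p_eq. reflexivity.
        - intros i Hi. apply (repE_lub g n s th (S k0) d (Q i) (EC (Q0 i) rho));
            [exact Hp | assumption | exact (HQ i Hi) |].
          intros j. rewrite (Ec (m' + j) (k0 + j)) by lia. reflexivity. }
    all: assert (Hv : (w < n -> s w = SVar w) /\ th w = EV w /\ andb (g <=? w) (w <? n) = false).
    1,3: destruct Hp as (Hp1 & Hp2 & _).
    { rewrite (proj2 (Nat.ltb_ge _ _) Hn), Bool.andb_false_r. repeat split; [lia | apply Hp2, Hn]. }
    { rewrite (proj2 (Nat.leb_gt _ _) Hw). destruct (Hp1 w Hw). repeat split; auto. }
    all: destruct Hv as (Hsv & Htv & Hbv); rewrite Htv in Hx'.
    all: assert (Ec : forall j, c j = GVar w r (fun i => circ_p g n (it_p n s d (m + j) (Q i))))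
      by (intros j; rewrite Hc, it_g_var, circ_g_eq, Hbv by assumption; reflexivity).
    all: destruct (lub_g_var c w r) as [m' ->]; [intros j; rewrite Ec; eexists; reflexivity|].
    all: constructor; [exact Hx'|]; intros i Hi;
      apply (repE_lub g n s th (m + m') d (Q i) (EC (Q0 i) rho));
        [assumption | assumption | exact (HQ i Hi) |];
      intros j; rewrite Ec, Nat.add_assoc; reflexivity.
  + assert (Ec : forall j, c j = GApp (circ_p g n (it_p n s d (m + j) P)) r
      (fun i => circ_p g n (it_p n s d (m + j) (Q i))))
      by (intros j; rewrite Hc, it_g_app, circ_g_eq; reflexivity).
    destruct (lub_g_app c r) as (m' & _ & ->).
    { exists 0. rewrite Ec. reflexivity. }
    { intros j. right. rewrite Ec. do 2 eexists. reflexivity. }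
    econstructor; [rewrite nth_error_map, Hx; reflexivity| |].
    * apply (repE_lub g n s th (m + m') d P); [assumption | assumption | assumption |].
      intros j. rewrite Ec, Nat.add_assoc. reflexivity.
    * intros i Hi. apply (repE_lub g n s th (m + m') d (Q i) (EC (Q0 i) rho));
        [assumption | assumption | exact (HQ i Hi) |].
      intros j. rewrite Ec, Nat.add_assoc. reflexivity.
- intros Hp Hd HT Hc. destruct HT as [d ts A a e rho Ha HA]. rewrite lub_p_eq.
  rewrite (Hc 0), it_p_eq, circ_p_eq. econstructor.
  + rewrite <- (map_plug_fresh g n s th d) by assumption. apply enters_sub. exact Ha.
  + apply (rep0_lub g n s th m (d + length ts) A); [assumption | lia | exact HA |].
    intros j. rewrite Hc, it_p_eq, circ_p_eq. reflexivity.
Qed.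

Lemma map_fresh_id th d m : (forall w, d <= w < d + m -> th w = EV w) ->
  map (esub th) (fresh d m) = fresh d m.
Proof.
intros H. apply map_id_nth_error. intros i a Hi.
pose proof (nth_error_lt _ _ _ Hi) as Hl. rewrite length_fresh in Hl.
rewrite nth_error_fresh in Hi by auto. injection Hi as <-. simpl. apply H. lia.
Qed.

(** Combines [rep0_lub] with [nfe_nf]: [z] becomes the recursive closure of the functional and each
    [x_i] the closure of [q_i], which is precisely the environment reached by calling that recursive
    closure. *)
Lemma plug_nf G ss e qs : wt_p G (Lam (Arr ss :: ss) e) (Arr (Arr ss :: ss)) ->
  (forall i t, nth_error ss i = Some t -> wt_p G (qs i) t) ->
  peq (plug_result (length G) ss e qs)
      (Lam [] (nf G (SC (ER (EC (Lam (Arr ss :: ss) e) (fresh 0 (length G))))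
                        (clos (length ss) qs (fresh 0 (length G))) []))).
Proof.
intros Hp Hq. inversion Hp as [G1 ts1 e1 He]; subst. constructor.
set (F := EC (Lam (Arr ss :: ss) e) (fresh 0 (length G))).
set (g := length G) in *. set (r := length ss) in *.
set (rho := fresh 0 g ++ ER F :: clos r qs (fresh 0 g)).
assert (HF : wt_ent G (Arr (Arr ss :: ss)) F) by (eapply wt_EC_env; [eauto | apply wt_idenv]).
assert (Hrho : wt_env G (G ++ Arr ss :: ss) rho).
{ apply wt_env_app; [apply wt_idenv|]. apply wt_env_cons; [constructor; exact HF|].
  eapply wt_clos; eauto. apply wt_idenv. }
rewrite (nf_step _ _ (SC F (ER F :: clos r qs (fresh 0 g)) [])) by reflexivity.
rewrite (nf_step _ _ (SE e rho [])) by reflexivity.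
assert (Hlen : length (G ++ Arr ss :: ss) = g + 1 + r) by (rewrite length_app; simpl; fold g r; lia).
assert (Hw : wt_s G (SE e rho [])) by (econstructor; [exact He | exact Hrho | constructor]).
(* The plugged term is normalised in [G] extended by [Z], but no variable of [Z] is left in the
   machine state. *)
eapply eeq_trans; [|apply (nf_strengthen G (Arr ss :: ss)); exact Hw].
replace (length G + length (Arr ss :: ss)) with (g + 1 + r) by (simpl; fold g r; lia).
fold g r. apply ren_e_eeq. rewrite <- Hlen at 1. apply nfe_nf.
{ econstructor; [exact He | apply wt_env_weaken, Hrho | constructor]. }
constructor. rewrite Hlen. unfold plug. fold r. set (n := g + 1 + r).
assert (Hn : n = g + 1 + r) by reflexivity.
set (s := fun v => if v <? g then SVar v else if v =? g
  then STm (MLam ss (mren_e (shift (g + 1) r) (embed_e e)))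
  else STm (mren_p (shift g (1 + r)) (embed_p (qs (v - g - 1))))).
set (th := fun v => if v <? g then EV v else if v =? g then ER F
  else if v <? n then EC (qs (v - g - 1)) (fresh 0 g) else EV v).
assert (Hth1 : forall w, w < g -> th w = EV w).
{ intros w H. unfold th. rewrite (proj2 (Nat.ltb_lt _ _) H). reflexivity. }
assert (Hth2 : th g = ER F).
{ unfold th. rewrite Nat.ltb_irrefl, Nat.eqb_refl. reflexivity. }
assert (Hth3 : forall w, g < w -> w < n -> th w = EC (qs (w - g - 1)) (fresh 0 g)).
{ intros w H1 H2. unfold th. rewrite (proj2 (Nat.ltb_ge _ _)) by lia.
  rewrite (proj2 (Nat.eqb_neq _ _)) by lia. rewrite (proj2 (Nat.ltb_lt _ _)) by lia. reflexivity. }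
assert (Hth4 : forall w, n <= w -> th w = EV w).
{ intros w H. unfold th. rewrite (proj2 (Nat.ltb_ge _ _)) by lia.
  rewrite (proj2 (Nat.eqb_neq _ _)) by lia. rewrite (proj2 (Nat.ltb_ge _ _)) by lia. reflexivity. }
assert (Er : map (esub th) (fresh 0 n) = rho).
{ unfold n, rho. rewrite <- (fresh_app 0 (g + 1)), <- (fresh_app 0 g), !map_app, <- app_assoc.
  f_equal; [apply map_fresh_id; intros; apply Hth1; lia|]. simpl. rewrite Hth2. f_equal.
  unfold fresh, clos. rewrite map_map. simpl. apply nth_error_ext. intros i.
  rewrite !nth_error_map. destruct (Nat.lt_ge_cases i r).
  - rewrite !nth_error_seq_lt by auto. simpl. rewrite Hth3 by lia. do 3 f_equal. lia.
  - rewrite !(proj2 (nth_error_None _ _)) by (rewrite length_seq; auto). reflexivity. }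
assert (Hemb : rep0 n (embed_e e) e (fresh 0 n)).
{ pose proof (rep0_embed _ _ He) as H. rewrite Hlen in H. exact H. }
rewrite <- Er.
apply (rep0_lub g n s th 0 n (embed_e e) e (fresh 0 n)); auto.
clear Er. split; [|split; [exact Hth4|]].
- intros w H. split; auto. unfold s. rewrite (proj2 (Nat.ltb_lt _ _) H). reflexivity.
- intros w d H1 H2 Hd. unfold s. rewrite (proj2 (Nat.ltb_ge _ _) H1).
  destruct (Nat.eqb_spec w g) as [->|Hne].
  (* The procedure for [z] binds fresh copies of the [x_i], hence the shift above [g + 1]; its free
     [z] remains at level [g] and is resolved to [ER F] again, as [enters_R] demands. *)
  + do 5 eexists. split; [reflexivity|]. split; [apply mren_p_eq|]. split.
    * pose proof (rep0_ren (g + 1) r n _ _ _ ltac:(lia) Hemb) as R1.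
      pose proof (rep0_ren n (d - n) (n + r) _ _ _ ltac:(lia) R1) as R2.
      replace (n + r + (d - n)) with (d + length ss) in R2 by (fold r; lia). exact R2.
    * rewrite Hth2. change (fresh 0 n) with (fresh 0 (g + 1 + r)).
      rewrite <- (fresh_app 0 (g + 1)), !map_app.
      rewrite (map_fresh_id _ 0) by (intros; f_equal; apply shift_lt; lia).
      rewrite (map_fresh_id _ 0) by (intros; f_equal; apply shift_lt; lia).
      rewrite !map_shift_fresh by lia.
      rewrite (map_fresh_id th (0 + (g + 1) + r + (d - n))) by (intros; apply Hth4; lia).
      rewrite <- (fresh_app 0 g), map_app, <- app_assoc.
      rewrite (map_fresh_id th) by (intros; apply Hth1; lia). simpl. rewrite Hth2.
      replace (g + 1 + r + (d - n)) with d by lia. apply enters_R.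
  + assert (Hi : w - g - 1 < length ss) by (fold r; lia).
    destruct (nth_error ss (w - g - 1)) as [t|] eqn:Ht; [|apply nth_error_None in Ht; lia].
    specialize (Hq _ _ Ht). rewrite Hth3 by lia.
    inversion Hq as [G1 us b Hb E1 E2 E3]; subst. do 5 eexists. split; [reflexivity|].
    split; [rewrite embed_p_eq, !mren_p_eq; reflexivity|].
    pose proof (rep0_embed _ _ Hb) as R0. rewrite length_app in R0. fold g in R0. split.
    * pose proof (rep0_ren g (1 + r) (g + length us) _ _ _ ltac:(lia) R0) as R1.
      pose proof (rep0_ren n (d - n) (g + length us + (1 + r)) _ _ _ ltac:(lia) R1) as R2.
      replace (g + length us + (1 + r) + (d - n)) with (d + length us) in R2 by lia. exact R2.
    * rewrite <- (fresh_app 0 g), !map_app.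
      rewrite (map_fresh_id _ 0) by (intros; f_equal; apply shift_lt; lia).
      rewrite (map_fresh_id _ 0) by (intros; f_equal; apply shift_lt; lia).
      rewrite (map_fresh_id th 0) by (intros; apply Hth1; lia).
      rewrite !map_shift_fresh by lia.
      rewrite (map_fresh_id th) by (intros; apply Hth4; lia).
      replace (0 + g + (1 + r) + (d - n)) with d by lia. constructor.
Qed.

(** * Denotable procedures are generated *)

Lemma wt_eta G x t : nth_error G x = Some t -> wt_p G (eta (length G) x t) t.
Proof.
revert G x t. cofix IH. intros G x [ts] Hx. rewrite eta_eq. constructor. constructor.
- apply nth_error_weaken. exact Hx.
- intros i t Ht. rewrite (nth_error_nth _ _ _ Ht), <- length_app. apply IH.
  rewrite nth_error_app2 by lia. replace (length G + i - length G) with i by lia. exact Ht.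
- intros i. constructor.
Qed.

Lemma nth_error_middle {A} (G : list A) x ts : nth_error (G ++ x :: ts) (length G) = Some x.
Proof. rewrite nth_error_app2, Nat.sub_diag by lia. reflexivity. Qed.

Lemma wt_Fy G x ts : nth_error G x = Some (Arr (Arr ts :: ts)) ->
  wt_p G (Fy (length G) x ts) (Arr ts).
Proof.
revert G x ts. cofix IH. intros G x ts Hx. rewrite Fy_eq. constructor.
apply (wt_Case _ _ (Arr ts :: ts)).
- apply nth_error_weaken. exact Hx.
- intros [|i] t Ht; simpl in Ht |- *; rewrite <- length_app.
  + injection Ht as <-. apply IH. apply nth_error_weaken. exact Hx.
  + rewrite (nth_error_nth _ _ _ Ht). apply wt_eta.
    rewrite nth_error_app2 by lia. replace (length G + i - length G) with i by lia. exact Ht.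
- intros i. constructor.
Qed.

Lemma wt_ground_var G x B : nth_error G x = Some N -> (forall i, wt_e G (B i)) ->
  wt_e G (Case x 0 dummy B).
Proof. intros Hx HB. apply (wt_Case _ _ []); auto. intros [|i] t Ht; discriminate. Qed.

Lemma interp_Y G ss : interp G (TY (Arr ss)) =
  Lam (Arr (Arr ss :: ss) :: ss)
    (Case (length G) (S (length ss)) (Fy_arg (length G + 1) (length G) ss) (fun i => Num i)).
Proof. reflexivity. Qed.

Lemma wt_interp k G M t : has_type k G M t -> wt_p G (interp G M) t.
Proof.
induction 1 as [G v Hv | G s M t _ IH | G M M' s ts _ IH1 _ IH2 | G n | G | G | G | G s Hs | G f].
- apply wt_eta. apply nth_error_nth'. exact Hv.
- simpl. inversion IH as [G1 ts e He E1 E2 E3]; subst. constructor.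
  rewrite <- app_assoc in He. exact He.
- simpl. destruct (app_nf _ _ _ _ _ IH1 IH2) as (e & _ & He & Hw).
  eapply wt_peq; [|apply peq_sym; exact He]. constructor. apply wt_nf. exact Hw.
- constructor. constructor.
- constructor. apply wt_ground_var; [apply nth_error_middle | intros i; constructor].
- constructor. apply wt_ground_var; [apply nth_error_middle | intros i; constructor].
- constructor. apply wt_ground_var; [apply nth_error_middle|].
  intros [|i]; (apply wt_ground_var; [rewrite nth_error_app2 by lia | intros; constructor]).
  + replace (length G + 1 - length G) with 1 by lia. reflexivity.
  + replace (length G + 2 - length G) with 2 by lia. reflexivity.
- destruct s as [ss]. rewrite interp_Y. constructor. apply (wt_Case _ _ (Arr ss :: ss)).
  + apply nth_error_middle.
  + pose proof (wt_Fy (G ++ [Arr (Arr ss :: ss)]) (length G) ss (nth_error_middle _ _ _)) as H.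
    rewrite Fy_eq in H. inversion H as [G1 ts1 e1 He1]; subst.
    inversion He1 as [| |G2 x us Q B Hx HQ HB]; subst. rewrite <- app_assoc in Hx, HQ.
    simpl in Hx, HQ. rewrite nth_error_middle in Hx. injection Hx as <-.
    rewrite length_app in HQ. exact HQ.
  + intros i. constructor.
- constructor. apply wt_ground_var; [apply nth_error_middle | intros i; destruct (f i); constructor].
Qed.

(** * Machine equations for variables, application and recursion *)

Lemma sem_var D G th x t bs us K : wt_env D G th -> nth_error G x = Some t -> t = Arr us ->
  wt_env D us bs -> wt_k D K ->
  exists a, nth_error th x = Some a /\ wt_ent D t a /\
    eeq (nf D (SC (EC (eta (length G) x t) th) bs K)) (nf D (SC a bs K)).
Proof.
intros Hth Hx -> Hbs HK. destruct (wt_env_lookup _ _ _ _ _ Hth Hx) as (a & Ha & Hwa).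
exists a. split; auto. split; auto. apply sr_nf.
rewrite <- (proj1 Hth). eapply sr_C; [|apply pw_refl, Hbs | apply kr_refl, HK].
eapply er_eta; eauto. apply er_refl, Hwa.
Qed.

(** By [app_nf] the application is the normal form of a state over [G ++ ts]. Running it in
    [th ++ bs] is the situation of [sr_N], so the normalisation may be skipped. *)
Lemma sem_app D G p q t ts th bs K : wt_p G p (Arr (t :: ts)) -> wt_p G q t ->
  wt_env D G th -> wt_env D ts bs -> wt_k D K ->
  eeq (nf D (SC (EC (Defs.app (length G) p q) th) bs K))
      (nf D (SC (EC p th) (EC q th :: bs) K)).
Proof.
intros Hp Hq Hth Hbs HK. destruct (app_nf _ _ _ _ _ Hp Hq) as (e & -> & He & Hw).
destruct (peq_inv _ _ He) as (ts1 & b & b' & E1 & E2 & Hb). injection E2 as <- <-. rewrite E1.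
rewrite (nf_step D (SC (EC (Lam ts b) th) bs K) (SE b (th ++ bs) K)) by reflexivity.
rewrite (nf_step D (SC (EC (Lam (t :: ts) e) th) _ K) (SE e (th ++ EC q th :: bs) K)) by reflexivity.
apply sr_nf.
assert (E : SE e (th ++ EC q th :: bs) K = sapp (ssub (lk (th ++ bs)) (SE e (fresh 0 (length G) ++
  EC q (fresh 0 (length G)) :: fresh (length G) (length ts)) [])) K).
{ simpl. destruct Hth as [Hl _]. destruct Hbs as [Hl' _]. rewrite <- Hl, <- Hl'.
  rewrite map_app. simpl. rewrite map_lk_idenv, map_lk_fresh. reflexivity. }
rewrite E. eapply sr_N; eauto.
- apply pw_app; apply pw_refl; auto.
- apply kr_refl, HK.
Qed.

Lemma sem_Y D G th ss f bs K : wt_env D G th -> wt_ent D (Arr (Arr ss :: ss)) f ->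
  wt_env D ss bs -> wt_k D K ->
  eeq (nf D (SC (EC (interp G (TY (Arr ss))) th) (f :: bs) K)) (nf D (SC (ER f) bs K)).
Proof.
intros Hth Hf Hbs HK. rewrite interp_Y. pose proof (proj1 Hth) as Hl.
assert (Hg : nth_error (th ++ f :: bs) (length G) = Some f)
  by (rewrite <- Hl; apply nth_error_middle).
erewrite nf_step; [|reflexivity]. erewrite nf_step; [|simpl; rewrite Hg; reflexivity].
rewrite (nf_step D (SC (ER f) bs K) (SC f (ER f :: bs) K)) by reflexivity.
apply sr_nf. eapply sr_C; [apply er_refl, Hf | | apply kr_id; [auto | apply kr_refl, HK]].
(* The functional is bound first, so the environment around [Fy] is [th ++ [f]], with [f] at level
   [length G]. *)
pose proof (pw_clos_Fy D ss (length G) (th ++ [f]) f f bs bs) as H.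
rewrite <- app_assoc, length_app, Hl in H. apply H.
- rewrite <- Hl. apply nth_error_middle.
- apply er_refl, Hf.
- apply pw_refl, Hbs.
Qed.

(** The extensions [D'] are needed because reification calls the entry on fresh variables. The local
    [fix] keeps the recursion structural through the list of argument types; [comp_Arr] restates it
    with [comps]. *)
Fixpoint comp (k : nat) (t : ty) (D : list ty) (a : ent) {struct t} : Prop :=
  match t with
  | Arr ts =>
      wt_ent D (Arr ts) a /\
      forall D' bs,
        (fix all (l : list ty) (bs : list ent) {struct l} : Prop :=
           match l, bs with
           | [], [] => True
           | u :: l', b :: bs' => comp k u (D ++ D') b /\ all l' bs'
           | _, _ => False
           end) ts bs ->
        gen k (D ++ D') (Lam [] (nf (D ++ D') (SC a bs [])))
  end.

Definition comps (k : nat) (D ts : list ty) (bs : list ent) : Prop :=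
  Forall2 (fun t => comp k t D) ts bs.

Lemma comp_Arr k ts D a : comp k (Arr ts) D a <->
  wt_ent D (Arr ts) a /\
  forall D' bs, comps k (D ++ D') ts bs ->
    gen k (D ++ D') (Lam [] (nf (D ++ D') (SC a bs []))).
Proof.
assert (E : forall D1 l bs,
  (fix all (l : list ty) (bs : list ent) {struct l} : Prop :=
     match l, bs with
     | [], [] => True
     | u :: l', b :: bs' => comp k u D1 b /\ all l' bs'
     | _, _ => False
     end) l bs <-> comps k D1 l bs).
{ intros D1. induction l as [|u l IH]; intros [|b bs]; split; intros H; try contradiction;
    try solve [inversion H]; try constructor; try tauto.
  - destruct H. apply IH. assumption.
  - inversion H; subst. assumption.
  - inversion H; subst. apply IH. assumption. }
simpl. split; intros [H1 H2]; split; auto; intros D' bs H; apply H2, E, H.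
Qed.

Lemma comp_wt k t D a : comp k t D a -> wt_ent D t a.
Proof. destruct t. simpl. tauto. Qed.

Arguments comp : simpl never.

Lemma comps_wt k D ts bs : comps k D ts bs -> wt_env D ts bs.
Proof.
intros H. apply wt_env_Forall2. eapply Forall2_impl; [|exact H]. simpl.
intros t a. apply comp_wt.
Qed.

Lemma comp_weaken k t D D' a : comp k t D a -> comp k t (D ++ D') a.
Proof.
destruct t as [ts]. rewrite !comp_Arr. intros [H1 H2]. split; [apply wt_ent_weaken, H1|].
intros D1 bs. rewrite <- app_assoc. apply H2.
Qed.

Lemma comps_weaken k D D' ts bs : comps k D ts bs -> comps k (D ++ D') ts bs.
Proof. apply Forall2_impl. intros t a. apply comp_weaken. Qed.

Lemma comps_lookup k D ts bs i u : comps k D ts bs -> nth_error ts i = Some u ->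
  exists b, nth_error bs i = Some b /\ comp k u D b.
Proof.
intros H. revert i. induction H as [|t b ts bs Hb _ IH]; intros [|i] Hu; try discriminate.
- injection Hu as <-. exists b. split; [reflexivity | exact Hb].
- apply IH. exact Hu.
Qed.

Lemma gen_peq k G p p' : gen k G p -> peq p' p -> gen k G p'.
Proof.
destruct 1 as [G x ts qs q Hx Hn Hq Hp | G s q q' Hq Hp | G n q Hp | G q f q' Hq Hp
  | G ts e d e' q' He Hd He' Hp | G ss e qs q' Hl He Hq Hp]; intros Hpp;
  pose proof (peq_trans _ _ _ Hpp Hp) as H.
- exact (gen_var k G x ts qs p' Hx Hn Hq H).
- exact (gen_lam k G s q p' Hq H).
- exact (gen_num k G n p' H).
- exact (gen_fun k G q f p' Hq H).
- exact (gen_ifz k G ts e d e' p' He Hd He' H).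
- exact (gen_plug k G ss e qs p' Hl He Hq H).
Qed.

Lemma gen_lams k G ts us e : gen k (G ++ ts) (Lam us e) -> gen k G (Lam (ts ++ us) e).
Proof.
revert G. induction ts as [|s ts IH]; intros G H; simpl.
- rewrite app_nil_r in H. exact H.
- eapply gen_lam; [apply IH; rewrite <- app_assoc; exact H | apply peq_refl].
Qed.

Lemma ty_ind_nested (P : ty -> Prop) : (forall ts, Forall P ts -> P (Arr ts)) -> forall t, P t.
Proof.
intros H. fix IH 1. intros [ts]. apply H. induction ts; constructor; auto.
Qed.

(* Reification needs reflection at the argument types and conversely. *)
Lemma reflect_reify k t :
  (forall D w, nth_error D w = Some t -> comp k t D (EV w)) /\
  (forall D a, comp k t D a -> gen k D (rb D t a)).
Proof.
induction t as [ts IH] using ty_ind_nested. rewrite Forall_forall in IH. split.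
- intros D w Hw. apply comp_Arr. split; [constructor; exact Hw|]. intros D' bs Hbs.
  assert (Hw' : nth_error (D ++ D') w = Some (Arr ts)) by (apply nth_error_weaken, Hw).
  rewrite (nf_var _ _ _ _ _ Hw').
  apply (gen_var k (D ++ D') w ts (fun i => rb (D ++ D') (nth i ts N) (nth i bs (EV 0)))).
  + eapply nth_error_lt; eauto.
  + apply nth_error_nth. exact Hw'.
  + intros i Hi. destruct (nth_error ts i) as [u|] eqn:Hu; [|apply nth_error_None in Hu; lia].
    rewrite (nth_error_nth _ _ _ Hu). split; [|destruct u; reflexivity].
    apply IH; [eapply nth_error_In; eauto|].
    destruct (comps_lookup _ _ _ _ _ _ Hbs Hu) as (b & Hb & Hc).
    rewrite (nth_error_nth _ _ _ Hb). exact Hc.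
  + constructor. constructor.
    * intros i _. apply peq_refl.
    * intros i. rewrite nf_SR_nil. constructor.
- intros D a Ha. apply comp_Arr in Ha. destruct Ha as [_ Ha]. simpl.
  rewrite <- (app_nil_r ts) at 1. apply gen_lams. apply Ha.
  assert (Hf : forall us d, (forall i u, nth_error us i = Some u -> In u ts /\
      nth_error (D ++ ts) (d + i) = Some u) -> comps k (D ++ ts) us (fresh d (length us))).
  { unfold fresh. induction us as [|u us IHus]; intros d H; simpl; constructor.
    - destruct (H 0 u eq_refl) as [Hin Hn]. rewrite Nat.add_0_r in Hn. apply IH; auto.
    - apply IHus. intros i v Hv. replace (S d + i) with (d + S i) by lia. apply H. exact Hv. }
  apply Hf. intros i u Hu. split; [eapply nth_error_In; eauto|].
  rewrite nth_error_app2 by lia. replace (length D + i - length D) with i by lia. exact Hu.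
Qed.

Lemma reflect k t D w : nth_error D w = Some t -> comp k t D (EV w).
Proof. apply reflect_reify. Qed.

Lemma reify k t D a : comp k t D a -> gen k D (rb D t a).
Proof. apply reflect_reify. Qed.

Lemma nf_opt_frame D i B rho o : B i = opt_num o -> nf D (SR i [(B, rho)]) = opt_num o.
Proof.
intros HB. rewrite (nf_step _ _ (SE (B i) rho [])) by reflexivity. rewrite HB.
destruct o as [n|]; simpl.
- rewrite (nf_step _ _ (SR n [])), nf_SR_nil by reflexivity. reflexivity.
- apply nf_div. intros n v Hv.
  inversion Hv as [v1 Hiv | n1 s1 s1' v1 Hst]; subst; [contradiction | discriminate].
Qed.

(** Running under a frame whose branches are numerals or [Bot] replaces leaves by a partial
    function, which is rule 4. *)
Lemma gen_nf_frame k D s B rho : gen k D (Lam [] (nf D s)) ->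
  (exists f : nat -> option nat, forall i, B i = opt_num (f i)) ->
  gen k D (Lam [] (nf D (sapp s [(B, rho)]))).
Proof.
intros Hs [f Hf]. apply (gen_fun k D (Lam [] (nf D s)) f); auto. simpl. constructor.
eapply eeq_trans; [apply nf_frame|].
assert (E : (fun i => nf D (SR i [(B, rho)])) = fun i => opt_num (f i)); [|rewrite E; apply eeq_refl].
apply functional_extensionality. intros i. apply nf_opt_frame, Hf.
Qed.

Lemma comp_ground_call k D a bs : comp k N D a -> bs = [] -> gen k D (Lam [] (nf D (SC a bs []))).
Proof.
intros Ha ->. apply comp_Arr in Ha. destruct Ha as [_ Ha].
specialize (Ha [] [] (Forall2_nil _)). rewrite app_nil_r in Ha. exact Ha.
Qed.

Lemma comp_unary k D G th e B : wt_env D G th -> wt_p G (Lam [N] e) (Arr [N]) ->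
  e = Case (length G) 0 dummy B ->
  (exists f : nat -> option nat, forall i, B i = opt_num (f i)) ->
  comp k (Arr [N]) D (EC (Lam [N] e) th).
Proof.
intros Hth Hp -> HB. apply comp_Arr. split; [eapply wt_EC_env; eauto|].
intros D' bs Hbs. inversion Hbs as [|t b ts bs' Hb Hnil]; subst. inversion Hnil; subst.
erewrite nf_step; [|reflexivity].
erewrite nf_step.
2:{ simpl. rewrite <- (proj1 Hth), nth_error_middle. reflexivity. }
apply (gen_nf_frame k (D ++ D') (SC b [] [])); auto.
apply comp_ground_call; auto.
Qed.

Lemma repl_e_eeq h h' e e' : (forall i, eeq (h i) (h' i)) -> eeq e e' ->
  eeq (repl_e h e) (repl_e h' e').
Proof.
intros Hh. revert e e'. cofix IH. intros e e' He.
destruct He as [|n|x r Q Q' B B' HQ HB].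
- rewrite (frob_eq (repl_e h Bot)), (frob_eq (repl_e h' Bot)). constructor.
- rewrite !repl_e_Num. apply Hh.
- rewrite (frob_eq (repl_e h _)), (frob_eq (repl_e h' _)). simpl. constructor; [exact HQ|].
  intros i. apply IH. apply HB.
Qed.

Lemma ren_e_id f e : (forall v, f v = v) -> eeq (ren_e f e) e.
Proof.
intros Hf. revert e. cofix IH. intros e. rewrite ren_e_eq.
destruct e as [|n|x r Q B]; try constructor. rewrite Hf. constructor.
- intros i _. destruct (Q i) as [ts e]. rewrite ren_p_eq. constructor. apply IH.
- intros i. apply IH.
Qed.

Lemma nf_id_frame D a rho : wt_ent D N a ->
  eeq (nf D (SC a [] [((fun i => Num i), rho)])) (nf D (SC a [] [])).
Proof.
intros Ha. apply sr_nf. eapply sr_C; [apply er_refl, Ha | apply pw_nil|].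
apply kr_id; [auto | constructor].
Qed.

(** An entry may be exchanged for its readback, as is needed for rule 6, whose premises concern code
    rather than entries. *)
Lemma er_rb_idenv D t a : wt_ent D t a -> er D t (EC (rb D t a) (fresh 0 (length D))) a.
Proof.
intros Ha. destruct (pw_refl _ _ _ (wt_idenv D)) as (H1 & H2 & H3).
eapply er_N; eauto using peq_refl. symmetry. eapply esub_id; [exact Ha|].
intros w Hw. apply lk_nth_error. apply (nth_error_fresh 0). exact Hw.
Qed.

(* The Tait-style fundamental lemma: the code [interp G M], run in computable environments,
   only produces generated procedures. *)
Lemma fundamental k G M t : has_type k G M t ->
  forall D th, comps k D G th -> comp k t D (EC (interp G M) th).
Proof.
induction 1 as [G v Hv | G s M t HM IH | G M M' s ts HM IH1 HM' IH2 | G n | G | G | G | G s Hs | G f];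
  intros D th Hth.
- pose proof (nth_error_nth' G N Hv) as Hn. simpl.
  destruct (nth v G N) as [us] eqn:Eu. apply comp_Arr. split.
  { eapply wt_EC_env; [apply wt_eta, Hn | eapply comps_wt; eauto]. }
  intros D' bs Hbs. pose proof (comps_weaken k D D' _ _ Hth) as Hth'.
  destruct (sem_var (D ++ D') G th v (Arr us) bs us [] (comps_wt _ _ _ _ Hth') Hn eq_refl
    (comps_wt _ _ _ _ Hbs) (wt_k_nil _)) as (a & Ha & _ & He).
  eapply gen_peq; [|constructor; exact He].
  destruct (comps_lookup _ _ _ _ _ _ Hth Hn) as (a' & Ha' & Hc).
  rewrite Ha in Ha'. injection Ha' as <-.
  apply comp_Arr in Hc. apply Hc. exact Hbs.
- pose proof (wt_interp _ _ _ _ HM) as HwM. simpl.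
  inversion HwM as [G1 ts e He E1 E2 E3]; subst. rewrite <- E2 in IH. simpl.
  rewrite <- app_assoc in He. simpl in He.
  apply comp_Arr. split; [eapply wt_EC_env; [constructor; exact He | eapply comps_wt; eauto]|].
  intros D' bs Hbs. inversion Hbs as [|t b ts' bs' Hb Hbs']; subst.
  assert (Hth' : comps k (D ++ D') (G ++ [s]) (th ++ [b])).
  { apply Forall2_app; [apply comps_weaken, Hth | constructor; auto]. }
  pose proof (IH _ _ Hth') as Hc. apply comp_Arr in Hc. destruct Hc as [_ Hc].
  specialize (Hc [] bs'). rewrite app_nil_r in Hc. specialize (Hc Hbs').
  rewrite (nf_step _ _ (SE e ((th ++ [b]) ++ bs') [])) in Hc by reflexivity.
  rewrite <- app_assoc in Hc. rewrite (nf_step _ _ (SE e (th ++ b :: bs') [])) by reflexivity.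
  exact Hc.
- pose proof (wt_interp _ _ _ _ HM) as HwM. pose proof (wt_interp _ _ _ _ HM') as HwM'.
  apply comp_Arr. split.
  { eapply wt_EC_env; [|eapply comps_wt; eauto]. eapply wt_interp. econstructor; eauto. }
  intros D' bs Hbs. pose proof (comps_weaken k D D' _ _ Hth) as Hth'.
  eapply gen_peq; [|constructor; apply (sem_app _ G _ _ s ts)];
    eauto using comps_wt, wt_k_nil.
  pose proof (IH1 _ _ Hth) as Hc. apply comp_Arr in Hc. apply Hc. constructor; auto.
- apply comp_Arr. split.
  { eapply wt_EC_env; [constructor; constructor | eapply comps_wt; eauto]. }
  intros D' bs Hbs. inversion Hbs; subst. simpl.
  do 2 (erewrite nf_step; [|reflexivity]). rewrite nf_SR_nil. eapply gen_num. apply peq_refl.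
- eapply comp_unary; [eapply comps_wt; eauto | exact (wt_interp k G TSuc _ (ht_suc k G)) | reflexivity |].
  exists (fun i => Some (S i)). reflexivity.
- eapply comp_unary; [eapply comps_wt; eauto | exact (wt_interp k G TPre _ (ht_pre k G)) | reflexivity |].
  exists (fun i => Some (pred i)). reflexivity.
- apply comp_Arr. split.
  { eapply wt_EC_env; [apply (wt_interp k G TIfz); constructor | eapply comps_wt; eauto]. }
  intros D' bs Hbs. pose proof (comps_wt _ _ _ _ Hth) as [Hl _].
  inversion Hbs as [|t a ts0 bs0 Ha Hbs0]; subst. inversion Hbs0 as [|t b ts1 bs1 Hb Hbs1]; subst.
  inversion Hbs1 as [|t c ts2 bs2 Hc Hbs2]; subst. inversion Hbs2; subst.
  simpl. erewrite nf_step; [|reflexivity]. erewrite nf_step.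
  2:{ simpl. rewrite <- Hl, nth_error_middle. reflexivity. }
  set (rho := th ++ [a; b; c]).
  (* Rule 5 without binders, where the weakening of the two branches is a shift by 0. *)
  apply (gen_ifz k (D ++ D') [] (nf (D ++ D') (SC a [] [])) (nf (D ++ D') (SC b [] []))
    (nf (D ++ D') (SC c [] []))); try (apply comp_ground_call; auto).
  simpl. constructor. match goal with |- eeq (nf _ (SC a _ [?F])) _ =>
    change (eeq (nf (D ++ D') (sapp (SC a [] []) [F]))
      (repl_e (fun i => match i with
                        | 0 => ren_e (shift (length (D ++ D')) 0) (nf (D ++ D') (SC b [] []))
                        | S _ => ren_e (shift (length (D ++ D')) 0) (nf (D ++ D') (SC c [] []))
                        end) (nf (D ++ D') (SC a [] [])))) end.
  assert (Hsh : forall v, shift (length (D ++ D')) 0 v = v).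
  { intros v. unfold shift. destruct (_ <? _); lia. }
  eapply eeq_trans; [apply nf_frame|]. apply repl_e_eeq; [|apply eeq_refl].
  intros [|i]; (eapply eeq_trans; [|apply eeq_sym, ren_e_id, Hsh]);
    (erewrite nf_step; [|reflexivity]).
  + erewrite nf_step.
    2:{ simpl. unfold rho. rewrite nth_error_app2 by lia.
        replace (length th + 1 - length th) with 1 by lia. reflexivity. }
    apply nf_id_frame. eapply comp_wt; eauto.
  + erewrite nf_step.
    2:{ simpl. unfold rho. rewrite nth_error_app2 by lia.
        replace (length th + 2 - length th) with 2 by lia. reflexivity. }
    apply nf_id_frame. eapply comp_wt; eauto.
- destruct s as [ss]. apply comp_Arr. split.
  { eapply wt_EC_env; [apply (wt_interp k G (TY (Arr ss))); constructor; exact Hs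
      | eapply comps_wt; eauto]. }
  intros D' bs Hbs. pose proof (comps_weaken k D D' _ _ Hth) as Hth'. set (E := D ++ D') in *.
  inversion Hbs as [|t f ts bs' Hf Hbs']; subst. clear Hbs. rename bs' into bs.
  pose proof (comp_wt _ _ _ _ Hf) as Hwf. pose proof (comps_wt _ _ _ _ Hbs') as Hwbs.
  (* The functional and its arguments are reified to code so that rule 6 can be applied to them. *)
  set (qs := fun i => rb E (nth i ss N) (nth i bs (EV 0))).
  set (e := nf (E ++ Arr ss :: ss) (SC f (fresh (length E) (length (Arr ss :: ss))) [])).
  assert (Hqs : forall i t, nth_error ss i = Some t -> exists b, nth_error bs i = Some b /\
    comp k t E b /\ qs i = rb E t b).
  { intros i t Ht. destruct (comps_lookup _ _ _ _ _ _ Hbs' Ht) as (b & Hb & Hc).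
    exists b. repeat split; auto. unfold qs.
    rewrite (nth_error_nth _ _ _ Ht), (nth_error_nth _ _ _ Hb). reflexivity. }
  apply (gen_plug k E ss e qs); auto.
  + apply (reify k (Arr (Arr ss :: ss))). exact Hf.
  + intros i Hi. destruct (nth_error ss i) as [t|] eqn:Ht; [|apply nth_error_None in Ht; lia].
    destruct (Hqs i t Ht) as (b & _ & Hc & ->). rewrite (nth_error_nth _ _ _ Ht).
    split; [apply reify, Hc | destruct t; reflexivity].
  + apply peq_trans with (Lam [] (nf E (SC (ER f) bs []))).
    { constructor. apply sem_Y; eauto using comps_wt, wt_k_nil. }
    apply peq_sym. eapply peq_trans; [apply plug_nf|].
    * apply (wt_rb E (Arr (Arr ss :: ss))). exact Hwf.
    * intros i t Ht. destruct (Hqs i t Ht) as (b & _ & Hc & ->). apply wt_rb. eapply comp_wt; eauto.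
    * constructor. apply sr_nf. eapply sr_C; [| |constructor].
      -- apply er_R. apply (er_rb_idenv E (Arr (Arr ss :: ss))). exact Hwf.
      -- destruct Hwbs as [Hl _]. repeat split; auto; [apply length_clos|].
         intros i t a b Ht Ha Hb. rewrite nth_error_clos in Ha by (eapply nth_error_lt; eauto).
         injection Ha as <-. destruct (Hqs i t Ht) as (b' & Hb' & Hc & ->).
         rewrite Hb in Hb'. injection Hb' as <-. apply er_rb_idenv. eapply comp_wt; eauto.
- eapply comp_unary; [eapply comps_wt; eauto | exact (wt_interp k G (TC f) _ (ht_C k G f)) | reflexivity |].
  exists f. reflexivity.
Qed.

(** Variables are computable, so the fundamental lemma applies in the identity environment; there
    the readback of [interp G M] is [interp G M] itself. *)
Lemma interp_gen k G M t : has_type k G M t -> gen k G (interp G M).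
Proof.
intros HM. pose proof (wt_interp _ _ _ _ HM) as Hw.
eapply gen_peq; [apply reify|].
- apply (fundamental k G M t HM G (fresh 0 (length G))).
  assert (Hid : forall us d, (forall i u, nth_error us i = Some u -> nth_error G (d + i) = Some u) ->
    comps k G us (fresh d (length us))).
  { unfold fresh. induction us as [|u us IH]; intros d H; simpl; constructor.
    - apply reflect. rewrite <- (Nat.add_0_r d). apply H. reflexivity.
    - apply IH. intros i v Hv. replace (S d + i) with (d + S i) by lia. apply H. exact Hv. }
  apply Hid. auto.
- apply peq_sym, rb_idenv, Hw.
Qed.

(** * Generated procedures are denotable *)

Definition apps (M : term) (Ms : list term) : term := fold_left TApp Ms M.
Definition lams (ts : list ty) (M : term) : term := fold_right TLam M ts.

Lemma ht_apps k G Ms ss : Forall2 (has_type k G) Ms ss ->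
  forall M us, has_type k G M (Arr (ss ++ us)) -> has_type k G (apps M Ms) (Arr us).
Proof.
induction 1 as [|M' s Ms ss HM' _ IH]; intros M us HM; [exact HM|].
apply IH. econstructor; eauto.
Qed.

Lemma ht_lams k ts : forall G M us, has_type k (G ++ ts) M (Arr us) ->
  has_type k G (lams ts M) (Arr (ts ++ us)).
Proof.
induction ts as [|s ts IH]; intros G M us HM; simpl.
- rewrite app_nil_r in HM. exact HM.
- apply (ht_lam k G s (lams ts M) (Arr (ts ++ us))). apply IH. rewrite <- app_assoc. exact HM.
Qed.

Lemma interp_lams ts : forall G M us e, interp (G ++ ts) M = Lam us e ->
  interp G (lams ts M) = Lam (ts ++ us) e.
Proof.
induction ts as [|s ts IH]; intros G M us e HM; simpl.
- rewrite app_nil_r in HM. exact HM.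
- rewrite (IH (G ++ [s]) M us e); [reflexivity|]. rewrite <- app_assoc. exact HM.
Qed.

Definition args (G : list ty) (th : list ent) (Ms : list term) : list ent :=
  map (fun M => EC (interp G M) th) Ms.

Lemma wt_args k D G th Ms ss : Forall2 (has_type k G) Ms ss -> wt_env D G th ->
  wt_env D ss (args G th Ms).
Proof.
intros HMs Hth. induction HMs as [|M s Ms ss HM _ IH]; [apply wt_env_nil|].
apply wt_env_cons; auto. eapply wt_EC_env; [eapply wt_interp|]; eauto.
Qed.

Lemma sem_apps k D G th us bs K Ms ss : Forall2 (has_type k G) Ms ss ->
  wt_env D G th -> wt_env D us bs -> wt_k D K ->
  forall M, has_type k G M (Arr (ss ++ us)) ->
  eeq (nf D (SC (EC (interp G (apps M Ms)) th) bs K))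
      (nf D (SC (EC (interp G M) th) (args G th Ms ++ bs) K)).
Proof.
intros HMs Hth Hbs HK. induction HMs as [|M' s Ms ss HM' HMs IH]; intros M HM.
- apply eeq_refl.
- eapply eeq_trans; [apply IH; econstructor; eauto|].
  apply (sem_app D G _ _ s (ss ++ us)); auto.
  + eapply wt_interp; eauto.
  + eapply wt_interp; eauto.
  + apply wt_env_app; auto. eapply wt_args; eauto.
Qed.

Lemma sem_lams k D G th bs ts M K : has_type k (G ++ ts) M N ->
  nf D (SC (EC (interp G (lams ts M)) th) bs K) =
  nf D (SC (EC (interp (G ++ ts) M) (th ++ bs)) [] K).
Proof.
intros HM. pose proof (wt_interp _ _ _ _ HM) as Hw. inversion Hw as [G1 us e He E1 E2 E3]; subst.
rewrite (interp_lams ts G M [] e) by auto.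
rewrite (nf_step D (SC (EC (Lam (ts ++ []) e) th) bs K) (SE e (th ++ bs) K)) by reflexivity.
symmetry. erewrite nf_step; [|reflexivity]. rewrite app_nil_r. reflexivity.
Qed.

Lemma denotable_intro k G M ts e : has_type k G M (Arr ts) ->
  eeq e (nf (G ++ ts) (SC (EC (interp G M) (fresh 0 (length G))) (fresh (length G) (length ts)) [])) ->
  denotable k G (Lam ts e).
Proof.
intros HM He. exists M, (Arr ts). split; auto.
eapply peq_trans; [|apply (rb_idenv G _ (Arr ts)); eapply wt_interp; eauto].
constructor. exact He.
Qed.

Lemma denotable_elim k G ts e : denotable k G (Lam ts e) -> exists M,
  has_type k G M (Arr ts) /\ peq (Lam ts e) (interp G M) /\
  eeq e (nf (G ++ ts) (SC (EC (interp G M) (fresh 0 (length G))) (fresh (length G) (length ts)) [])).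
Proof.
intros (M & t & HM & Hp). pose proof (wt_interp _ _ _ _ HM) as Hw.
assert (Et : t = Arr ts) by (inversion Hp; subst; inversion Hw; congruence). subst t.
exists M. split; auto. split; auto.
pose proof (peq_trans _ _ _ Hp (peq_sym _ _ (rb_idenv G _ _ Hw))) as H.
apply peq_Lam_inv in H. apply H.
Qed.

Lemma denotable_peq k G p p' : denotable k G p -> peq p' p -> denotable k G p'.
Proof. intros (M & t & HM & Hp) H. exists M, t. eauto using peq_trans. Qed.

(** Chooses terms for the finitely many arguments. A denotable procedure determines the type of its
    term by its binders, so [ptype] gives the types required. *)
Lemma denotable_list k G qs ss :
  (forall i, i < length ss -> denotable k G (qs i) /\ ptype (qs i) = nth i ss N) ->
  exists Ms, Forall2 (has_type k G) Ms ss /\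
    forall i, i < length ss -> peq (qs i) (interp G (nth i Ms (TNum 0))).
Proof.
revert qs. induction ss as [|s ss IH]; intros qs Hq.
- exists []. split; [constructor|]. intros i Hi. inversion Hi.
- destruct (IH (fun i => qs (S i))) as (Ms & HMs & Hp).
  { intros i Hi. apply (Hq (S i)). simpl. lia. }
  destruct (Hq 0) as [(M & t & HM & HqM) Ht]; [simpl; lia|].
  exists (M :: Ms). split.
  + constructor; auto. pose proof (wt_interp _ _ _ _ HM) as Hw.
    simpl in Ht. inversion HqM as [us e e' He E1 E2]. rewrite <- E1 in Ht. simpl in Ht. subst s.
    rewrite <- E2 in Hw. inversion Hw; subst. exact HM.
  + intros [|i] Hi; simpl; [exact HqM|]. apply Hp. simpl in Hi. lia.
Qed.

Lemma nth_error_args G th Ms i M :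
  nth_error Ms i = Some M -> nth_error (args G th Ms) i = Some (EC (interp G M) th).
Proof. intros H. unfold args. rewrite nth_error_map, H. reflexivity. Qed.

Lemma wt_ptype G p t : wt_p G p t -> ptype p = t.
Proof. destruct 1; reflexivity. Qed.

Lemma Forall2_nth_error {A B} (R : A -> B -> Prop) l l' i a b :
  Forall2 R l l' -> nth_error l i = Some a -> nth_error l' i = Some b -> R a b.
Proof.
intros H. revert i. induction H as [|x y l l' Hxy _ IH]; intros [|i] Ha Hb; try discriminate.
- injection Ha as <-. injection Hb as <-. exact Hxy.
- exact (IH i Ha Hb).
Qed.

Lemma pw_args_clos k D G th qs Ms ss : Forall2 (has_type k G) Ms ss -> wt_env D G th ->
  (forall i, i < length ss -> peq (qs i) (interp G (nth i Ms (TNum 0)))) ->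
  pw D ss (clos (length ss) qs th) (args G th Ms).
Proof.
intros HMs Hth Hq. pose proof (wt_args _ _ _ _ _ _ HMs Hth) as [Hl _].
destruct (pw_refl _ _ _ Hth) as (H1 & H2 & H3).
repeat split; auto; [apply length_clos|].
intros i t a b Ht Ha Hb. pose proof (nth_error_lt _ _ _ Ht) as Hi.
rewrite nth_error_clos in Ha by auto. injection Ha as <-.
unfold args in Hb. rewrite nth_error_map in Hb.
destruct (nth_error Ms i) as [M|] eqn:HM; [|discriminate]. injection Hb as <-.
specialize (Hq i Hi). rewrite (nth_error_nth _ _ _ HM) in Hq.
eapply er_C; eauto. eapply wt_peq; [|apply peq_sym; exact Hq].
eapply wt_interp. eapply Forall2_nth_error; eauto.
Qed.

(** Realised by applying [x] to terms for the arguments; [sem_var] removes the eta-expansion of the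
    head. *)
Lemma denotable_var k G x ts qs : x < length G -> nth x G N = Arr ts ->
  (forall i, i < length ts -> denotable k G (qs i) /\ ptype (qs i) = nth i ts N) ->
  denotable k G (Lam [] (Case x (length ts) qs (fun j => Num j))).
Proof.
intros Hx Hn Hq. destruct (denotable_list _ _ _ _ Hq) as (Ms & HMs & Hp).
pose proof (nth_error_nth' G N Hx) as Hx'. rewrite Hn in Hx'.
assert (HM : has_type k G (TVar x) (Arr (ts ++ []))).
{ rewrite app_nil_r, <- Hn. constructor. exact Hx. }
apply (denotable_intro k G (apps (TVar x) Ms)); [eapply ht_apps; eauto|].
rewrite app_nil_r. simpl length. apply eeq_sym.
eapply eeq_trans; [eapply sem_apps; eauto; [apply wt_idenv | apply wt_env_nil | constructor]|].
rewrite app_nil_r. simpl. rewrite Hn.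
pose proof (pw_args_clos k G G (fresh 0 (length G)) qs Ms ts HMs (wt_idenv G) Hp) as Hpw.
destruct (sem_var G G (fresh 0 (length G)) x (Arr ts) (args G (fresh 0 (length G)) Ms) ts []
  (wt_idenv G) Hx' eq_refl) as (a & Ha & _ & He); [|constructor|].
{ eapply wt_args; eauto. apply wt_idenv. }
rewrite nth_error_fresh in Ha by auto. injection Ha as <-.
eapply eeq_trans; [exact He|].
eapply eeq_trans.
{ apply eeq_sym, sr_nf. eapply sr_C; [apply er_V; exact Hx' | exact Hpw | constructor]. }
simpl. rewrite (nf_var _ _ _ _ _ Hx'). constructor.
- intros i Hi. rewrite (nth_error_nth _ _ _ (nth_error_clos _ _ _ _ Hi)).
  apply rb_idenv. destruct (Hq i Hi) as [(M & t & HM' & HqM) Ht].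
  pose proof (wt_peq _ _ _ _ (wt_interp _ _ _ _ HM') (peq_sym _ _ HqM)) as Hw.
  rewrite <- Ht, (wt_ptype _ _ _ Hw). exact Hw.
- intros i. rewrite nf_SR_nil. constructor.
Qed.

(** Realised by [TY (Arr ss)] applied to terms for the functional and the [q_i]. By [plug_nf] and
    [sem_Y] both sides are calls of a recursive closure with related contents. *)
Lemma denotable_plug k G ss e qs : lv (Arr ss) <= k ->
  denotable k G (Lam (Arr ss :: ss) e) ->
  (forall i, i < length ss -> denotable k G (qs i) /\ ptype (qs i) = nth i ss N) ->
  denotable k G (plug_result (length G) ss e qs).
Proof.
intros Hlv He Hq. destruct (denotable_list _ _ _ _ Hq) as (Ms & HMs & Hp).
destruct (denotable_elim _ _ _ _ He) as (M & HM & HpM & _).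
pose proof (wt_peq _ _ _ _ (wt_interp _ _ _ _ HM) (peq_sym _ _ HpM)) as HwM.
pose proof (wt_idenv G) as Hid.
eapply denotable_peq; [|apply plug_nf; [exact HwM|]].
2:{ intros i t Ht. pose proof (nth_error_lt _ _ _ Ht) as Hi.
    destruct (Hq i Hi) as [(M' & t' & HM' & HqM) Et].
    pose proof (wt_peq _ _ _ _ (wt_interp _ _ _ _ HM') (peq_sym _ _ HqM)) as Hw.
    rewrite (nth_error_nth _ _ _ Ht), (wt_ptype _ _ _ Hw) in Et. subst t'. exact Hw. }
assert (HY : has_type k G (TY (Arr ss)) (Arr ((Arr (Arr ss :: ss) :: ss) ++ []))).
{ rewrite app_nil_r. apply (ht_Y k G (Arr ss)). exact Hlv. }
assert (HMs' : Forall2 (has_type k G) (M :: Ms) (Arr (Arr ss :: ss) :: ss)) by (constructor; auto).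
apply (denotable_intro k G (apps (TY (Arr ss)) (M :: Ms))); [eapply ht_apps; eauto|].
rewrite app_nil_r. apply eeq_sym.
eapply eeq_trans; [eapply sem_apps; eauto; [apply wt_env_nil | constructor]|].
rewrite app_nil_r. eapply eeq_trans; [apply sem_Y; auto; [| |constructor]|].
- eapply wt_EC_env; [eapply wt_interp|]; eauto.
- eapply wt_args; eauto.
- apply eeq_sym, sr_nf. destruct (pw_refl _ _ _ Hid) as (H1 & H2 & H3).
  eapply sr_C; [apply er_R; eapply er_C; eauto | eapply pw_args_clos; eauto | constructor].
Qed.

(** * Replacing leaves under binders *)

Definition vars (d m : nat) : list term := map TVar (seq d m).

Lemma ht_vars k G ts d : (forall i t, nth_error ts i = Some t -> nth_error G (d + i) = Some t) ->
  Forall2 (has_type k G) (vars d (length ts)) ts.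
Proof.
unfold vars. revert d. induction ts as [|t ts IH]; intros d H; simpl; constructor.
- specialize (H 0 t eq_refl). rewrite Nat.add_0_r in H.
  rewrite <- (nth_error_nth _ _ N H). constructor. eapply nth_error_lt; eauto.
- apply IH. intros i u Hu. replace (S d + i) with (d + S i) by lia. apply H. exact Hu.
Qed.

(* A combinator [lams (As ++ ts) M] applied to terms for the parameters [As] avoids having to
   weaken these terms under the binders [ts]. *)
Lemma denotable_comb k G As ts M Ms e : Forall2 (has_type k G) Ms As ->
  has_type k (G ++ As ++ ts) M N ->
  eeq e (nf (G ++ ts) (SC (EC (interp (G ++ As ++ ts) M)
     (fresh 0 (length G) ++ args G (fresh 0 (length G)) Ms ++ fresh (length G) (length ts))) [] [])) ->
  denotable k G (Lam ts e).
Proof.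
intros HMs HM He.
assert (HL : has_type k G (lams (As ++ ts) M) (Arr (As ++ ts))).
{ rewrite <- (app_nil_r (As ++ ts)) at 2. apply ht_lams. exact HM. }
apply (denotable_intro k G (apps (lams (As ++ ts) M) Ms)); [eapply ht_apps; eauto|].
eapply eeq_trans; [exact He|]. apply eeq_sym.
eapply eeq_trans; [eapply sem_apps; eauto|].
- apply wt_env_weaken, wt_idenv.
- apply wt_fresh.
- constructor.
- erewrite sem_lams by eauto. apply eeq_refl.
Qed.

Lemma wt_comb_env k G As ts Ms : Forall2 (has_type k G) Ms As ->
  wt_env (G ++ ts) (G ++ As ++ ts)
    (fresh 0 (length G) ++ args G (fresh 0 (length G)) Ms ++ fresh (length G) (length ts)).
Proof.
intros HMs. apply wt_env_app; [apply wt_env_weaken, wt_idenv|].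
apply wt_env_app; [apply wt_env_weaken; eapply wt_args; eauto; apply wt_idenv | apply wt_fresh].
Qed.

(** [X] applies the first combinator parameter to the variables bound by [ts]. With [M] supplied for
    that parameter it behaves as the body of [M], the eta-expansions of the variables being absorbed
    by [er_eta]. *)
Lemma comb_head k G A ts M Ms K (As := Arr ts :: A)
  (X := apps (TVar (length G)) (vars (length G + length As) (length ts)))
  (rho := fresh 0 (length G) ++ args G (fresh 0 (length G)) (M :: Ms) ++
          fresh (length G) (length ts)) :
  Forall2 (has_type k G) (M :: Ms) As -> wt_k (G ++ ts) K ->
  has_type k (G ++ As ++ ts) X N /\
  eeq (nf (G ++ ts) (SC (EC (interp (G ++ As ++ ts) X) rho) [] K))
      (nf (G ++ ts) (SC (EC (interp G M) (fresh 0 (length G))) (fresh (length G) (length ts)) K)).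
Proof.
intros HMs HK. pose proof (wt_comb_env k G As ts _ HMs) as Hrho. fold rho in Hrho.
assert (Hv : Forall2 (has_type k (G ++ As ++ ts)) (vars (length G + length As) (length ts)) ts).
{ apply ht_vars. intros i t Ht. rewrite app_assoc, nth_error_app2 by (rewrite length_app; lia).
  rewrite length_app. replace (_ - _) with i by lia. exact Ht. }
assert (Hg : nth_error (G ++ As ++ ts) (length G) = Some (Arr ts)) by apply nth_error_middle.
assert (HM : has_type k (G ++ As ++ ts) (TVar (length G)) (Arr (ts ++ []))).
{ rewrite app_nil_r, <- (nth_error_nth _ _ N Hg). constructor. eapply nth_error_lt; eauto. }
split; [eapply ht_apps; eauto|].
eapply eeq_trans; [eapply sem_apps; eauto; apply wt_env_nil|].
assert (HV : forall v t, nth_error (G ++ As ++ ts) v = Some t ->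
  interp (G ++ As ++ ts) (TVar v) = eta (length rho) v t).
{ intros v t Hvt. rewrite (proj1 Hrho), <- (nth_error_nth _ _ N Hvt). reflexivity. }
rewrite app_nil_r, (HV _ _ Hg). apply sr_nf. eapply sr_C; [| |apply kr_refl, HK].
- eapply er_eta.
  + unfold rho. rewrite nth_error_app2, length_fresh, Nat.sub_diag by (rewrite length_fresh; lia).
    reflexivity.
  + apply er_refl. eapply wt_EC_env; [|apply wt_env_weaken, wt_idenv].
    eapply wt_interp. inversion HMs; eauto.
- repeat split; [| apply length_fresh |].
  { apply (wt_args k _ _ _ _ _ Hv Hrho). }
  intros i t a b Ht Ha Hb. pose proof (nth_error_lt _ _ _ Ht) as Hi.
  rewrite nth_error_fresh in Hb by auto. injection Hb as <-.
  rewrite (nth_error_args _ _ _ _ (TVar (length G + length As + i))) in Ha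
    by (unfold vars; rewrite nth_error_map, nth_error_seq_lt by auto; reflexivity).
  assert (Hn : nth_error (G ++ As ++ ts) (length G + length As + i) = Some t).
  { rewrite app_assoc, nth_error_app2 by (rewrite length_app; lia).
    rewrite length_app. replace (_ - _) with i by lia. exact Ht. }
  rewrite (HV _ _ Hn) in Ha. injection Ha as <-. eapply er_eta.
  + pose proof (wt_args _ _ _ _ _ _ HMs (wt_idenv G)) as [Hl _].
    unfold rho. rewrite app_assoc, nth_error_app2 by (rewrite length_app, length_fresh, Hl; simpl; lia).
    rewrite length_app, length_fresh, Hl. simpl length. replace (_ - _) with i by (simpl; lia).
    apply nth_error_fresh. exact Hi.
  + apply er_V. rewrite nth_error_app2 by lia. replace (_ - _) with i by lia. exact Ht.
Qed.

(** The witness applies [TC f] to the saturated call [X]; its [case] frame acts on the leaves by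
    [nf_frame]. *)
Lemma denotable_fun k G p f : denotable k G p ->
  denotable k G (repl_p (fun i => opt_num (f i)) p).
Proof.
destruct p as [ts e]. intros He. destruct (denotable_elim _ _ _ _ He) as (M & HM & _ & HeM).
simpl. assert (HMs : Forall2 (has_type k G) [M] [Arr ts]) by (constructor; auto).
set (X := apps (TVar (length G)) (vars (length G + length [Arr ts]) (length ts))).
pose proof (wt_comb_env k G _ ts _ HMs) as Hrho.
set (rho := fresh 0 _ ++ _) in Hrho. set (G' := G ++ [Arr ts] ++ ts) in *.
assert (HX : has_type k G' X N) by (eapply (comb_head k G [] ts M [] []); [exact HMs | constructor]).
apply (denotable_comb k G [Arr ts] ts (TApp (TC f) X) [M]); auto.
{ eapply ht_app; [constructor | exact HX]. }
fold rho G'. apply eeq_sym.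
eapply eeq_trans.
{ apply (sem_app _ G' (interp G' (TC f)) (interp G' X) N []); auto;
   [exact (wt_interp k G' (TC f) _ (ht_C k G' f)) | eapply wt_interp; eauto
   | apply wt_env_nil | constructor]. }
simpl (interp G' (TC f)). erewrite nf_step; [|reflexivity].
erewrite nf_step; [|simpl; rewrite <- (proj1 Hrho), nth_error_middle; reflexivity].
eapply eeq_trans.
{ apply (comb_head k G [] ts M []); auto. apply (wt_k_cons _ (G' ++ [N])); [|apply wt_env_app; [exact Hrho|]|constructor].
  - intros i. destruct (f i); constructor.
  - apply wt_env_cons; [|apply wt_env_nil]. eapply wt_EC_env; [eapply wt_interp|]; eauto. }
match goal with |- eeq (nf _ (SC ?a ?b [?F])) _ =>
  change (SC a b [F]) with (sapp (SC a b []) [F]) end.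
eapply eeq_trans; [apply nf_frame|]. apply repl_e_eeq; [|apply eeq_sym, HeM].
intros i. erewrite nf_opt_frame by reflexivity. apply eeq_refl.
Qed.

(** The witness applies [TIfz] to the saturated call [X] and to two ground parameters, which stand
    for the terms of [d] and [e']. *)
Lemma denotable_ifz k G ts e d e' : denotable k G (Lam ts e) -> denotable k G (Lam [] d) ->
  denotable k G (Lam [] e') ->
  denotable k G (repl_p (fun i => match i with
                                  | 0 => ren_e (shift (length G) (length ts)) d
                                  | S _ => ren_e (shift (length G) (length ts)) e'
                                  end) (Lam ts e)).
Proof.
intros He Hd He'. destruct (denotable_elim _ _ _ _ He) as (M & HM & _ & HeM).
destruct (denotable_elim _ _ _ _ Hd) as (M1 & HM1 & _ & HdM).
destruct (denotable_elim _ _ _ _ He') as (M2 & HM2 & _ & HeM').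
rewrite app_nil_r in HdM, HeM'. simpl fresh in HdM, HeM'. simpl repl_p.
set (As := [Arr ts; N; N]).
assert (HMs : Forall2 (has_type k G) [M; M1; M2] As) by (repeat constructor; auto).
set (X := apps (TVar (length G)) (vars (length G + length As) (length ts))).
pose proof (wt_comb_env k G _ ts _ HMs) as Hrho.
set (rho := fresh 0 _ ++ _) in Hrho. set (G' := G ++ As ++ ts) in *.
assert (HX : has_type k G' X N)
  by (eapply (comb_head k G [N; N] ts M [M1; M2] []); [exact HMs | constructor]).
set (V1 := TVar (length G + 1)). set (V2 := TVar (length G + 2)).
assert (Hn1 : nth_error G' (length G + 1) = Some N).
{ unfold G'. rewrite nth_error_app2 by lia. replace (_ - _) with 1 by lia. reflexivity. }
assert (Hn2 : nth_error G' (length G + 2) = Some N).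
{ unfold G'. rewrite nth_error_app2 by lia. replace (_ - _) with 2 by lia. reflexivity. }
assert (HV1 : has_type k G' V1 N).
{ unfold V1. rewrite <- (nth_error_nth _ _ N Hn1). constructor. eapply nth_error_lt; eauto. }
assert (HV2 : has_type k G' V2 N).
{ unfold V2. rewrite <- (nth_error_nth _ _ N Hn2). constructor. eapply nth_error_lt; eauto. }
assert (HXs : Forall2 (has_type k G') [X; V1; V2] [N; N; N]) by (repeat constructor; auto).
apply (denotable_comb k G As ts (apps TIfz [X; V1; V2]) [M; M1; M2]); auto.
{ apply (ht_apps k G' _ _ HXs). constructor. }
fold rho G'. apply eeq_sym.
eapply eeq_trans.
{ eapply sem_apps; eauto; [apply wt_env_nil | constructor | constructor]. }
pose proof (wt_args k _ _ _ _ _ HXs Hrho) as Hargs. rewrite app_nil_r.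
simpl (interp G' TIfz). erewrite nf_step; [|reflexivity].
set (rho' := rho ++ args G' rho [X; V1; V2]).
assert (Hrho' : wt_env (G ++ ts) (G' ++ [N; N; N]) rho') by (apply wt_env_app; auto).
assert (Hx0 : nth_error rho' (length G') = Some (EC (interp G' X) rho))
  by (rewrite <- (proj1 Hrho); apply nth_error_middle).
erewrite nf_step; [|cbn [step]; rewrite Hx0; reflexivity].
set (B := fun i : nat => match i with 0 => _ | S _ => _ end).
assert (HB : forall i, wt_e (G' ++ [N; N; N]) (B i)).
{ intros [|i]; (apply wt_ground_var; [rewrite nth_error_app2 by lia | intros; constructor]).
  - replace (_ - _) with 1 by lia. reflexivity.
  - replace (_ - _) with 2 by lia. reflexivity. }
eapply eeq_trans.
{ apply (comb_head k G [N; N] ts M [M1; M2]); auto. econstructor; [exact HB | exact Hrho' | constructor]. }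
match goal with |- eeq (nf _ (SC ?a ?b [?F])) _ =>
  change (SC a b [F]) with (sapp (SC a b []) [F]) end.
eapply eeq_trans; [apply nf_frame|]. apply repl_e_eeq; [|apply eeq_sym, HeM].
(* A branch runs a term over [G] in the context [G ++ ts]; by [nf_weaken] its readback is shifted
   exactly as in rule 5. *)
assert (Hvar : forall j v M' d', nth_error G' v = Some N ->
  nth_error [X; V1; V2] j = Some (TVar v) ->
  nth_error rho v = Some (EC (interp G M') (fresh 0 (length G))) ->
  has_type k G M' N -> eeq d' (nf G (SC (EC (interp G M') (fresh 0 (length G))) [] [])) ->
  eeq (nf (G ++ ts) (SE (Case (length G' + j) 0 dummy (fun i => Num i)) rho' []))
      (ren_e (shift (length G) (length ts)) d')).
{ intros j v M' d' Hv Hj Hr HM' Hd'.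
  erewrite nf_step.
  2:{ simpl. unfold rho'. rewrite nth_error_app2 by (rewrite (proj1 Hrho); lia).
      rewrite (proj1 Hrho). replace (_ - _) with j by lia.
      rewrite (nth_error_args _ _ _ _ _ Hj). reflexivity. }
  assert (Hwv : wt_ent (G ++ ts) N (EC (interp G' (TVar v)) rho)).
  { eapply wt_EC_env; [|exact Hrho]. apply (wt_interp k).
    rewrite <- (nth_error_nth _ _ N Hv). constructor. eapply nth_error_lt; eauto. }
  eapply eeq_trans; [apply nf_id_frame, Hwv|]. simpl interp. rewrite (nth_error_nth _ _ N Hv).
  destruct (sem_var _ _ _ _ _ [] [] [] Hrho Hv eq_refl (wt_env_nil _) (wt_k_nil _))
    as (a & Ha & _ & Hea).
  rewrite Hr in Ha. injection Ha as <-. eapply eeq_trans; [exact Hea|].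
  eapply eeq_trans; [apply nf_weaken|].
  - eapply wt_SC; [eapply wt_EC_env; [eapply wt_interp; exact HM' | apply wt_idenv]
      | apply wt_env_nil | constructor].
  - apply ren_e_eeq, eeq_sym, Hd'. }
assert (Hrn : forall i M', nth_error [M; M1; M2] i = Some M' ->
  nth_error rho (length G + i) = Some (EC (interp G M') (fresh 0 (length G)))).
{ intros i M' Hi. unfold rho. rewrite nth_error_app2, length_fresh by (rewrite length_fresh; lia).
  replace (_ - _) with i by lia. apply nth_error_weaken, nth_error_args, Hi. }
intros [|i]; (erewrite nf_step; [|reflexivity]).
- apply (Hvar 1 (length G + 1) M1); auto.
- apply (Hvar 2 (length G + 2) M2); auto.
Qed.

(* The premises of [gen] occur under a conjunction, out of reach of the derived induction
   principle. *)
Lemma gen_denotable k G p : gen k G p -> denotable k G p.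
Proof.
revert G p. fix IH 3. intros G p H.
destruct H as [G x ts qs q Hx Hn Hq Hp | G s q q' Hq Hp | G n q Hp | G q f q' Hq Hp
  | G ts e d e' q' He Hd He' Hp | G ss e qs q' Hl He Hq Hp];
  (eapply denotable_peq; [|exact Hp]).
- apply denotable_var; [exact Hx | exact Hn |].
  intros i Hi. destruct (Hq i Hi) as [Hg Ht]. split; [exact (IH _ _ Hg) | exact Ht].
- destruct (IH _ _ Hq) as (M & t & HM & HqM). exists (TLam s M), (arrow s t).
  split; [constructor; exact HM|]. simpl. destruct HqM. constructor. assumption.
- exists (TNum n), N. split; [constructor | apply peq_refl].
- apply denotable_fun. exact (IH _ _ Hq).
- apply denotable_ifz; [exact (IH _ _ He) | exact (IH _ _ Hd) | exact (IH _ _ He')].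
- apply denotable_plug; [exact Hl | exact (IH _ _ He) |].
  intros i Hi. destruct (Hq i Hi) as [Hg Ht]. split; [exact (IH _ _ Hg) | exact Ht].
Qed.

Theorem theorem3p8 (k : nat) (hk : 1 <= k) (G : list ty) (p : proc) :
  denotable k G p <-> gen k G p.
Proof.
split; [|apply gen_denotable].
intros (M & t & HM & Hp). eapply gen_peq; [eapply interp_gen; eauto | exact Hp].
Qed.
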